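(* A meromorphic function $f$ on $\mathbb{C}$ with divisor $D=((a_n),(b_n))$ belongs to ${\cal N}_1$ if and only if: (a) for every $\delta>0$ there is $C_\delta<\infty$ with $1/C_\delta\le|f(z)|\le C_\delta$ for all $z\notin A(\delta)$; (b) $\inf_{n,k}|a_n-b_k|>0$; there is $C_0$ with ${\rm card}\{n:|a_n-c|\le1\}+{\rm card}\{n:|b_n-c|\le1\}<C_0$ for all $c\in\mathbb{C}$; and there is $R_0<\infty$ such that every disc $B(w,R_0)$, $w\in\mathbb{C}$, contains some $a_n$ and some $b_k$.
   Context: $\rho_S$ is the spherical metric. A meromorphic $f$ on $\mathbb{C}$ is normal if every sequence $(h_n)\subset\mathbb{C}$ has a subsequence $(h_{n'})$ with $\rho_S(f(z+h_{n'}),f(z+h_{m'}))\to0$ uniformly on compacta; $f\in{\cal N}_1$ if $f$ is normal and no limit (uniform on compacta in $\rho_S$) of translates $f(z+h_n)$ is constant (including $\infty$). The divisor lists zeros $a_n$ and poles $b_n$ with multiplicity. $A(\delta)=\bigcup_nB(a_n,\delta)\cup\bigcup_nB(b_n,\delta)$, $B(c,r)=\{|z-c|<r\}$. *)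

(* Defs.v *)
From Stdlib Require Import Reals Lra List.
Open Scope R_scope.

Definition Cplx : Type := (R * R)%type.
Definition Cadd (z w : Cplx) : Cplx := (fst z + fst w, snd z + snd w).
Definition Copp (z : Cplx) : Cplx := (- fst z, - snd z).
Definition Csub (z w : Cplx) : Cplx := Cadd z (Copp w).
Definition Cmul (z w : Cplx) : Cplx :=
  (fst z * fst w - snd z * snd w, fst z * snd w + snd z * fst w).
Definition Cinv (z : Cplx) : Cplx :=
  (fst z / (fst z ^ 2 + snd z ^ 2), - snd z / (fst z ^ 2 + snd z ^ 2)).
Definition Cdiv (z w : Cplx) : Cplx := Cmul z (Cinv w).
Definition Czero : Cplx := (0, 0).
Definition C1 : Cplx := (1, 0).
Fixpoint Cpow (z : Cplx) (n : nat) : Cplx :=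
  match n with O => C1 | S k => Cmul z (Cpow z k) end.
Definition Cnorm (z : Cplx) : R := sqrt (fst z ^ 2 + snd z ^ 2).

Definition C_differentiable (g : Cplx -> Cplx) (z : Cplx) : Prop :=
  exists l : Cplx, forall eps, eps > 0 -> exists del, del > 0 /\
    forall h : Cplx, 0 < Cnorm h < del ->
      Cnorm (Csub (Cdiv (Csub (g (Cadd z h)) (g z)) h) l) < eps.

Definition holo_on_disc (g : Cplx -> Cplx) (z0 : Cplx) (r : R) : Prop :=
  forall z, Cnorm (Csub z z0) < r -> C_differentiable g z.

(* Functions into the Riemann sphere: None stands for infinity. *)
Definition sphere := option Cplx.

Definition meromorphic (f : Cplx -> sphere) : Prop :=
  (forall z0, exists r, r > 0 /\ exists g : Cplx -> Cplx, holo_on_disc g z0 r /\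
     ((forall z, Cnorm (Csub z z0) < r -> f z = Some (g z)) \/
      (forall z, Cnorm (Csub z z0) < r ->
         f z = (if Req_EM_T (fst (g z)) 0 then
                  if Req_EM_T (snd (g z)) 0 then None else Some (Cinv (g z))
                else Some (Cinv (g z)))))) /\
  (exists z, f z <> None).

Definition is_zero_of_order (f : Cplx -> sphere) (z0 : Cplx) (k : nat) : Prop :=
  (1 <= k)%nat /\ exists r, r > 0 /\ exists g : Cplx -> Cplx,
    holo_on_disc g z0 r /\ g z0 <> Czero /\
    forall z, Cnorm (Csub z z0) < r -> f z = Some (Cmul (Cpow (Csub z z0) k) (g z)).

Definition is_pole_of_order (f : Cplx -> sphere) (z0 : Cplx) (k : nat) : Prop :=
  (1 <= k)%nat /\ f z0 = None /\ exists r, r > 0 /\ exists g : Cplx -> Cplx,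
    holo_on_disc g z0 r /\ g z0 <> Czero /\
    forall z, Cnorm (Csub z z0) < r -> z <> z0 ->
      f z = Some (Cdiv (g z) (Cpow (Csub z z0) k)).

Definition is_zero (f : Cplx -> sphere) (a : Cplx) : Prop := exists k, is_zero_of_order f a k.
Definition is_pole (f : Cplx -> sphere) (b : Cplx) : Prop := exists k, is_pole_of_order f b k.

Definition inA (f : Cplx -> sphere) (delta : R) (z : Cplx) : Prop :=
  exists c, (is_zero f c \/ is_pole f c) /\ Cnorm (Csub z c) < delta.

Definition rhoS (u v : sphere) : R :=
  match u, v with
  | Some z, Some w => 2 * Cnorm (Csub z w) /
                      sqrt ((1 + Cnorm z ^ 2) * (1 + Cnorm w ^ 2))
  | Some z, None | None, Some z => 2 / sqrt (1 + Cnorm z ^ 2)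
  | None, None => 0
  end.

Definition translate (f : Cplx -> sphere) (h : Cplx) : Cplx -> sphere :=
  fun z => f (Cadd z h).

(* uniform Cauchy / convergence on compacta, w.r.t. rhoS (compacta are
   contained in closed discs |z| <= Rad) *)
Definition ucc_cauchy (F : nat -> Cplx -> sphere) : Prop :=
  forall Rad eps, eps > 0 -> exists N, forall n m, (N <= n)%nat -> (N <= m)%nat ->
    forall z, Cnorm z <= Rad -> rhoS (F n z) (F m z) < eps.

Definition ucc_conv (F : nat -> Cplx -> sphere) (g : Cplx -> sphere) : Prop :=
  forall Rad eps, eps > 0 -> exists N, forall n, (N <= n)%nat ->
    forall z, Cnorm z <= Rad -> rhoS (F n z) (g z) < eps.

Definition strictly_increasing (phi : nat -> nat) : Prop :=
  forall n m, (n < m)%nat -> (phi n < phi m)%nat.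

Definition normal (f : Cplx -> sphere) : Prop :=
  forall h : nat -> Cplx, exists phi, strictly_increasing phi /\
    ucc_cauchy (fun n => translate f (h (phi n))).

Definition in_N1 (f : Cplx -> sphere) : Prop :=
  normal f /\
  forall (h : nat -> Cplx) (g : Cplx -> sphere),
    ucc_conv (fun n => translate f (h n)) g -> ~ (exists c : sphere, forall z, g z = c).

Definition total_mult (l : list (Cplx * nat)) : nat :=
  fold_right (fun p s => (snd p + s)%nat) 0%nat l.

(* Main.v *)
(** A limit function that vanishes on a small disc vanishes everywhere, and for translates of [f] this
    can be made quantitative: normality makes [f] uniformly continuous for the spherical metric, so [f]
    is holomorphic and bounded by 1 on a disc of fixed radius about each point where it is small, and
    the three circles estimate carries smallness from disc to disc.  Hence, for [f] in N_1 and [s > 0],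
    [f] cannot be arbitrarily small on discs of radius [s], and neither can [1/f].
    This yields (a) by Hurwitz's theorem; the bound on the multiplicities, since dividing out [N] zeros
    clustered in a disc makes [f] of size [2^-N] there; and the relative density, since on huge discs
    free of zeros [1/f] is bounded, hence almost constant by Cauchy's estimate.
    Conversely, few zeros and poles in a disc leave room for a circle avoiding A(delta), where [f] is
    bounded above and below; near a point with no pole (resp. zero) close by, the maximum principle and
    Cauchy's estimate for [f] (resp. [1/f]) give equicontinuity, and Arzela-Ascoli gives normality.
    Limits are not constant because every translate has a zero and a pole in a fixed disc.
    Everything rests on Goursat's theorem applied to [F o exp] on a rectangle of height 2 pi, which
    shows that circle means of [F] do not depend on the radius. *)

From Coquelicot Require Import Coquelicot.
Require Import Defs.
From Stdlib Require Import Reals List Lia Lra Classical ClassicalEpsilon FunctionalExtensionality.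
Import Complex.
Open Scope R_scope.

(** * Complex differentiability *)

(** Values in the sphere leave no global holomorphic function to work with: holomorphic tools apply
    only on discs where f or 1/f is known to be bounded. Inversion is an isometry of [rhoS] and
    preserves N_1, so the estimates are proved for zeros and small values only, and [flip] transfers
    them to poles and large values. On |z| = r one has dz = i z dt, hence Cauchy's integral of F(z)
    / (z - w) is, up to a factor i, the integral of F(z) z / (z - w) over the angle. The local
    theory is written with such angular integrals and uses that they do not depend on the radius.
    Higher derivatives and power series do not occur: Cauchy's estimate becomes a Lipschitz bound at
    the centre, and the order of a zero is found by repeated division by z. Goursat's argument wants
    differentiability everywhere, but the difference quotient of F at w is at first only continuous
    at w. This is why the mean value property is proved with exceptional points. *)

Definition cont (F : C -> C) (z : C) : Prop :=
  forall eps, 0 < eps -> exists del, 0 < del /\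
    forall y, Cmod (y - z) < del -> Cmod (F y - F z) < eps.

(* Caratheodory's form of differentiability: the difference quotient extends continuously, so that the
   differentiation rules become algebraic identities. *)
Definition ex_der (F : C -> C) (z : C) : Prop :=
  exists q : C -> C, cont q z /\ forall y, F y = (F z + q y * (y - z))%C.

Definition Ceq_dec (z w : C) : {z = w} + {z <> w} :=
  excluded_middle_informative (z = w).

(** The value l at y = z stands for the derivative: continuity of this function at z says that F is
    differentiable there with derivative l. *)
Definition slope (F : C -> C) (z l : C) (y : C) : C :=
  if Ceq_dec y z then l else ((F y - F z) / (y - z))%C.

Lemma Csub_eq_0 (z w : C) : (z - w)%C = 0 -> z = w.
Proof. intros H. replace z with ((z - w) + w)%C by ring. rewrite H. ring. Qed.

Lemma Csub_neq_0 (z w : C) : z <> w -> (z - w)%C <> 0.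
Proof. intros H E. apply H, Csub_eq_0, E. Qed.

Lemma Cmod_sub_self (z : C) : Cmod (z - z) = 0.
Proof. replace (z - z)%C with (RtoC 0) by ring. apply Cmod_0. Qed.

Lemma Cmod_sub_sym (z w : C) : Cmod (z - w) = Cmod (w - z).
Proof. rewrite <- Cmod_opp. f_equal. ring. Qed.

Lemma Cmod_sub_0 (z : C) : Cmod (z - 0) = Cmod z.
Proof. f_equal. ring. Qed.

Lemma Cmod_sub_triangle (x y z : C) : Cmod (x - z) <= Cmod (x - y) + Cmod (y - z).
Proof. replace (x - z)%C with ((x - y) + (y - z))%C by ring. apply Cmod_triangle. Qed.

Lemma Cmod_triangle_minus (x y : C) : Cmod (x - y) <= Cmod x + Cmod y.
Proof. unfold Cminus. rewrite <- (Cmod_opp y). apply Cmod_triangle. Qed.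

Lemma Cmod_triangle_inv (x y : C) : Cmod x - Cmod y <= Cmod (x - y).
Proof.
  pose proof (Cmod_triangle (x - y) y). replace (x - y + y)%C with x in H by ring. lra.
Qed.

Lemma cont_const (c z : C) : cont (fun _ => c) z.
Proof.
  intros e He; exists 1; split; [lra|]; intros y _. rewrite Cmod_sub_self; lra.
Qed.

Lemma cont_id (z : C) : cont (fun y => y) z.
Proof. intros e He; exists e; auto. Qed.

Lemma cont_ext_loc (F G : C -> C) (z : C) (r : R) :
  0 < r -> (forall y, Cmod (y - z) < r -> F y = G y) -> cont F z -> cont G z.
Proof.
  intros Hr E H e He. destruct (H e He) as [d [Hd K]].
  exists (Rmin r d). split; [now apply Rmin_pos|].
  intros y Hy. rewrite <- E, <- E.
  - apply K. eapply Rlt_le_trans; [apply Hy|apply Rmin_r].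
  - rewrite Cmod_sub_self; lra.
  - eapply Rlt_le_trans; [apply Hy|apply Rmin_l].
Qed.

Lemma cont_ext (F G : C -> C) (z : C) : (forall y, F y = G y) -> cont F z -> cont G z.
Proof. intros E. apply (cont_ext_loc F G z 1); auto. lra. Qed.

Lemma cont_plus (F G : C -> C) (z : C) :
  cont F z -> cont G z -> cont (fun y => F y + G y)%C z.
Proof.
  intros HF HG e He.
  destruct (HF (e/2)) as [d1 [Hd1 K1]]; [lra|].
  destruct (HG (e/2)) as [d2 [Hd2 K2]]; [lra|].
  exists (Rmin d1 d2); split; [now apply Rmin_pos|]. intros y Hy.
  pose proof (Rmin_l d1 d2). pose proof (Rmin_r d1 d2).
  specialize (K1 y ltac:(lra)). specialize (K2 y ltac:(lra)).
  replace (F y + G y - (F z + G z))%C with ((F y - F z) + (G y - G z))%C by ring.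
  pose proof (Cmod_triangle (F y - F z) (G y - G z)). lra.
Qed.

Lemma cont_mult (F G : C -> C) (z : C) :
  cont F z -> cont G z -> cont (fun y => F y * G y)%C z.
Proof.
  intros HF HG e He.
  set (A := Cmod (F z) + Cmod (G z) + 1).
  assert (HA : 0 < A) by (unfold A; pose proof (Cmod_ge_0 (F z)); pose proof (Cmod_ge_0 (G z)); lra).
  (* Both increments will be below m; as m <= 1, their product is below m too, and the three terms
     of the expansion add up to at most m * A <= e / 2. *)
  assert (Hm : 0 < Rmin 1 (e / (2 * A))).
  { apply Rmin_pos; [lra|]. apply Rdiv_lt_0_compat; lra. }
  set (m := Rmin 1 (e / (2 * A))) in *.
  destruct (HF m Hm) as [d1 [Hd1 K1]]. destruct (HG m Hm) as [d2 [Hd2 K2]].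
  exists (Rmin d1 d2); split; [now apply Rmin_pos|]. intros y Hy.
  pose proof (Rmin_l d1 d2). pose proof (Rmin_r d1 d2).
  specialize (K1 y ltac:(lra)). specialize (K2 y ltac:(lra)).
  assert (m <= 1) by apply Rmin_l. assert (m <= e / (2 * A)) by apply Rmin_r.
  assert (m * A <= e / 2).
  { replace (e/2) with (e / (2 * A) * A) by (field; lra). apply Rmult_le_compat_r; lra. }
  replace (F y * G y - F z * G z)%C with
    ((F y - F z) * (G y - G z) + (F y - F z) * G z + F z * (G y - G z))%C by ring.
  pose proof (Cmod_triangle ((F y - F z) * (G y - G z) + (F y - F z) * G z) (F z * (G y - G z))).
  pose proof (Cmod_triangle ((F y - F z) * (G y - G z)) ((F y - F z) * G z)).
  rewrite !Cmod_mult in *.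
  pose proof (Cmod_ge_0 (F z)); pose proof (Cmod_ge_0 (G z)).
  pose proof (Cmod_ge_0 (F y - F z)); pose proof (Cmod_ge_0 (G y - G z)).
  unfold A in *. nra.
Qed.

Lemma cont_inv (F : C -> C) (z : C) :
  F z <> 0 -> cont F z -> cont (fun y => / F y)%C z.
Proof.
  intros H0 HF e He.
  assert (Ha : 0 < Cmod (F z)) by now apply Cmod_gt_0.
  set (a := Cmod (F z)) in *.
  (* The first bound keeps |F y| above a / 2, so the denominator F y * F z exceeds a * a / 2 in
     modulus; the second bound is e times that. *)
  assert (Hm : 0 < Rmin (a/2) (e * a * a / 2)).
  { apply Rmin_pos; [lra|]. assert (0 < e * a) by nra. nra. }
  destruct (HF _ Hm) as [d [Hd K]]. exists d; split; auto. intros y Hy. specialize (K y Hy).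
  pose proof (Rmin_l (a/2) (e * a * a / 2)). pose proof (Rmin_r (a/2) (e * a * a / 2)).
  pose proof (Cmod_triangle_inv (F z) (F y)) as T. rewrite Cmod_sub_sym in T. fold a in T.
  assert (Hb : a / 2 < Cmod (F y)) by lra.
  assert (F y <> 0) by (apply Cmod_gt_0; lra).
  replace (/ F y - / F z)%C with (- (F y - F z) / (F y * F z))%C by (field; auto).
  rewrite Cmod_div, Cmod_opp, Cmod_mult by (apply Cmult_neq_0; auto). fold a.
  apply Rlt_div_l; [nra|].
  apply Rlt_le_trans with (e * a * a / 2); [lra|].
  assert (0 < e * a) by nra. nra.
Qed.

Lemma cont_comp (F G : C -> C) (z : C) :
  cont G z -> cont F (G z) -> cont (fun y => F (G y)) z.
Proof.
  intros HG HF e He. destruct (HF e He) as [d [Hd K]]. destruct (HG d Hd) as [d' [Hd' K']].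
  exists d'; split; auto.
Qed.

Lemma cont_opp (F : C -> C) (z : C) : cont F z -> cont (fun y => - F y)%C z.
Proof.
  intros H. apply cont_ext with (fun y => (-(1)) * F y)%C; [intros; ring|].
  apply cont_mult; auto using cont_const.
Qed.

Lemma cont_minus (F G : C -> C) (z : C) :
  cont F z -> cont G z -> cont (fun y => F y - G y)%C z.
Proof. intros. apply cont_plus; auto using cont_opp. Qed.

Lemma ex_der_cont (F : C -> C) (z : C) : ex_der F z -> cont F z.
Proof.
  intros [q [Hq E]]. apply cont_ext with (fun y => F z + q y * (y - z))%C; auto.
  apply cont_plus; [apply cont_const|]. apply cont_mult; auto.
  apply cont_minus; auto using cont_id, cont_const.
Qed.

Lemma ex_der_slope (F : C -> C) (z : C) : ex_der F z -> exists l, cont (slope F z l) z.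
Proof.
  intros [q [Hq E]]. exists (q z). apply cont_ext with q; auto.
  intros y; unfold slope. destruct (Ceq_dec y z) as [->|H]; auto.
  rewrite (E y). field. now apply Csub_neq_0.
Qed.

Lemma slope_spec (F : C -> C) (z l y : C) : F y = (F z + slope F z l y * (y - z))%C.
Proof.
  unfold slope. destruct (Ceq_dec y z) as [->|H]; [ring|].
  field. now apply Csub_neq_0.
Qed.

Lemma slope_ex_der (F : C -> C) (z l : C) : cont (slope F z l) z -> ex_der F z.
Proof. intros H. exists (slope F z l); split; auto using slope_spec. Qed.

Lemma ex_der_ext_loc (F G : C -> C) (z : C) (r : R) :
  0 < r -> (forall y, Cmod (y - z) < r -> F y = G y) -> ex_der F z -> ex_der G z.
Proof.
  intros Hr E H. destruct (ex_der_slope F z H) as [l Hl].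
  apply slope_ex_der with l. apply cont_ext_loc with (slope F z l) r; auto.
  intros y Hy; unfold slope. destruct (Ceq_dec y z); auto.
  rewrite <- !E; auto. rewrite Cmod_sub_self; lra.
Qed.

Lemma ex_der_ext (F G : C -> C) (z : C) : (forall y, F y = G y) -> ex_der F z -> ex_der G z.
Proof. intros E. apply (ex_der_ext_loc F G z 1); auto. lra. Qed.

Lemma ex_der_const (c z : C) : ex_der (fun _ => c) z.
Proof. exists (fun _ => 0%C); split; [apply cont_const|]. intros; ring. Qed.

Lemma ex_der_id (z : C) : ex_der (fun y => y) z.
Proof. exists (fun _ => 1%C); split; [apply cont_const|]. intros; ring. Qed.

Lemma ex_der_plus (F G : C -> C) (z : C) :
  ex_der F z -> ex_der G z -> ex_der (fun y => F y + G y)%C z.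
Proof.
  intros [q [Hq E]] [p [Hp E']]. exists (fun y => q y + p y)%C; split; [now apply cont_plus|].
  intros y. rewrite (E y), (E' y). ring.
Qed.

Lemma ex_der_mult (F G : C -> C) (z : C) :
  ex_der F z -> ex_der G z -> ex_der (fun y => F y * G y)%C z.
Proof.
  intros HF HG. generalize (ex_der_cont _ _ HF). destruct HF as [q [Hq E]], HG as [p [Hp E']].
  intros cF. exists (fun y => q y * G z + F y * p y)%C; split.
  - apply cont_plus; apply cont_mult; auto using cont_const.
  - intros y. rewrite (E' y), (E y). ring.
Qed.

Lemma ex_der_opp (F : C -> C) (z : C) : ex_der F z -> ex_der (fun y => - F y)%C z.
Proof.
  intros H. apply ex_der_ext with (fun y => (-(1)) * F y)%C; [intros; ring|].
  apply ex_der_mult; auto using ex_der_const.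
Qed.

Lemma ex_der_minus (F G : C -> C) (z : C) :
  ex_der F z -> ex_der G z -> ex_der (fun y => F y - G y)%C z.
Proof. intros. apply ex_der_plus; auto using ex_der_opp. Qed.

Lemma cont_neq_0 (F : C -> C) (z : C) :
  F z <> 0 -> cont F z -> exists r, 0 < r /\ forall y, Cmod (y - z) < r -> F y <> 0.
Proof.
  intros H0 HF. assert (Ha : 0 < Cmod (F z)) by now apply Cmod_gt_0.
  destruct (HF _ Ha) as [d [Hd K]]. exists d; split; auto. intros y Hy E.
  specialize (K y Hy). rewrite E in K.
  replace (0 - F z)%C with (- F z)%C in K by ring. rewrite Cmod_opp in K. lra.
Qed.

Lemma ex_der_inv (F : C -> C) (z : C) :
  F z <> 0 -> ex_der F z -> ex_der (fun y => / F y)%C z.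
Proof.
  intros H0 HF. generalize (ex_der_cont _ _ HF). intros cF.
  destruct (cont_neq_0 F z H0 cF) as [r [Hr Hn]].
  destruct (ex_der_slope F z HF) as [l Hl].
  apply slope_ex_der with (- l / (F z * F z))%C.
  apply cont_ext_loc with (fun y => - slope F z l y * / (F y * F z))%C r; auto.
  - intros y Hy. specialize (Hn y Hy). unfold slope. destruct (Ceq_dec y z) as [->|D]; [reflexivity|].
    assert (y - z <> 0)%C by now apply Csub_neq_0. field; auto.
  - apply cont_mult; [now apply cont_opp|]. apply cont_inv; [now apply Cmult_neq_0|].
    apply cont_mult; auto using cont_const.
Qed.

Lemma ex_der_div (F G : C -> C) (z : C) :
  G z <> 0 -> ex_der F z -> ex_der G z -> ex_der (fun y => F y / G y)%C z.
Proof. intros. apply ex_der_mult; auto using ex_der_inv. Qed.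

Lemma ex_der_pow (F : C -> C) (z : C) (n : nat) :
  ex_der F z -> ex_der (fun y => F y ^ n)%C z.
Proof. intros H; induction n; [apply (ex_der_const 1)|]. apply (ex_der_mult F (fun y => F y ^ n)%C); auto. Qed.

Lemma ex_der_comp (F G : C -> C) (z : C) :
  ex_der G z -> ex_der F (G z) -> ex_der (fun y => F (G y)) z.
Proof.
  intros HG. generalize (ex_der_cont _ _ HG). destruct HG as [p [Hp Ep]]. intros cG [q [Hq Eq]].
  exists (fun y => q (G y) * p y)%C; split.
  - apply cont_mult; auto. now apply (cont_comp q G).
  - intros y. rewrite (Eq (G y)). rewrite (Ep y) at 2. ring.
Qed.

Lemma Cplus_sub_cancel (z h : C) : (z + h - z)%C = h.
Proof. ring. Qed.

Lemma Csub_diag (z : C) : (z - z)%C = 0.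
Proof. ring. Qed.

Lemma Cplus_sub (z y : C) : (z + (y - z))%C = y.
Proof. ring. Qed.

Lemma C_differentiable_iff (F : C -> C) (z : C) : C_differentiable F z <-> ex_der F z.
Proof.
  split.
  - intros [l Hl]. apply slope_ex_der with l. intros e He. destruct (Hl e He) as [d [Hd K]].
    exists d; split; auto. intros y Hy. unfold slope at 2.
    destruct (Ceq_dec z z) as [_|N]; [|now elim N]. unfold slope.
    destruct (Ceq_dec y z) as [->|D]; [rewrite Cmod_sub_self; lra|].
    (* The two sets of complex operations are convertible, so [change] passes from one to the
       other. *)
    specialize (K (y - z)%C). change Cnorm with Cmod in K.
    change Defs.Csub with Cminus in K. change Defs.Cdiv with Cdiv in K. change Cadd with Cplus in K.
    rewrite Cplus_sub in K. apply K. split; auto.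
    apply Cmod_gt_0, Csub_neq_0, D.
  - intros H. destruct (ex_der_slope _ _ H) as [l Hl]. exists l. intros e He.
    destruct (Hl e He) as [d [Hd K]]. exists d; split; auto. intros h Hh.
    change Cnorm with Cmod in *. change Defs.Csub with Cminus. change Defs.Cdiv with Cdiv.
    change Cadd with Cplus.
    specialize (K (z + h)%C). rewrite Cplus_sub_cancel in K. specialize (K (proj2 Hh)).
    unfold slope in K. destruct (Ceq_dec z z) as [_|N]; [|now elim N].
    assert (H0 : h <> RtoC 0) by (apply Cmod_gt_0, Hh).
    destruct (Ceq_dec (z + h) z) as [D|D].
    + exfalso; apply H0. rewrite <- (Cplus_sub_cancel z h), D. apply Csub_diag.
    + rewrite Cplus_sub_cancel in K. exact K.
Qed.

(** * Goursat's theorem on rectangles *)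

Definition contR (f : R -> C) (t : R) : Prop :=
  forall eps, 0 < eps -> exists del, 0 < del /\
    forall s, Rabs (s - t) < del -> Cmod (f s - f t) < eps.

Definition isInt (f : R -> C) (a b : R) (I : C) : Prop := @is_RInt C_R_NormedModule f a b I.

Definition CInt (f : R -> C) (a b : R) : C := @RInt C_R_CompleteNormedModule f a b.

Lemma contR_continuous (f : R -> C) (t : R) :
  contR f t -> @continuous R_UniformSpace C_R_NormedModule f t.
Proof.
  intros H. apply (proj2 (filterlim_locally (U:=C_R_NormedModule) f (f t))). intros eps.
  destruct (H eps (cond_pos eps)) as [d [Hd K]].
  exists (mkposreal d Hd). intros s Hs. apply C_NormedModule_mixin_compat1. apply K, Hs.
Qed.

Lemma CInt_correct (f : R -> C) (a b : R) :
  a <= b -> (forall t, a <= t <= b -> contR f t) -> isInt f a b (CInt f a b).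
Proof.
  intros Hab H. apply (RInt_correct (V:=C_R_CompleteNormedModule)).
  apply (ex_RInt_continuous (V:=C_R_CompleteNormedModule)).
  intros t Ht. apply contR_continuous, H. now rewrite Rmin_left, Rmax_right in Ht.
Qed.

Lemma CInt_unique (f : R -> C) (a b : R) (I : C) : isInt f a b I -> CInt f a b = I.
Proof. apply (is_RInt_unique (V:=C_R_CompleteNormedModule)). Qed.

Lemma CInt_ext (f g : R -> C) (a b : R) :
  (forall t, Rmin a b < t < Rmax a b -> f t = g t) -> CInt f a b = CInt g a b.
Proof. apply (RInt_ext (V:=C_R_CompleteNormedModule)). Qed.

Lemma isInt_plus (f g : R -> C) (a b : R) (I J : C) :
  isInt f a b I -> isInt g a b J -> isInt (fun t => f t + g t)%C a b (I + J)%C.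
Proof. apply (is_RInt_plus (V:=C_R_NormedModule)). Qed.

Lemma isInt_Chasles (f : R -> C) (a b c : R) (I J : C) :
  isInt f a b I -> isInt f b c J -> isInt f a c (I + J)%C.
Proof. apply (is_RInt_Chasles (V:=C_R_NormedModule)). Qed.

Lemma isInt_components (f : R -> C) (a b : R) (I : C) :
  isInt f a b I <->
  is_RInt (fun t => fst (f t)) a b (fst I) /\ is_RInt (fun t => snd (f t)) a b (snd I).
Proof.
  split.
  - intros H; split.
    + now apply (is_RInt_fct_extend_fst (U:=R_NormedModule) (V:=R_NormedModule)).
    + now apply (is_RInt_fct_extend_snd (U:=R_NormedModule) (V:=R_NormedModule)).
  - intros [H K]. rewrite (surjective_pairing I).
    now apply (is_RInt_fct_extend_pair (U:=R_NormedModule) (V:=R_NormedModule)).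
Qed.

(** Integration takes place in C as a normed module over R, whose scalars are real; a complex factor
    is therefore treated by components. *)
Lemma isInt_scal (c : C) (f : R -> C) (a b : R) (I : C) :
  isInt f a b I -> isInt (fun t => c * f t)%C a b (c * I)%C.
Proof.
  intros H; apply isInt_components in H; destruct H as [H K]. apply isInt_components; split; simpl.
  - apply (is_RInt_minus (V:=R_NormedModule));
      apply (is_RInt_scal (V:=R_NormedModule)); auto.
  - apply (is_RInt_plus (V:=R_NormedModule));
      apply (is_RInt_scal (V:=R_NormedModule)); auto.
Qed.

Lemma isInt_minus (f g : R -> C) (a b : R) (I J : C) :
  isInt f a b I -> isInt g a b J -> isInt (fun t => f t - g t)%C a b (I - J)%C.
Proof. apply (is_RInt_minus (V:=C_R_NormedModule)). Qed.

Lemma isInt_const (c : C) (a b : R) : isInt (fun _ => c) a b (RtoC (b - a) * c)%C.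
Proof.
  apply isInt_components; split; simpl.
  - replace ((b - a) * fst c - 0 * snd c) with ((b - a) * fst c) by ring.
    apply (is_RInt_const (V:=R_NormedModule)).
  - replace ((b - a) * snd c + 0 * fst c) with ((b - a) * snd c) by ring.
    apply (is_RInt_const (V:=R_NormedModule)).
Qed.

Lemma isInt_bound (f : R -> C) (a b M : R) (I : C) :
  a <= b -> (forall t, a <= t <= b -> Cmod (f t) <= M) -> isInt f a b I ->
  Cmod I <= (b - a) * M.
Proof.
  intros Hab H HI. rewrite Cmod_norm.
  apply (norm_RInt_le_const (V:=C_R_NormedModule) f a b I M Hab); auto.
  intros t Ht. specialize (H t Ht). now rewrite Cmod_norm in H.
Qed.

Lemma contR_line (G : C -> C) (g : R -> C) (t : R) :
  contR g t -> cont G (g t) -> contR (fun s => G (g s)) t.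
Proof.
  intros Hg HG e He. destruct (HG e He) as [d [Hd K]]. destruct (Hg d Hd) as [d' [Hd' K']].
  exists d'; split; auto.
Qed.

Lemma contR_re (y t : R) : contR (fun s => (s, y)) t.
Proof.
  intros e He. exists e; split; auto. intros s Hs.
  replace ((s, y) - (t, y))%C with (RtoC (s - t)) by (unfold RtoC, Cminus, Cplus, Copp; simpl; f_equal; ring).
  now rewrite Cmod_R.
Qed.

Lemma contR_im (x t : R) : contR (fun s => (x, s)) t.
Proof.
  intros e He. exists e; split; auto. intros s Hs.
  replace ((x, s) - (x, t))%C with (Ci * RtoC (s - t))%C
    by (unfold RtoC, Ci, Cminus, Cplus, Copp, Cmult; simpl; f_equal; ring).
  now rewrite Cmod_mult, Cmod_Ci, Cmod_R, Rmult_1_l.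
Qed.

(** The integral of G dz along the boundary of [a, b] x [c, d], counterclockwise: dz is dx on the
    horizontal sides and i dy on the vertical ones. *)
Definition rectI (G : C -> C) (a b c d : R) : C :=
  (CInt (fun x => G (x, c)) a b + Ci * CInt (fun y => G (b, y)) c d
   - CInt (fun x => G (x, d)) a b - Ci * CInt (fun y => G (a, y)) c d)%C.

Definition cont_box (G : C -> C) (a b c d : R) : Prop :=
  forall x y, a <= x <= b -> c <= y <= d -> cont G (x, y).

Lemma hI_correct (G : C -> C) (a b c d a' b' y : R) :
  cont_box G a b c d -> a <= a' -> a' <= b' -> b' <= b -> c <= y <= d ->
  isInt (fun x => G (x, y)) a' b' (CInt (fun x => G (x, y)) a' b').
Proof.
  intros H H1 H2 H3 H4. apply CInt_correct; auto. intros t Ht.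
  apply (contR_line G (fun s => (s, y))); [apply contR_re|]. apply H; lra.
Qed.

Lemma vI_correct (G : C -> C) (a b c d c' d' x : R) :
  cont_box G a b c d -> c <= c' -> c' <= d' -> d' <= d -> a <= x <= b ->
  isInt (fun y => G (x, y)) c' d' (CInt (fun y => G (x, y)) c' d').
Proof.
  intros H H1 H2 H3 H4. apply CInt_correct; auto. intros t Ht.
  apply (contR_line G (fun s => (x, s))); [apply contR_im|]. apply H; lra.
Qed.

Lemma rectI_split_x (G : C -> C) (a m b c d : R) :
  a <= m -> m <= b -> c <= d -> cont_box G a b c d ->
  rectI G a b c d = (rectI G a m c d + rectI G m b c d)%C.
Proof.
  intros H1 H2 H3 H. unfold rectI.
  assert (E : forall y, c <= y <= d -> CInt (fun x => G (x, y)) a b =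
     (CInt (fun x => G (x, y)) a m + CInt (fun x => G (x, y)) m b)%C).
  { intros y Hy. apply CInt_unique. apply isInt_Chasles with m; eapply hI_correct; eauto; lra. }
  rewrite !E by lra. ring.
Qed.

Lemma rectI_split_y (G : C -> C) (a b c m d : R) :
  a <= b -> c <= m -> m <= d -> cont_box G a b c d ->
  rectI G a b c d = (rectI G a b c m + rectI G a b m d)%C.
Proof.
  intros H1 H2 H3 H. unfold rectI.
  assert (E : forall x, a <= x <= b -> CInt (fun y => G (x, y)) c d =
     (CInt (fun y => G (x, y)) c m + CInt (fun y => G (x, y)) m d)%C).
  { intros x Hx. apply CInt_unique. apply isInt_Chasles with m; eapply vI_correct; eauto; lra. }
  rewrite !E by lra. ring.
Qed.

Lemma rectI_minus (F G : C -> C) (a b c d : R) :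
  a <= b -> c <= d -> cont_box F a b c d -> cont_box G a b c d ->
  rectI (fun z => F z - G z)%C a b c d = (rectI F a b c d - rectI G a b c d)%C.
Proof.
  intros H1 H2 HF HG. unfold rectI.
  assert (E : forall y, c <= y <= d -> CInt (fun x => F (x, y) - G (x, y))%C a b =
     (CInt (fun x => F (x, y)) a b - CInt (fun x => G (x, y)) a b)%C).
  { intros y Hy. apply CInt_unique, isInt_minus; eapply hI_correct; eauto; lra. }
  assert (E' : forall x, a <= x <= b -> CInt (fun y => F (x, y) - G (x, y))%C c d =
     (CInt (fun y => F (x, y)) c d - CInt (fun y => G (x, y)) c d)%C).
  { intros y Hy. apply CInt_unique, isInt_minus; eapply vI_correct; eauto; lra. }
  rewrite !E, !E' by lra. ring.
Qed.

Lemma rectI_bound (G : C -> C) (a b c d e : R) :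
  a <= b -> c <= d -> cont_box G a b c d ->
  (forall x y, a <= x <= b -> c <= y <= d -> Cmod (G (x, y)) <= e) ->
  Cmod (rectI G a b c d) <= 2 * ((b - a) + (d - c)) * e.
Proof.
  intros H1 H2 H B. unfold rectI.
  assert (E : forall y, c <= y <= d -> Cmod (CInt (fun x => G (x, y)) a b) <= (b - a) * e).
  { intros y Hy. apply isInt_bound with (fun x => G (x, y)); auto. eapply hI_correct; eauto; lra. }
  assert (E' : forall x, a <= x <= b -> Cmod (CInt (fun y => G (x, y)) c d) <= (d - c) * e).
  { intros x Hx. apply isInt_bound with (fun y => G (x, y)); auto. eapply vI_correct; eauto; lra. }
  pose proof (E c ltac:(lra)). pose proof (E d ltac:(lra)).
  pose proof (E' a ltac:(lra)). pose proof (E' b ltac:(lra)).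
  eapply Rle_trans; [apply Cmod_triangle_minus|].
  rewrite Cmod_mult, Cmod_Ci.
  eapply Rle_trans; [apply Rplus_le_compat_r, Cmod_triangle_minus|].
  eapply Rle_trans; [apply Rplus_le_compat_r, Rplus_le_compat_r, Cmod_triangle|].
  rewrite Cmod_mult, Cmod_Ci. lra.
Qed.

Lemma is_RInt_affine (u v a b : R) :
  is_RInt (fun x => u + v * x) a b (u * (b - a) + v * (b ^ 2 - a ^ 2) / 2).
Proof.
  replace (u * (b - a) + v * (b ^ 2 - a ^ 2) / 2) with
    (minus (u * b + v * b ^ 2 / 2) (u * a + v * a ^ 2 / 2))
    by (unfold minus, plus, opp; simpl; field).
  apply (is_RInt_derive (V:=R_CompleteNormedModule) (fun x => u * x + v * x ^ 2 / 2)).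
  - intros x _. auto_derive; auto. field.
  - intros x _. apply (ex_derive_continuous (V:=R_NormedModule)). auto_derive; auto.
Qed.

Lemma CInt_affine (p q : C) (a b : R) :
  CInt (fun t => p + q * RtoC t)%C a b =
  (p * RtoC (b - a) + q * RtoC ((b ^ 2 - a ^ 2) / 2))%C.
Proof.
  apply CInt_unique, isInt_components; split; simpl.
  - eapply is_RInt_ext; [|apply (eq_ind _ _ (is_RInt_affine (fst p) (fst q) a b))].
    + intros; simpl; ring.
    + field.
  - eapply is_RInt_ext; [|apply (eq_ind _ _ (is_RInt_affine (snd p) (snd q) a b))].
    + intros; simpl; ring.
    + field.
Qed.

(** Goursat's argument subtracts the tangent polynomial of G; its contribution is computed outright
    on each side, without a theory of primitives. *)
Lemma rectI_affine (p q : C) (a b c d : R) :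
  rectI (fun z => p + q * z)%C a b c d = 0.
Proof.
  unfold rectI.
  assert (X : forall y a b, CInt (fun x => p + q * (x, y))%C a b =
     ((p + q * (Ci * RtoC y)) * RtoC (b - a) + q * RtoC ((b ^ 2 - a ^ 2) / 2))%C).
  { intros. rewrite <- CInt_affine. apply CInt_ext. intros x _.
    unfold Ci, RtoC, Cplus, Cmult; simpl; f_equal; ring. }
  assert (Y : forall x a b, CInt (fun y => p + q * (x, y))%C a b =
     ((p + q * RtoC x) * RtoC (b - a) + (q * Ci) * RtoC ((b ^ 2 - a ^ 2) / 2))%C).
  { intros. rewrite <- CInt_affine. apply CInt_ext. intros y _.
    unfold Ci, RtoC, Cplus, Cmult; simpl; f_equal; ring. }
  rewrite !X, !Y. unfold Ci, RtoC, Cplus, Cmult, Cminus, Copp, Cplus; simpl; f_equal; ring.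
Qed.

Lemma Cmod_le_sum (z : C) : Cmod z <= Rabs (fst z) + Rabs (snd z).
Proof.
  destruct z as [x y]. replace (x, y) with (RtoC x + Ci * RtoC y)%C
    by (unfold Ci, RtoC, Cplus, Cmult; simpl; f_equal; ring).
  eapply Rle_trans; [apply Cmod_triangle|]. rewrite Cmod_mult, Cmod_Ci, !Cmod_R. simpl.
  apply Req_le. rewrite Rmult_1_l. f_equal; f_equal; ring.
Qed.

Section Goursat.
Variables (G : C -> C) (a c w h : R).
Hypothesis Hw : 0 < w.
Hypothesis Hh : 0 < h.
Hypothesis HG : forall x y, a <= x <= a + w -> c <= y <= c + h -> ex_der G (x, y).

Let u (n : nat) : R := (/ 2) ^ n.

(** A rectangle of generation n has sides w 2^-n and h 2^-n, so its lower left corner p determines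
    it. *)
Let inside (n : nat) (p : R * R) : Prop :=
  a <= fst p /\ fst p + w * u n <= a + w /\ c <= snd p /\ snd p + h * u n <= c + h.

(** The factor is 4^-n: the integral has lost no more than the area has. *)
Let big (n : nat) (p : R * R) : Prop :=
  Cmod (rectI G a (a + w) c (c + h)) * (u n * u n) <=
  Cmod (rectI G (fst p) (fst p + w * u n) (snd p) (snd p + h * u n)).

Let next (n : nat) (p p' : R * R) : Prop :=
  fst p <= fst p' /\ fst p' + w * u (S n) <= fst p + w * u n /\
  snd p <= snd p' /\ snd p' + h * u (S n) <= snd p + h * u n.

Lemma half_pow_pos (n : nat) : 0 < u n.
Proof. apply pow_lt; lra. Qed.

Lemma half_pow_S (n : nat) : u (S n) = u n / 2.
Proof. unfold u; simpl; lra. Qed.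

Lemma inside_cont_box (n : nat) (p : R * R) :
  inside n p -> cont_box G (fst p) (fst p + w * u n) (snd p) (snd p + h * u n).
Proof. intros [H1 [H2 [H3 H4]]] x y Hx Hy. apply ex_der_cont, HG; lra. Qed.

(** One of the four quarters carries at least a quarter of the integral. The hypotheses stand under
    the existential so that [choice] yields a total step function. *)
Lemma bisect_step (n : nat) (p : R * R) :
  exists p', inside n p -> big n p -> inside (S n) p' /\ big (S n) p' /\ next n p p'.
Proof.
  destruct (classic (inside n p /\ big n p)) as [[Hi Hb]|N]; [|exists p; tauto].
  pose proof (half_pow_pos n) as Hu.
  destruct p as [x y]. pose proof (inside_cont_box n _ Hi) as HC.
  unfold big in Hb. destruct Hi as [H1 [H2 [H3 H4]]]. unfold fst, snd in *.
  assert (wu : 0 < w * u n) by nra. assert (hu : 0 < h * u n) by nra.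
  set (w' := w * u n / 2). set (h' := h * u n / 2).
  assert (E : rectI G x (x + w * u n) y (y + h * u n) =
    (rectI G x (x + w') y (y + h') + rectI G x (x + w') (y + h') (y + h' + h')
     + (rectI G (x + w') (x + w' + w') y (y + h') +
        rectI G (x + w') (x + w' + w') (y + h') (y + h' + h')))%C).
  { replace (x + w * u n) with (x + w' + w') in * by (unfold w'; lra).
    replace (y + h * u n) with (y + h' + h') in * by (unfold h'; lra).
    assert (0 < w') by (unfold w'; lra). assert (0 < h') by (unfold h'; lra).
    assert (Hsub : forall a' b' c' d', x <= a' -> b' <= x + w' + w' -> y <= c' ->
      d' <= y + h' + h' -> cont_box G a' b' c' d') by (intros; intros s t Hs Ht; apply HC; lra).
    rewrite (rectI_split_x G x (x + w')), (rectI_split_y G x (x + w') y (y + h')),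
      (rectI_split_y G (x + w') (x + w' + w') y (y + h')); try lra; auto; apply Hsub; lra. }
  set (K := Cmod (rectI G a (a + w) c (c + h))) in *.
  rewrite E in Hb.
  set (I1 := rectI G x (x + w') y (y + h')) in *.
  set (I2 := rectI G x (x + w') (y + h') (y + h' + h')) in *.
  set (I3 := rectI G (x + w') (x + w' + w') y (y + h')) in *.
  set (I4 := rectI G (x + w') (x + w' + w') (y + h') (y + h' + h')) in *.
  pose proof (Cmod_triangle (I1 + I2) (I3 + I4)).
  pose proof (Cmod_triangle I1 I2). pose proof (Cmod_triangle I3 I4).
  assert (Ew : w * u (S n) = w') by (rewrite half_pow_S; unfold w'; lra).
  assert (Eh : h * u (S n) = h') by (rewrite half_pow_S; unfold h'; lra).
  assert (Ek : K * (u (S n) * u (S n)) = K * (u n * u n) / 4) by (rewrite half_pow_S; field).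
  assert (D : K * (u n * u n) / 4 <= Cmod I1 \/ K * (u n * u n) / 4 <= Cmod I2 \/
              K * (u n * u n) / 4 <= Cmod I3 \/ K * (u n * u n) / 4 <= Cmod I4).
  { destruct (Rle_dec (K * (u n * u n) / 4) (Cmod I1)); auto.
    destruct (Rle_dec (K * (u n * u n) / 4) (Cmod I2)); auto.
    destruct (Rle_dec (K * (u n * u n) / 4) (Cmod I3)); auto. right; right; right. lra. }
  destruct D as [D|[D|[D|D]]];
    [exists (x, y)|exists (x, y + h')|exists (x + w', y)|exists (x + w', y + h')];
    intros _ _; unfold inside, big, next, fst, snd; rewrite Ew, Eh, Ek;
    (split; [unfold w', h'; lra|split; [exact D|unfold w', h'; lra]]).
Qed.

(** The chosen quarters shrink to a point p near which G differs from its tangent polynomial by at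
    most e |z - p|. Perimeter and distance to p are both of order 2^-n, so the n-th integral is at
    most a constant times e 4^-n, against the lower bound K 4^-n. *)
Theorem goursat : rectI G a (a + w) c (c + h) = 0.
Proof.
  destruct (choice (fun (q : nat * (R * R)) p' => inside (fst q) (snd q) -> big (fst q) (snd q) ->
     inside (S (fst q)) p' /\ big (S (fst q)) p' /\ next (fst q) (snd q) p')) as [st Hst].
  { intros [n p]. apply bisect_step. }
  set (s := fix s (n : nat) : R * R := match n with O => (a, c) | S k => st (k, s k) end).
  assert (Hs : forall n, inside n (s n) /\ big n (s n)).
  { induction n as [|n [IH1 IH2]].
    - split; unfold inside, big; simpl; unfold u; simpl; rewrite ?Rmult_1_r; lra.
    - destruct (Hst (n, s n) IH1 IH2) as [A [B _]]. split; auto. }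
  assert (Hn : forall n, next n (s n) (s (S n))).
  { intros n. destruct (Hs n) as [A B]. now destruct (Hst (n, s n) A B) as [_ [_ D]]. }
  assert (Hmono : forall n k, fst (s n) <= fst (s (n + k)%nat) /\
      fst (s (n + k)%nat) + w * u (n + k) <= fst (s n) + w * u n /\
      snd (s n) <= snd (s (n + k)%nat) /\
      snd (s (n + k)%nat) + h * u (n + k) <= snd (s n) + h * u n).
  { intros n; induction k as [|k IH]; [rewrite Nat.add_0_r; lra|].
    rewrite Nat.add_succ_r. pose proof (Hn (n + k)%nat) as [? [? [? ?]]]. lra. }
  assert (Hx : forall m n, fst (s m) <= fst (s n) + w * u n).
  { intros m n. pose proof (half_pow_pos m). pose proof (half_pow_pos n).
    assert (0 < w * u m) by nra. assert (0 < w * u n) by nra.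
    destruct (Nat.le_ge_cases m n) as [L|L].
    - destruct (Hmono m (n - m)%nat) as [Q _]. replace (m + (n - m))%nat with n in Q by lia. lra.
    - destruct (Hmono n (m - n)%nat) as [_ [Q _]]. replace (n + (m - n))%nat with m in Q by lia. lra. }
  assert (Hy : forall m n, snd (s m) <= snd (s n) + h * u n).
  { intros m n. pose proof (half_pow_pos m). pose proof (half_pow_pos n).
    assert (0 < h * u m) by nra. assert (0 < h * u n) by nra.
    destruct (Nat.le_ge_cases m n) as [L|L].
    - destruct (Hmono m (n - m)%nat) as [_ [_ [Q _]]]. replace (m + (n - m))%nat with n in Q by lia. lra.
    - destruct (Hmono n (m - n)%nat) as [_ [_ [_ Q]]]. replace (n + (m - n))%nat with m in Q by lia. lra. }
  (* The suprema of the left and of the lower coordinates form a point common to all rectangles. *)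
  destruct (completeness (fun x => exists n, x = fst (s n))) as [px [Px1 Px2]].
  { exists (fst (s 0%nat) + w * u 0). intros x [n ->]. apply Hx. }
  { exists (fst (s 0%nat)). now exists 0%nat. }
  destruct (completeness (fun x => exists n, x = snd (s n))) as [py [Py1 Py2]].
  { exists (snd (s 0%nat) + h * u 0). intros x [n ->]. apply Hy. }
  { exists (snd (s 0%nat)). now exists 0%nat. }
  assert (Bx : forall n, fst (s n) <= px <= fst (s n) + w * u n).
  { intros n; split; [apply Px1; now exists n|]. apply Px2. intros x [m ->]; apply Hx. }
  assert (By : forall n, snd (s n) <= py <= snd (s n) + h * u n).
  { intros n; split; [apply Py1; now exists n|]. apply Py2. intros x [m ->]; apply Hy. }
  set (p := (px, py) : C).
  assert (Dp : ex_der G p).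
  { destruct (Hs 0%nat) as [[? [? [? ?]]] _]. pose proof (Bx 0%nat). pose proof (By 0%nat).
    apply HG; lra. }
  destruct Dp as [q [Hq Eq]].
  set (K := Cmod (rectI G a (a + w) c (c + h))).
  assert (HK : forall e, 0 < e -> K <= e * (2 * (w + h) * (w + h))).
  { intros e He. destruct (Hq e He) as [del [Hdel B]].
    (* (w + h) 2^-n bounds the distance from p to the points of the n-th rectangle; it has to fall
       below del. *)
    destruct (pow_lt_1_zero (/2) ltac:(rewrite Rabs_pos_eq; lra) (del / (w + h))
      ltac:(apply Rdiv_lt_0_compat; lra)) as [n Hn'].
    specialize (Hn' n (le_n n)). fold (u n) in Hn'.
    pose proof (half_pow_pos n) as Hu. rewrite Rabs_pos_eq in Hn' by lra.
    apply Rlt_div_r in Hn'; [|lra].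
    destruct (Hs n) as [Hi Hb]. unfold big in Hb. fold K in Hb.
    pose proof (inside_cont_box n _ Hi) as HC.
    set (x0 := fst (s n)) in *. set (y0 := snd (s n)) in *.
    specialize (Bx n). specialize (By n). fold x0 in Bx. fold y0 in By.
    assert (wu : 0 < w * u n) by nra. assert (hu : 0 < h * u n) by nra.
    set (A := fun z : C => ((G p - q p * p) + q p * z)%C).
    assert (CA : cont_box A x0 (x0 + w * u n) y0 (y0 + h * u n)).
    { intros x y _ _. apply cont_plus; [apply cont_const|].
      apply cont_mult; auto using cont_const, cont_id. }
    assert (E : rectI G x0 (x0 + w * u n) y0 (y0 + h * u n) =
       rectI (fun z => G z - A z)%C x0 (x0 + w * u n) y0 (y0 + h * u n)).
    { rewrite rectI_minus; auto; try lra. unfold A. rewrite rectI_affine. ring. }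
    assert (Bd : Cmod (rectI G x0 (x0 + w * u n) y0 (y0 + h * u n)) <=
       2 * ((x0 + w * u n - x0) + (y0 + h * u n - y0)) * (e * ((w + h) * u n))).
    { rewrite E. apply rectI_bound; try lra.
      - intros x y Hx' Hy'. apply cont_minus; [apply HC|apply CA]; lra.
      - intros x y Hx' Hy'.
        assert (Dz : Cmod ((x, y) - p) <= (w + h) * u n).
        { eapply Rle_trans; [apply Cmod_le_sum|]. simpl.
          assert (Rabs (x + - px) <= w * u n) by (apply Rabs_le; lra).
          assert (Rabs (y + - py) <= h * u n) by (apply Rabs_le; lra). lra. }
        unfold A. rewrite (Eq (x, y)).
        replace (G p + q (x, y) * ((x, y) - p) - (G p - q p * p + q p * (x, y)))%C
          with ((q (x, y) - q p) * ((x, y) - p))%C by ring.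
        rewrite Cmod_mult. apply Rmult_le_compat; auto using Cmod_ge_0.
        left; apply B. lra. }
    assert (Hu2 : 0 < u n * u n) by nra.
    apply Rmult_le_reg_r with (u n * u n); auto.
    eapply Rle_trans; [apply Hb|]. eapply Rle_trans; [apply Bd|].
    apply Req_le. ring. }
  apply Cmod_eq_0. apply Rle_antisym; [|apply Cmod_ge_0]. fold K.
  apply Rnot_lt_le. intros Kpos.
  assert (W : 0 < 2 * (w + h) * (w + h)) by nra.
  specialize (HK (K / 2 / (2 * (w + h) * (w + h))) ltac:(apply Rdiv_lt_0_compat; lra)).
  replace (K / 2 / (2 * (w + h) * (w + h)) * (2 * (w + h) * (w + h))) with (K / 2) in HK
    by (field; lra). lra.
Qed.
End Goursat.

(** * Means over circles *)

Definition expC (z : C) : C := (exp (fst z) * cos (snd z), exp (fst z) * sin (snd z)).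

Definition circ (r t : R) : C := (r * cos t, r * sin t).

Lemma expC_plus (z w : C) : expC (z + w) = (expC z * expC w)%C.
Proof.
  destruct z as [a b], w as [c d]. unfold expC, Cplus, Cmult; simpl.
  rewrite exp_plus, cos_plus, sin_plus. f_equal; ring.
Qed.

Lemma Rabs_fst_le (z : C) : Rabs (fst z) <= Cmod z.
Proof. eapply Rle_trans; [|apply Rmax_Cmod]. apply Rmax_l. Qed.

Lemma Rabs_snd_le (z : C) : Rabs (snd z) <= Cmod z.
Proof. eapply Rle_trans; [|apply Rmax_Cmod]. apply Rmax_r. Qed.

Lemma derivable_pt_lim_0_bound (f : R -> R) (l e : R) :
  derivable_pt_lim f 0 l -> 0 < e -> exists d, 0 < d /\
  forall x, Rabs x < d -> Rabs (f x - f 0 - l * x) <= e * Rabs x.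
Proof.
  intros H He. destruct (H e He) as [d K]. exists d; split; [apply cond_pos|]. intros x Hx.
  destruct (Req_dec x 0) as [->|N].
  - rewrite Rmult_0_r, Rminus_0_r, Rminus_diag, Rabs_R0. lra.
  - specialize (K x N Hx). rewrite Rplus_0_l in K.
    replace (f x - f 0 - l * x) with (((f x - f 0) / x - l) * x) by (field; auto).
    rewrite Rabs_mult. apply Rmult_le_compat_r; [apply Rabs_pos|lra].
Qed.

Lemma expC_at_0 (e : R) : 0 < e -> exists d, 0 < d /\
  forall z, Cmod z < d -> Cmod (expC z - 1 - z) <= e * Cmod z.
Proof.
  (* With m = |z| the error terms below are at most 2 k m and k m in each of the two coordinates, 6
     k m in all. *)
  intros He. set (k := Rmin 1 (e / 6)).
  assert (Hk : 0 < k) by (apply Rmin_pos; lra).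
  assert (k <= 1) by apply Rmin_l. assert (k <= e / 6) by apply Rmin_r.
  destruct (derivable_pt_lim_0_bound exp 1 k) as [d1 [Hd1 K1]]; auto.
  { rewrite <- exp_0. apply derivable_pt_lim_exp. }
  destruct (derivable_pt_lim_0_bound cos 0 k) as [d2 [Hd2 K2]]; auto.
  { replace 0 with (- sin 0) at 2 by (rewrite sin_0; ring). apply derivable_pt_lim_cos. }
  destruct (derivable_pt_lim_0_bound sin 1 k) as [d3 [Hd3 K3]]; auto.
  { rewrite <- cos_0. apply derivable_pt_lim_sin. }
  set (d := Rmin (Rmin d1 d2) (Rmin d3 (k / 2))).
  exists d. assert (Hd : 0 < d) by (repeat apply Rmin_pos; lra).
  assert (d <= d1) by (eapply Rle_trans; apply Rmin_l).
  assert (d <= d2) by (eapply Rle_trans; [apply Rmin_l|apply Rmin_r]).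
  assert (d <= d3) by (eapply Rle_trans; [apply Rmin_r|apply Rmin_l]).
  assert (d <= k / 2) by (eapply Rle_trans; [apply Rmin_r|apply Rmin_r]).
  split; auto. intros z Hz.
  pose proof (Rabs_fst_le z) as Hx. pose proof (Rabs_snd_le z) as Hy.
  specialize (K1 (fst z) ltac:(lra)). specialize (K2 (snd z) ltac:(lra)).
  specialize (K3 (snd z) ltac:(lra)).
  rewrite exp_0 in K1. rewrite cos_0 in K2. rewrite sin_0 in K3.
  eapply Rle_trans; [apply Cmod_le_sum|]. simpl.
  set (x := fst z) in *. set (y := snd z) in *. set (m := Cmod z) in *.
  assert (Hm : 0 <= m) by apply Cmod_ge_0.
  assert (E1 : Rabs (exp x - 1) <= k).
  { replace (exp x - 1) with ((exp x - 1 - 1 * x) + x) by ring.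
    eapply Rle_trans; [apply Rabs_triang|]. nra. }
  assert (E2 : 0 < exp x <= 2).
  { split; [apply exp_pos|]. apply Rabs_le_between in E1. lra. }
  replace (exp x * cos y + - (1) + - x) with (exp x * (cos y - 1 - 0 * y) + (exp x - 1 - 1 * x)) by ring.
  replace (exp x * sin y + - 0 + - y) with (exp x * (sin y - 0 - 1 * y) + (exp x - 1) * y) by ring.
  pose proof (Rabs_triang (exp x * (cos y - 1 - 0 * y)) (exp x - 1 - 1 * x)).
  pose proof (Rabs_triang (exp x * (sin y - 0 - 1 * y)) ((exp x - 1) * y)).
  rewrite !Rabs_mult, (Rabs_pos_eq (exp x)) in * by lra.
  assert (exp x * Rabs (cos y - 1 - 0 * y) <= 2 * (k * m)).
  { apply Rmult_le_compat; try lra; [apply Rabs_pos|]. nra. }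
  assert (exp x * Rabs (sin y - 0 - 1 * y) <= 2 * (k * m)).
  { apply Rmult_le_compat; try lra; [apply Rabs_pos|]. nra. }
  assert (Rabs (exp x - 1) * Rabs y <= k * m).
  { apply Rmult_le_compat; try lra; apply Rabs_pos. }
  nra.
Qed.

Lemma expC_0 : expC 0 = 1.
Proof. unfold expC, RtoC; simpl. rewrite exp_0, cos_0, sin_0. f_equal; ring. Qed.

(** The addition formula reduces differentiability at z to the estimate at 0. *)
Lemma ex_der_expC (z : C) : ex_der expC z.
Proof.
  exists (fun y => expC z * slope expC 0 1 (y - z))%C; split.
  - apply cont_mult; [apply cont_const|]. apply (cont_comp (slope expC 0 1)).
    + apply cont_minus; auto using cont_id, cont_const.
    + rewrite Csub_diag. intros e He. destruct (expC_at_0 (e/2)) as [d [Hd K]]; [lra|].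
      exists d; split; auto. intros y Hy. rewrite Cmod_sub_0 in Hy. specialize (K y Hy).
      unfold slope at 2. destruct (Ceq_dec 0 0) as [_|N]; [|now elim N].
      unfold slope. destruct (Ceq_dec y 0) as [_|N]; [rewrite Cmod_sub_self; lra|].
      rewrite expC_0. assert (Hp : 0 < Cmod y) by now apply Cmod_gt_0.
      replace ((expC y - 1) / (y - 0) - 1)%C with ((expC y - 1 - y) / y)%C.
      2:{ replace (y - 0)%C with y by ring. field. auto. }
      rewrite Cmod_div by auto. apply Rlt_div_l; auto. nra.
  - intros y. replace y with (z + (y - z))%C at 1 by ring. rewrite expC_plus.
    rewrite (slope_spec expC 0 1 (y - z)). rewrite expC_0. ring.
Qed.

Lemma expC_ln (r t : R) : 0 < r -> expC (ln r, t) = circ r t.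
Proof. intros H. unfold expC; simpl. now rewrite exp_ln. Qed.

Lemma circ_2PI (r : R) : circ r (2 * PI) = circ r 0.
Proof. unfold circ. now rewrite cos_2PI, sin_2PI, cos_0, sin_0. Qed.

Lemma Cmod_circ (r t : R) : 0 <= r -> Cmod (circ r t) = r.
Proof.
  intros H. unfold Cmod, circ; simpl fst; simpl snd.
  replace ((r * cos t) ^ 2 + (r * sin t) ^ 2) with (r ^ 2 * ((sin t)^2 + (cos t)^2)) by ring.
  replace ((sin t)^2 + (cos t)^2) with 1.
  - rewrite Rmult_1_r. now apply sqrt_pow2.
  - pose proof (sin2_cos2 t) as E. unfold Rsqr in E. lra.
Qed.

Lemma Cmod_expC (z : C) : Cmod (expC z) = exp (fst z).
Proof. apply (Cmod_circ (exp (fst z)) (snd z)). left; apply exp_pos. Qed.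

(** The integral of F(z) dz / (i z) over |z| = r, that is 2 pi times the mean of F on this
    circle. *)
Definition CI (F : C -> C) (r : R) : C := CInt (fun t => F (circ r t)) 0 (2 * PI).

Lemma contR_circ (r t : R) : contR (circ r) t.
Proof.
  intros e He.
  assert (H0 : 0 < e / (2 * (Rabs r + 1))).
  { pose proof (Rabs_pos r). apply Rdiv_lt_0_compat; lra. }
  destruct (continuity_cos t _ H0) as [d1 [Hd1 K1]].
  destruct (continuity_sin t _ H0) as [d2 [Hd2 K2]].
  exists (Rmin d1 d2). split; [now apply Rmin_pos|]. intros s Hs.
  pose proof (Rmin_l d1 d2). pose proof (Rmin_r d1 d2).
  destruct (Req_dec s t) as [->|N]; [rewrite Cmod_sub_self; auto|].
  assert (D1 : Rabs (cos s - cos t) < e / (2 * (Rabs r + 1))).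
  { apply K1; split; [split; auto; exact I|]. change (Rabs (s - t) < d1); lra. }
  assert (D2 : Rabs (sin s - sin t) < e / (2 * (Rabs r + 1))).
  { apply K2; split; [split; auto; exact I|]. change (Rabs (s - t) < d2); lra. }
  eapply Rle_lt_trans; [apply Cmod_le_sum|]. simpl.
  replace (r * cos s + - (r * cos t)) with (r * (cos s - cos t)) by ring.
  replace (r * sin s + - (r * sin t)) with (r * (sin s - sin t)) by ring.
  rewrite !Rabs_mult. pose proof (Rabs_pos r).
  set (k := e / (2 * (Rabs r + 1))) in *.
  assert (Ek : 2 * (Rabs r + 1) * k = e) by (unfold k; field; lra).
  pose proof (Rabs_pos (cos s - cos t)). pose proof (Rabs_pos (sin s - sin t)). nra.
Qed.

Lemma CI_correct (F : C -> C) (r : R) :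
  0 <= r -> (forall z, Cmod z = r -> cont F z) ->
  isInt (fun t => F (circ r t)) 0 (2 * PI) (CI F r).
Proof.
  intros Hr H. apply CInt_correct; [pose proof PI_RGT_0; lra|]. intros t _.
  apply contR_line; [apply contR_circ|]. apply H, Cmod_circ, Hr.
Qed.

(** The horizontal sides of [ln s, ln t] x [0, 2 pi] have the same image under exp, so their
    contributions cancel in Goursat's theorem; the vertical sides contribute i times the two circle
    integrals. *)
Lemma CI_annulus (F : C -> C) (s t : R) :
  0 < s -> s <= t -> (forall z, s <= Cmod z <= t -> ex_der F z) -> CI F s = CI F t.
Proof.
  intros Hs [Hst|<-] H; [|reflexivity]. pose proof PI_RGT_0 as Hpi.
  assert (Hl : ln s < ln t) by now apply ln_increasing.
  assert (HG : forall x y, ln s <= x <= ln s + (ln t - ln s) -> 0 <= y <= 0 + 2 * PI ->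
     ex_der (fun z => F (expC z)) (x, y)).
  { intros x y Hx _. apply ex_der_comp; [apply ex_der_expC|]. apply H. rewrite Cmod_expC. simpl.
    rewrite <- (exp_ln s), <- (exp_ln t) by lra.
    split; [destruct (Req_dec (ln s) x) as [->|N]|destruct (Req_dec x (ln t)) as [->|N]]; try lra;
      left; apply exp_increasing; lra. }
  pose proof (goursat (fun z => F (expC z)) (ln s) 0 (ln t - ln s) (2 * PI) ltac:(lra) ltac:(lra) HG) as E.
  replace (ln s + (ln t - ln s)) with (ln t) in E by ring. rewrite Rplus_0_l in E.
  unfold rectI in E.
  assert (E1 : CInt (fun x => F (expC (x, 2 * PI))) (ln s) (ln t) =
               CInt (fun x => F (expC (x, 0))) (ln s) (ln t)).
  { apply CInt_ext. intros x _. f_equal.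
    apply (circ_2PI (exp x)). }
  rewrite E1 in E.
  assert (E2 : forall r, 0 < r -> CInt (fun y => F (expC (ln r, y))) 0 (2 * PI) = CI F r).
  { intros r Hr. unfold CI. apply CInt_ext. intros y _. now rewrite expC_ln. }
  rewrite !E2 in E by lra.
  assert (Ci <> 0) by (apply Cmod_gt_0; rewrite Cmod_Ci; lra).
  symmetry; apply Csub_eq_0.
  replace (CI F t - CI F s)%C with (/ Ci * (Ci * CI F t - Ci * CI F s))%C by (field; auto).
  replace (Ci * CI F t - Ci * CI F s)%C with (RtoC 0); [ring|]. rewrite <- E. ring.
Qed.

(** Uniform continuity of F in polar coordinates on the compact rectangle [r - a, r + a] x
    [0, 2 pi]. *)
Lemma circle_uniform (F : C -> C) (r a e : R) :
  0 < a -> a < r -> 0 < e -> (forall z, r - a <= Cmod z <= r + a -> cont F z) ->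
  exists d, 0 < d /\ forall s t, Rabs (s - r) < d -> 0 <= t <= 2 * PI ->
    Cmod (F (circ s t) - F (circ r t)) < e.
Proof.
  intros Ha Har He H.
  assert (HC : forall x y, r - a <= x <= r + a -> forall e', 0 < e' ->
     exists d, 0 < d /\ forall x' y', Rabs (x' - x) < d -> Rabs (y' - y) < d ->
       Cmod (F (circ x' y') - F (circ x y)) < e').
  { intros x y Hx e' He'. destruct (H (circ x y)) with (eps := e') as [d [Hd K]]; auto.
    { rewrite Cmod_circ; lra. }
    destruct (contR_circ x y (d/2)) as [d' [Hd' K']]; [lra|].
    exists (Rmin (d/2) d'). split; [apply Rmin_pos; lra|]. intros x' y' Hx' Hy'.
    pose proof (Rmin_l (d/2) d'). pose proof (Rmin_r (d/2) d').
    apply K. eapply Rle_lt_trans; [apply (Cmod_sub_triangle _ (circ x y'))|].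
    specialize (K' y' ltac:(lra)).
    assert (Cmod (circ x' y' - circ x y') = Rabs (x' - x)); [|lra].
    replace (circ x' y' - circ x y')%C with (RtoC (x' - x) * circ 1 y')%C
      by (unfold circ, RtoC, Cminus, Cplus, Copp, Cmult; simpl; f_equal; ring).
    rewrite Cmod_mult, Cmod_R, Cmod_circ; lra. }
  (* The compactness theorem applied here is about real-valued functions, so it is used for the real
     and the imaginary part, both 1-Lipschitz. *)
  assert (U : forall g : C -> R, (forall z w, Rabs (g z - g w) <= Cmod (z - w)) ->
    exists d : posreal, forall s t, Rabs (s - r) < d -> 0 <= t <= 2 * PI -> r - a <= s <= r + a ->
    Rabs (g (F (circ s t)) - g (F (circ r t))) < e / 2).
  { intros g Hg.
    assert (He2 : 0 < e / 2) by lra.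
    destruct (uniform_continuity_2d (fun x y => g (F (circ x y))) (r - a) (r + a) 0 (2 * PI))
      with (eps := mkposreal _ He2) as [d K].
    - intros x y Hx _ eps. destruct (HC x y Hx eps (cond_pos eps)) as [d [Hd K]].
      exists (mkposreal d Hd). intros u v Hu Hv. eapply Rle_lt_trans; [apply Hg|]. apply K; auto.
    - exists d. intros s t Hs Ht Hsr. apply K; auto; try lra.
      rewrite Rminus_diag, Rabs_R0. apply cond_pos. }
  destruct (U fst) as [d1 K1]. { intros z w. apply (Rabs_fst_le (z - w)). }
  destruct (U snd) as [d2 K2]. { intros z w. apply (Rabs_snd_le (z - w)). }
  pose proof (cond_pos d1). pose proof (cond_pos d2).
  exists (Rmin a (Rmin d1 d2)). split; [repeat apply Rmin_pos; auto|]. intros s t Hs Ht.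
  pose proof (Rmin_l a (Rmin d1 d2)). pose proof (Rmin_r a (Rmin d1 d2)).
  pose proof (Rmin_l d1 d2). pose proof (Rmin_r d1 d2).
  assert (Hsr : r - a <= s <= r + a) by (apply Rlt_le, Rabs_le_between' in Hs; lra).
  specialize (K1 s t ltac:(lra) Ht Hsr). specialize (K2 s t ltac:(lra) Ht Hsr).
  eapply Rle_lt_trans; [apply Cmod_le_sum|]. simpl. unfold Rminus in *. lra.
Qed.

Lemma CI_bound (F : C -> C) (r M : R) :
  0 <= r -> (forall z, Cmod z = r -> cont F z) -> (forall z, Cmod z = r -> Cmod (F z) <= M) ->
  Cmod (CI F r) <= 2 * PI * M.
Proof.
  intros Hr HC HM. pose proof PI_RGT_0.
  replace (2 * PI * M) with ((2 * PI - 0) * M) by ring.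
  apply isInt_bound with (fun t => F (circ r t)); [lra| |now apply CI_correct].
  intros; now apply HM, Cmod_circ.
Qed.

Lemma CI_near (F : C -> C) (r a e : R) :
  0 < a -> a < r -> 0 < e -> (forall z, r - a <= Cmod z <= r + a -> cont F z) ->
  exists d, 0 < d /\ d <= a /\ forall s, Rabs (s - r) < d -> Cmod (CI F s - CI F r) <= 2 * PI * e.
Proof.
  intros Ha Har He H. pose proof PI_RGT_0.
  destruct (circle_uniform F r a e Ha Har He H) as [d [Hd K]].
  exists (Rmin a d). split; [now apply Rmin_pos|]. split; [apply Rmin_l|]. intros s Hs.
  pose proof (Rmin_l a d). pose proof (Rmin_r a d).
  assert (Hsr : r - a <= s <= r + a) by (apply Rlt_le, Rabs_le_between' in Hs; lra).
  replace (2 * PI * e) with ((2 * PI - 0) * e) by ring.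
  apply isInt_bound with (fun t => F (circ s t) - F (circ r t))%C; [lra| |].
  - intros t Ht. left; apply K; lra.
  - apply isInt_minus; apply CI_correct; try lra; intros; apply H; lra.
Qed.

(* The puncture at 0 and one further puncture p cost nothing: the integral over the circle of radius
   r is locally constant in r off |p| and continuous in r. *)
Lemma mean_value_punctured (F : C -> C) (p : C) (Rad r : R) :
  0 < r < Rad -> (forall z, Cmod z < Rad -> cont F z) ->
  (forall z, Cmod z < Rad -> z <> 0 -> z <> p -> ex_der F z) ->
  CI F r = (RtoC (2 * PI) * F 0)%C.
Proof.
  intros Hr HC HD. pose proof PI_RGT_0 as Hpi.
  assert (small : forall z, (forall e, 0 < e -> Cmod z <= 2 * PI * e) -> z = 0).
  { intros z Hz. apply Cmod_eq_0, Rle_antisym; [|apply Cmod_ge_0].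
    apply Rnot_lt_le; intros Hp. specialize (Hz (Cmod z / (4 * PI)) ltac:(apply Rdiv_lt_0_compat; lra)).
    replace (2 * PI * (Cmod z / (4 * PI))) with (Cmod z / 2) in Hz by (field; lra). lra. }
  (* As long as no circle of smaller radius meets p, the circle can be shrunk towards 0, where F is
     close to F 0. *)
  assert (near0 : forall s, 0 < s < Rad -> (forall z, 0 < Cmod z <= s -> z <> p) ->
     CI F s = (RtoC (2 * PI) * F 0)%C).
  { intros s Hs Hp. apply Csub_eq_0, small. intros e He.
    destruct (HC 0 ltac:(rewrite Cmod_0; lra) e He) as [d [Hd K]].
    set (s' := Rmin s (d / 2)). assert (0 < s') by (apply Rmin_pos; lra).
    assert (s' <= s) by apply Rmin_l. assert (s' <= d / 2) by apply Rmin_r.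
    rewrite <- (CI_annulus F s' s); try lra.
    - replace (2 * PI * e) with ((2 * PI - 0) * e) by ring.
      apply isInt_bound with (fun t => F (circ s' t) - F 0)%C; [lra| |].
      + intros t _. left; apply K. rewrite Cmod_sub_0, Cmod_circ; lra.
      + apply isInt_minus.
        * apply CI_correct; [lra|]. intros z Hz; apply HC; lra.
        * replace (RtoC (2 * PI)) with (RtoC (2 * PI - 0)) by (f_equal; ring). apply isInt_const.
    - intros z Hz. apply HD; [lra| |apply Hp; lra]. intros ->. rewrite Cmod_0 in Hz. lra. }
  destruct (Rlt_le_dec r (Cmod p)) as [L|L].
  { apply near0; auto. intros z Hz ->. lra. }
  destruct (Req_dec (Cmod p) 0) as [E|E].
  { apply near0; auto. intros z Hz ->. lra. }
  pose proof (Cmod_ge_0 p).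
  (* Radii slightly below |p| carry the value over to |p| by continuity; then |p| carries it to
     radii slightly above, and annuli do the rest. *)
  assert (AtP : CI F (Cmod p) = (RtoC (2 * PI) * F 0)%C).
  { apply Csub_eq_0, small. intros e He.
    destruct (CI_near F (Cmod p) (Rmin (Cmod p / 2) ((Rad - r) / 2)) e) as [d [Hd [Hda K]]]; auto.
    { apply Rmin_pos; lra. }
    { eapply Rle_lt_trans; [apply Rmin_l|]; lra. }
    { pose proof (Rmin_r (Cmod p / 2) ((Rad - r) / 2)). intros z Hz; apply HC; lra. }
    pose proof (Rmin_l (Cmod p / 2) ((Rad - r) / 2)).
    rewrite <- (near0 (Cmod p - d / 2)); try lra.
    - rewrite Cmod_sub_sym. apply K.
      replace (Cmod p - d / 2 - Cmod p) with (- (d / 2)) by ring. rewrite Rabs_Ropp, Rabs_pos_eq; lra.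
    - intros z Hz ->. lra. }
  destruct (Rle_lt_or_eq_dec _ _ L) as [L'|<-]; [|exact AtP].
  rewrite <- AtP. apply Csub_eq_0, small. intros e He.
  destruct (CI_near F (Cmod p) (Rmin (Cmod p / 2) ((Rad - r) / 2)) e) as [d [Hd [Hda K]]]; auto.
  { apply Rmin_pos; lra. }
  { eapply Rle_lt_trans; [apply Rmin_l|]; lra. }
  { pose proof (Rmin_r (Cmod p / 2) ((Rad - r) / 2)). intros z Hz; apply HC; lra. }
  set (s := Rmin r (Cmod p + d / 2)).
  assert (s <= r) by apply Rmin_l. assert (s <= Cmod p + d/2) by apply Rmin_r.
  assert (Cmod p < s) by (apply Rmin_glb_lt; lra).
  rewrite <- (CI_annulus F s r); try lra.
  - apply K. rewrite Rabs_pos_eq; lra.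
  - intros z Hz. apply HD; [lra| |].
    + intros ->. rewrite Cmod_0 in Hz. lra.
    + intros ->. lra.
Qed.

(** * Cauchy's integral formula and its consequences *)

Definition hol (F : C -> C) (p : C) (r : R) : Prop :=
  forall z, Cmod (z - p) < r -> ex_der F z.

Lemma CI_ext (F G : C -> C) (r : R) :
  0 <= r -> (forall z, Cmod z = r -> F z = G z) -> CI F r = CI G r.
Proof.
  intros Hr H. unfold CI. apply CInt_ext. intros t _. apply H.
  now apply Cmod_circ.
Qed.

Lemma CI_plus (F G : C -> C) (r : R) :
  0 <= r -> (forall z, Cmod z = r -> cont F z) -> (forall z, Cmod z = r -> cont G z) ->
  CI (fun z => F z + G z)%C r = (CI F r + CI G r)%C.
Proof. intros. unfold CI at 1. apply CInt_unique, isInt_plus; now apply CI_correct. Qed.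

Lemma CI_minus (F G : C -> C) (r : R) :
  0 <= r -> (forall z, Cmod z = r -> cont F z) -> (forall z, Cmod z = r -> cont G z) ->
  CI (fun z => F z - G z)%C r = (CI F r - CI G r)%C.
Proof. intros. unfold CI at 1. apply CInt_unique, isInt_minus; now apply CI_correct. Qed.

Lemma CI_scal (c : C) (F : C -> C) (r : R) :
  0 <= r -> (forall z, Cmod z = r -> cont F z) ->
  CI (fun z => c * F z)%C r = (c * CI F r)%C.
Proof. intros. unfold CI at 1. apply CInt_unique, isInt_scal; now apply CI_correct. Qed.

Lemma CI_const (c : C) (r : R) : CI (fun _ => c) r = (RtoC (2 * PI) * c)%C.
Proof.
  unfold CI. apply CInt_unique. replace (RtoC (2 * PI)) with (RtoC (2 * PI - 0)) by (f_equal; ring).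
  apply isInt_const.
Qed.

Lemma RtoC_2PI_neq_0 : RtoC (2 * PI) <> 0.
Proof. apply Cmod_gt_0. pose proof PI_RGT_0. rewrite Cmod_R, Rabs_pos_eq; lra. Qed.

Lemma Cmod_2PI : Cmod (RtoC (2 * PI)) = 2 * PI.
Proof. pose proof PI_RGT_0. rewrite Cmod_R, Rabs_pos_eq; lra. Qed.

Lemma Cmod_neq (z w : C) : Cmod z <> Cmod w -> z <> w.
Proof. intros H E; apply H; now f_equal. Qed.

Lemma ex_der_kernel (w z : C) : z <> w -> ex_der (fun z => z / (z - w))%C z.
Proof.
  intros H. apply ex_der_div; [now apply Csub_neq_0|apply ex_der_id|].
  apply ex_der_minus; auto using ex_der_id, ex_der_const.
Qed.

Lemma kernel_bound (w z : C) (r : R) :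
  Cmod z = r -> Cmod w < r -> Cmod (z / (z - w)) <= r / (r - Cmod w).
Proof.
  intros Hz Hw. pose proof (Cmod_ge_0 w).
  assert (z <> w) by (apply Cmod_neq; lra).
  rewrite Cmod_div by now apply Csub_neq_0. rewrite Hz.
  apply Rmult_le_compat_l; [lra|]. apply Rinv_le_contravar; [lra|].
  rewrite <- Hz. apply Cmod_triangle_inv.
Qed.

(** The integral is the same for all radii t >= r, and on |z| = t the kernel differs from 1 by at
    most |w| / (t - |w|), which tends to 0 as t grows. *)
Lemma CI_kernel (w : C) (r : R) : Cmod w < r -> CI (fun z => z / (z - w))%C r = RtoC (2 * PI).
Proof.
  intros Hw. pose proof (Cmod_ge_0 w). pose proof PI_RGT_0.
  apply Csub_eq_0, Cmod_eq_0.
  set (K := Cmod (CI (fun z => z / (z - w))%C r - RtoC (2 * PI))).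
  assert (HK : forall t, r <= t -> K * (t - Cmod w) <= 2 * PI * Cmod w).
  { intros t Ht. unfold K. rewrite (CI_annulus _ r t); try lra.
    2:{ intros z Hz; apply ex_der_kernel, Cmod_neq; lra. }
    replace (RtoC (2 * PI)) with (CI (fun _ => 1%C) t) by (rewrite CI_const; ring).
    rewrite <- CI_minus; try lra; auto using cont_const.
    2:{ intros z Hz; apply ex_der_cont, ex_der_kernel, Cmod_neq; lra. }
    apply Rle_trans with (2 * PI * (Cmod w / (t - Cmod w)) * (t - Cmod w)).
    - apply Rmult_le_compat_r; [lra|]. apply CI_bound; [lra| |].
      + intros z Hz. apply cont_minus; auto using cont_const.
        apply ex_der_cont, ex_der_kernel, Cmod_neq; lra.
      + intros z Hz. assert (z <> w) by (apply Cmod_neq; lra).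
        replace (z / (z - w) - 1)%C with (w / (z - w))%C by (field; now apply Csub_neq_0).
        rewrite Cmod_div by now apply Csub_neq_0.
        apply Rmult_le_compat_l; [lra|]. apply Rinv_le_contravar; [lra|].
        rewrite <- Hz. apply Cmod_triangle_inv.
    - apply Req_le. field. lra. }
  assert (K0 : 0 <= K) by apply Cmod_ge_0.
  destruct (Req_dec K 0) as [E|N]; auto. exfalso.
  (* At this radius K times (t - |w|) is at least 2 pi |w| + K, which contradicts [HK]. *)
  set (t := Rmax r (Cmod w + 2 * PI * Cmod w / K + 1)).
  assert (Cmod w + 2 * PI * Cmod w / K + 1 <= t) by apply Rmax_r.
  specialize (HK t (Rmax_l _ _)).
  assert (K * (2 * PI * Cmod w / K + 1) <= K * (t - Cmod w)) by (apply Rmult_le_compat_l; lra).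
  replace (K * (2 * PI * Cmod w / K + 1)) with (2 * PI * Cmod w + K) in * by (field; auto). lra.
Qed.

(** The function z (F z - F w) / (z - w), completed at w, vanishes at 0, so its mean is 0; splitting
    it leaves F w times the integral of the kernel. Its exceptional points are w, where the quotient
    is only continuous, and 0, where F is. For w = 0 the formula is the mean value property
    itself. *)
Theorem cauchy_formula (F : C -> C) (Rad r : R) (w : C) :
  0 < r < Rad -> Cmod w < r -> (forall z, Cmod z < Rad -> cont F z) ->
  (forall z, Cmod z < Rad -> z <> 0 -> ex_der F z) ->
  CI (fun z => F z * (z / (z - w)))%C r = (RtoC (2 * PI) * F w)%C.
Proof.
  intros Hr Hw HC HD.
  destruct (Ceq_dec w 0) as [->|Nw].
  { rewrite <- (mean_value_punctured F 0 Rad r); auto.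
    apply CI_ext; [lra|]. intros z Hz.
    assert (z <> 0) by (apply Cmod_gt_0; lra).
    replace (z - 0)%C with z by ring. field; auto. }
  destruct (ex_der_slope F w) as [l Hl]; [apply HD; auto; lra|].
  set (H := fun z => (z * slope F w l z)%C).
  assert (HS : forall z, z <> w -> exists d, 0 < d /\ forall y, Cmod (y - z) < d ->
     ((F y - F w) / (y - w))%C = slope F w l y).
  { intros z Hz. exists (Cmod (z - w)). split; [now apply Cmod_gt_0, Csub_neq_0|].
    intros y Hy. unfold slope. destruct (Ceq_dec y w) as [->|]; auto.
    rewrite Cmod_sub_sym in Hy. lra. }
  assert (HM : CI H r = (RtoC (2 * PI) * H 0)%C).
  { apply mean_value_punctured with w Rad; auto.
    - intros z Hz. apply cont_mult; [apply cont_id|].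
      destruct (Ceq_dec z w) as [->|N]; auto.
      destruct (HS z N) as [d [Hd E]].
      apply (cont_ext_loc _ _ _ d Hd E).
      apply cont_mult; [apply cont_minus; auto using cont_const|].
      apply cont_inv; [now apply Csub_neq_0|]. apply cont_minus; auto using cont_id, cont_const.
    - intros z Hz N0 N. apply ex_der_mult; [apply ex_der_id|].
      destruct (HS z N) as [d [Hd E]].
      apply (ex_der_ext_loc _ _ _ d Hd E).
      apply ex_der_div; [now apply Csub_neq_0| |].
      + apply ex_der_minus; auto using ex_der_const.
      + apply ex_der_minus; auto using ex_der_const, ex_der_id. }
  assert (Kc : forall z, Cmod z = r -> cont (fun z => z / (z - w))%C z).
  { intros z Hz; apply ex_der_cont, ex_der_kernel, Cmod_neq; lra. }
  rewrite (CI_ext H (fun z => F z * (z / (z - w)) - F w * (z / (z - w)))%C r) in HM.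
  - rewrite CI_minus, CI_scal, CI_kernel in HM; auto; try lra.
    + replace (RtoC (2 * PI) * H 0)%C with (RtoC 0) in HM by (unfold H; ring).
      apply Csub_eq_0. rewrite <- HM. ring.
    + intros z Hz; apply cont_mult; auto. apply HC; lra.
    + intros z Hz; apply cont_mult; auto using cont_const.
  - lra.
  - intros z Hz. assert (z <> w) by (apply Cmod_neq; lra).
    unfold H, slope. destruct (Ceq_dec z w) as [|_]; [contradiction|].
    field. now apply Csub_neq_0.
Qed.

Lemma cont_lipschitz (G : C -> C) (z : C) (d B : R) :
  0 < d -> 0 <= B -> (forall y, Cmod (y - z) < d -> Cmod (G y - G z) <= B * Cmod (y - z)) ->
  cont G z.
Proof.
  intros Hd HB H e He. exists (Rmin d (e / (B + 1))). split.
  - apply Rmin_pos; auto. apply Rdiv_lt_0_compat; lra.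
  - intros y Hy. pose proof (Rmin_l d (e / (B + 1))). pose proof (Rmin_r d (e / (B + 1))).
    specialize (H y ltac:(lra)). pose proof (Cmod_ge_0 (y - z)).
    assert (Cmod (y - z) * (B + 1) < e) by (apply Rlt_div_r; lra). nra.
Qed.

(** A Cauchy integral with any continuous bounded density Phi is differentiable: since 1 / (z - w) -
    1 / (z - w0) = (w - w0) / ((z - w) (z - w0)), its difference quotient is again an integral over
    the circle, and that one is Lipschitz at w0. Phi need not be the boundary values of F. *)
Lemma cauchy_integral_ex_der (Phi F : C -> C) (r M : R) (c w0 : C) :
  Cmod w0 < r -> (forall z, Cmod z = r -> cont Phi z) ->
  (forall z, Cmod z = r -> Cmod (Phi z) <= M) ->
  (forall w, Cmod w < r -> F w = (c * CI (fun z => Phi z * (z / (z - w))) r)%C) ->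
  ex_der F w0.
Proof.
  intros Hw0 HC HM HF. pose proof (Cmod_ge_0 w0). pose proof PI_RGT_0.
  assert (M0 : 0 <= M).
  { eapply Rle_trans; [|apply (HM (RtoC r))]; [apply Cmod_ge_0|].
    rewrite Cmod_R, Rabs_pos_eq; lra. }
  (* For |w - w0| < d all points of the circle stay at distance at least d from w, which bounds
     every factor 1 / (z - w) by 1 / d. *)
  set (d := (r - Cmod w0) / 2). assert (Hd : 0 < d) by (unfold d; lra).
  assert (Hdi : 0 < / d) by now apply Rinv_0_lt_compat.
  assert (Hin : forall w, Cmod (w - w0) < d -> Cmod w < r - d).
  { intros w Hw. pose proof (Cmod_triangle_inv w w0). unfold d in *. lra. }
  assert (Hz : forall w z, Cmod w < r - d -> Cmod z = r -> z <> w).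
  { intros w z Hw Hz. apply Cmod_neq; lra. }
  assert (Hd1 : forall w z, Cmod w < r - d -> Cmod z = r -> / Cmod (z - w) <= / d).
  { intros w z Hw Ez. apply Rinv_le_contravar; auto.
    pose proof (Cmod_triangle_inv z w). lra. }
  assert (Hinv : forall w z, Cmod w < r - d -> Cmod z = r -> cont (fun z => / (z - w))%C z).
  { intros w z Hw Ez. apply cont_inv; [apply Csub_neq_0; eauto|].
    apply cont_minus; auto using cont_id, cont_const. }
  assert (H00 : Cmod w0 < r - d) by (unfold d; lra).
  set (q := fun w => (c * CI (fun z => Phi z * z * (/ (z - w) * / (z - w0))) r)%C).
  assert (Cq : forall w, Cmod w < r - d -> forall z, Cmod z = r ->
    cont (fun z => Phi z * z * (/ (z - w) * / (z - w0)))%C z).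
  { intros w Hw z Ez. repeat apply cont_mult; auto using cont_id. }
  assert (Ck : forall w, Cmod w < r - d -> forall z, Cmod z = r ->
    cont (fun z => Phi z * (z / (z - w)))%C z).
  { intros w Hw z Ez. repeat apply cont_mult; auto using cont_id. }
  assert (Eq : forall w, Cmod (w - w0) < d -> slope F w0 (q w0) w = q w).
  { intros w Hw. specialize (Hin w Hw).
    unfold slope. destruct (Ceq_dec w w0) as [->|N]; auto.
    rewrite !HF by lra. unfold q.
    replace (CI (fun z => Phi z * z * (/ (z - w) * / (z - w0))) r)%C with
      (/ (w - w0) * (CI (fun z => Phi z * (z / (z - w))) r - CI (fun z => Phi z * (z / (z - w0))) r))%C.
    { field. now apply Csub_neq_0. }
    rewrite <- CI_minus, <- CI_scal; auto; try lra.
    - apply CI_ext; [lra|]. intros z Ez. field. repeat split; apply Csub_neq_0; eauto.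
    - intros z Ez; apply cont_minus; auto. }
  apply slope_ex_der with (q w0).
  apply cont_lipschitz with d (Cmod c * (2 * PI * (M * r * (/ d * / d * / d)))); auto.
  { apply Rmult_le_pos; [apply Cmod_ge_0|]. apply Rmult_le_pos; [lra|].
    repeat apply Rmult_le_pos; lra. }
  intros w Hw. rewrite !Eq; auto; [|rewrite Cmod_sub_self; auto].
  specialize (Hin w Hw). unfold q.
  replace (c * CI (fun z => Phi z * z * (/ (z - w) * / (z - w0))) r -
           c * CI (fun z => Phi z * z * (/ (z - w0) * / (z - w0))) r)%C with
    (c * (CI (fun z => Phi z * z * (/ (z - w) * / (z - w0))) r -
          CI (fun z => Phi z * z * (/ (z - w0) * / (z - w0))) r))%C by ring.
  rewrite <- CI_minus; auto; try lra.
  rewrite (CI_ext _ (fun z => (w - w0) * (Phi z * z * (/ (z - w) * / (z - w0) * / (z - w0))))%C r); try lra.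
  2:{ intros z Ez. field. split; apply Csub_neq_0; eauto. }
  assert (Cq3 : forall z, Cmod z = r -> cont (fun z => Phi z * z * (/ (z - w) * / (z - w0) * / (z - w0)))%C z).
  { intros z Ez. repeat apply cont_mult; auto using cont_id. }
  rewrite CI_scal; auto; try lra. rewrite !Cmod_mult.
  apply Rle_trans with (Cmod c * (Cmod (w - w0) * (2 * PI * (M * r * (/ d * / d * / d))))).
  - apply Rmult_le_compat_l; [apply Cmod_ge_0|]. apply Rmult_le_compat_l; [apply Cmod_ge_0|].
    apply CI_bound; auto; [lra|]. intros z Ez. rewrite !Cmod_mult, Ez.
    rewrite !Cmod_inv by (apply Csub_neq_0; eauto).
    assert (P : forall v, Cmod v < r - d -> 0 <= / Cmod (z - v)).
    { intros v Hv. left; apply Rinv_0_lt_compat. apply Cmod_gt_0, Csub_neq_0. eauto. }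
    repeat apply Rmult_le_compat; auto; try lra; try apply Cmod_ge_0;
      repeat apply Rmult_le_pos; auto; try apply Cmod_ge_0; lra.
  - apply Req_le; ring.
Qed.

(** Cauchy's formula was proved with mere continuity at 0, so it represents F near 0 as a Cauchy
    integral, which is differentiable. *)
Lemma removable_singularity_0 (F : C -> C) (Rad : R) :
  0 < Rad -> (forall z, Cmod z < Rad -> cont F z) ->
  (forall z, Cmod z < Rad -> z <> 0 -> ex_der F z) -> ex_der F 0.
Proof.
  intros HR HC HD. destruct (HC 0 ltac:(rewrite Cmod_0; lra) 1 Rlt_0_1) as [d [Hd K]].
  set (r := Rmin d Rad / 2).
  assert (0 < r) by (unfold r; pose proof (Rmin_pos d Rad Hd HR); lra).
  assert (r < d) by (unfold r in *; pose proof (Rmin_l d Rad); lra).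
  assert (r < Rad) by (unfold r in *; pose proof (Rmin_r d Rad); lra).
  apply cauchy_integral_ex_der with F r (Cmod (F 0) + 1) (/ RtoC (2 * PI))%C.
  - now rewrite Cmod_0.
  - intros; apply HC; lra.
  - intros z Hz. specialize (K z). rewrite Cmod_sub_0 in K. specialize (K ltac:(lra)).
    pose proof (Cmod_triangle_inv (F z) (F 0)). lra.
  - intros w Hw. rewrite (cauchy_formula F Rad); auto. field. apply RtoC_2PI_neq_0.
Qed.

Lemma hol_shift (F : C -> C) (p : C) (r : R) : hol F p r -> hol (fun z => F (p + z))%C 0 r.
Proof.
  intros H z Hz. rewrite Cmod_sub_0 in Hz. apply ex_der_comp.
  - apply ex_der_plus; auto using ex_der_id, ex_der_const.
  - apply H. now rewrite Cplus_sub_cancel.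
Qed.

Lemma hol_unshift (F : C -> C) (p : C) (r : R) : hol (fun z => F (p + z))%C 0 r -> hol F p r.
Proof.
  intros H z Hz. apply ex_der_ext with (fun z => F (p + (z - p)))%C.
  { intros y. now rewrite Cplus_sub. }
  apply (ex_der_comp (fun z => F (p + z))%C (fun z => z - p)%C).
  - apply ex_der_minus; auto using ex_der_id, ex_der_const.
  - apply H. now rewrite Cmod_sub_0.
Qed.

Lemma hol_sub (F : C -> C) (p q : C) (r s : R) :
  Cmod (q - p) + s <= r -> hol F p r -> hol F q s.
Proof. intros Hs H z Hz. apply H. pose proof (Cmod_sub_triangle z q p). lra. Qed.

Lemma hol_pow (F : C -> C) (p : C) (r : R) (k : nat) :
  hol F p r -> hol (fun z => F z ^ k)%C p r.
Proof. intros HF z Hz. apply ex_der_pow; auto. Qed.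

Lemma hol_cont (F : C -> C) (p : C) (r : R) (z : C) : hol F p r -> Cmod (z - p) < r -> cont F z.
Proof. intros H Hz. now apply ex_der_cont, H. Qed.

Lemma cauchy_formula_hol (F : C -> C) (Rad r : R) (w : C) :
  0 < r < Rad -> Cmod w < r -> hol F 0 Rad ->
  CI (fun z => F z * (z / (z - w)))%C r = (RtoC (2 * PI) * F w)%C.
Proof.
  intros Hr Hw HF. apply cauchy_formula with Rad; auto.
  - intros z Hz. apply (hol_cont F 0 Rad); auto. now rewrite Cmod_sub_0.
  - intros z Hz _. apply HF. now rewrite Cmod_sub_0.
Qed.

Lemma hol_circle_cont (F : C -> C) (Rad r : R) :
  hol F 0 Rad -> r < Rad -> forall z, Cmod z = r -> cont F z.
Proof. intros H Hr z Hz. apply (hol_cont F 0 Rad); auto. rewrite Cmod_sub_0; lra. Qed.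

Lemma kernel_cont (w : C) (r : R) :
  Cmod w < r -> forall z, Cmod z = r -> cont (fun z => z / (z - w))%C z.
Proof. intros Hw z Hz. apply ex_der_cont, ex_der_kernel, Cmod_neq; lra. Qed.

(** For x > M > 0 Bernoulli's inequality makes (x / M)^k grow at least linearly in k, beyond any
    B. *)
Lemma pow_le_geometric (x M B : R) :
  0 <= M -> 0 <= x -> (forall k, x ^ k <= B * M ^ k) -> x <= M.
Proof.
  intros HM Hx H. apply Rnot_lt_le; intros L.
  destruct (Req_dec M 0) as [->|N].
  - specialize (H 1%nat). rewrite !pow_1 in H. lra.
  - set (e := x / M - 1). assert (He : 0 < e).
    { unfold e. assert (1 < x / M) by (apply Rlt_div_r; lra). lra. }
    assert (Hk : forall k, 1 + INR k * e <= B).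
    { intros k. pose proof (poly k e He). replace (1 + e) with (x / M) in * by (unfold e; ring).
      eapply Rle_trans; [apply H0|]. unfold Rdiv. rewrite Rpow_mult_distr, pow_inv.
      specialize (H k). apply (Rle_div_l (x ^ k)); [apply pow_lt; lra|lra]. }
    destruct (INR_unbounded (B / e)) as [n Hn]. specialize (Hk n).
    apply Rlt_div_l in Hn; lra.
Qed.

(* Cauchy's formula for F^k bounds |F w|^k by a constant times M^k; let k tend to infinity. *)
Lemma maximum_modulus_0 (F : C -> C) (Rad r M : R) (w : C) :
  0 < r < Rad -> hol F 0 Rad -> (forall z, Cmod z = r -> Cmod (F z) <= M) -> Cmod w < r ->
  Cmod (F w) <= M.
Proof.
  intros Hr HF HM Hw. pose proof PI_RGT_0.
  assert (M0 : 0 <= M).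
  { eapply Rle_trans; [|apply (HM (RtoC r))]; [apply Cmod_ge_0|].
    rewrite Cmod_R, Rabs_pos_eq; lra. }
  pose proof (Cmod_ge_0 w).
  apply pow_le_geometric with (r / (r - Cmod w)); auto using Cmod_ge_0.
  intros k. rewrite <- Cmod_pow.
  apply Rmult_le_reg_l with (2 * PI); [lra|].
  rewrite <- Cmod_2PI at 1. rewrite <- Cmod_mult.
  pose proof (hol_pow F 0 Rad k HF) as HFk.
  rewrite <- (cauchy_formula_hol (fun z => F z ^ k)%C Rad r); auto.
  apply CI_bound; [lra| |].
  - intros z Hz. apply cont_mult; [apply hol_circle_cont with Rad r; auto; lra|].
    apply kernel_cont with r; auto.
  - intros z Hz. rewrite Cmod_mult, Cmod_pow, Rmult_comm.
    apply Rmult_le_compat; try apply Cmod_ge_0.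
    + apply pow_le, Cmod_ge_0.
    + now apply kernel_bound.
    + apply pow_incr. split; [apply Cmod_ge_0|auto].
Qed.

Lemma maximum_modulus (F : C -> C) (p : C) (Rad r M : R) (w : C) :
  0 < r < Rad -> hol F p Rad -> (forall z, Cmod (z - p) = r -> Cmod (F z) <= M) ->
  Cmod (w - p) < r -> Cmod (F w) <= M.
Proof.
  intros Hr HF HM Hw. replace w with (p + (w - p))%C by ring.
  apply (maximum_modulus_0 (fun z => F (p + z))%C Rad r M (w - p)); auto using hol_shift.
  intros z Hz. apply HM. now rewrite Cplus_sub_cancel.
Qed.

(** On |z| = Rad / 2 the Cauchy kernels for w and for 0 differ by w / (z - w), which is at most |w|
    / (Rad / 4) when |w| <= Rad / 4. *)
Lemma cauchy_lipschitz_0 (F : C -> C) (Rad M : R) (w : C) :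
  0 < Rad -> hol F 0 Rad -> (forall z, Cmod z < Rad -> Cmod (F z) <= M) ->
  Cmod w <= Rad / 4 -> Cmod (F w - F 0) <= 4 * M / Rad * Cmod w.
Proof.
  intros HR HF HM Hw. pose proof PI_RGT_0. set (r := Rad / 2).
  assert (Hr : 0 < r < Rad) by (unfold r; lra). pose proof (Cmod_ge_0 w).
  assert (M0 : 0 <= M).
  { eapply Rle_trans; [|apply (HM (RtoC 0))]; [apply Cmod_ge_0|]. rewrite Cmod_0; lra. }
  assert (Hw' : Cmod w < r) by (unfold r; lra).
  assert (H0' : Cmod 0 < r) by (rewrite Cmod_0; lra).
  apply Rmult_le_reg_l with (2 * PI); [lra|].
  rewrite <- Cmod_2PI at 1. rewrite <- Cmod_mult.
  replace (RtoC (2 * PI) * (F w - F 0))%C with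
    (RtoC (2 * PI) * F w - RtoC (2 * PI) * F 0)%C by ring.
  rewrite <- (cauchy_formula_hol F Rad r w), <- (cauchy_formula_hol F Rad r 0); auto.
  assert (CF : forall v, Cmod v < r -> forall z, Cmod z = r -> cont (fun z => F z * (z / (z - v)))%C z).
  { intros v Hv z Hz. apply cont_mult; [apply hol_circle_cont with Rad r; auto; lra|].
    apply kernel_cont with r; auto. }
  rewrite <- CI_minus; auto; try lra.
  apply CI_bound; [lra| |].
  - intros z Hz. apply cont_minus; auto.
  - intros z Hz. assert (z <> 0) by (apply Cmod_gt_0; lra).
    assert (z <> w) by (apply Cmod_neq; lra).
    assert (Z1 : (z - w)%C <> 0) by now apply Csub_neq_0.
    replace (F z * (z / (z - w)) - F z * (z / (z - 0)))%C with (F z * (w / (z - w)))%C.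
    2:{ replace (z - 0)%C with z by ring. field; auto. }
    rewrite Cmod_mult, Cmod_div by auto.
    replace (4 * M / Rad * Cmod w) with (M * (Cmod w * / (Rad / 4))) by (field; lra).
    apply Rmult_le_compat; try apply Cmod_ge_0.
    + apply Rmult_le_pos; [lra|]. left. now apply Rinv_0_lt_compat, Cmod_gt_0.
    + apply HM; lra.
    + apply Rmult_le_compat_l; [lra|]. apply Rinv_le_contravar; [lra|].
      pose proof (Cmod_triangle_inv z w). unfold r in *. lra.
Qed.

Lemma cauchy_lipschitz (F : C -> C) (p : C) (Rad M : R) (w : C) :
  0 < Rad -> hol F p Rad -> (forall z, Cmod (z - p) < Rad -> Cmod (F z) <= M) ->
  Cmod (w - p) <= Rad / 4 -> Cmod (F w - F p) <= 4 * M / Rad * Cmod (w - p).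
Proof.
  intros HR HF HM Hw.
  pose proof (cauchy_lipschitz_0 (fun z => F (p + z))%C Rad M (w - p) HR (hol_shift _ _ _ HF)) as H.
  cbv beta in H. rewrite Cplus_sub, Cplus_0_r in H. apply H; auto.
  intros z Hz. apply HM. now rewrite Cplus_sub_cancel.
Qed.

Fixpoint geom_sum (x : C) (K : nat) : C :=
  match K with O => 0%C | S k => (geom_sum x k + x ^ k)%C end.

Lemma geom_sum_spec (x : C) (K : nat) : (geom_sum x K * (1 - x))%C = (1 - x ^ K)%C.
Proof.
  induction K as [|K IH]; simpl; [ring|]. rewrite Cmult_plus_distr_r, IH. ring.
Qed.

Lemma geom_sum_bound (x : C) (K : nat) (B : R) :
  1 <= B -> Cmod x <= B -> Cmod (geom_sum x K) <= INR K * B ^ K.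
Proof.
  intros HB Hx. induction K as [|K IH]; [simpl; rewrite Cmod_0; lra|].
  simpl geom_sum. eapply Rle_trans; [apply Cmod_triangle|]. rewrite Cmod_pow, S_INR.
  assert (B ^ K <= B ^ S K) by (apply Rle_pow; auto).
  assert (Cmod x ^ K <= B ^ K) by (apply pow_incr; split; auto; apply Cmod_ge_0).
  pose proof (pos_INR K). nra.
Qed.

Lemma ex_der_geom_sum (f : C -> C) (z : C) (K : nat) :
  ex_der f z -> ex_der (fun y => geom_sum (f y) K) z.
Proof.
  intros H; induction K as [|K IH]; [apply (ex_der_const 0)|].
  apply (ex_der_plus (fun y => geom_sum (f y) K) (fun y => f y ^ K)%C); auto using ex_der_pow.
Qed.

Lemma half_pow_small (e : R) : 0 < e -> exists n : nat, (/ 2) ^ n < e.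
Proof.
  intros He. destruct (pow_lt_1_zero (/ 2) ltac:(rewrite Rabs_pos_eq; lra) e He) as [n Hn].
  exists n. specialize (Hn n (le_n n)). rewrite Rabs_pos_eq in Hn; auto. apply pow_le; lra.
Qed.

(* Qualitative Hadamard three circles: cut the Cauchy kernel z/(z-w) after K terms of its geometric
   series in w/z; the sum of these K terms times F has no singularity but 0, so its mean may be
   computed on a circle where F is tiny. *)
Lemma small_spread (Rad s eps : R) :
  0 < Rad -> 0 < s -> 0 < eps -> exists eps', 0 < eps' /\ forall (F : C -> C) (p : C),
    hol F p Rad -> (forall z, Cmod (z - p) < Rad -> Cmod (F z) <= 1) ->
    (forall z, Cmod (z - p) < s -> Cmod (F z) <= eps') ->
    forall z, Cmod (z - p) <= Rad / 4 -> Cmod (F z) <= eps.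
Proof.
  intros HR Hs He. pose proof PI_RGT_0 as Hpi.
  (* On |z| = Rad / 2 one has |w / z| <= 1/2 and the kernel is at most 2, so this K makes the tail
     at most eps / 2. *)
  destruct (half_pow_small (eps / 4)) as [K HK]; [lra|].
  set (r := Rad / 2). set (s0 := Rmin s r / 2).
  assert (Hr : 0 < r) by (unfold r; lra).
  assert (Hs0 : 0 < s0) by (unfold s0; pose proof (Rmin_pos s r Hs Hr); lra).
  assert (Hs1 : s0 < s) by (pose proof (Rmin_l s r); pose proof (Rmin_pos s r Hs Hr); unfold s0; lra).
  assert (Hs2 : s0 < r) by (pose proof (Rmin_r s r); pose proof (Rmin_pos s r Hs Hr); unfold s0; lra).
  set (B := r / s0). assert (HB : 1 <= B) by (unfold B; apply Rle_div_r; lra).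
  (* A bound for the geometric sum on |z| = s0, where |w / z| <= B; the added 1 keeps A positive for
     K = 0. *)
  set (A := (INR K + 1) * B ^ K).
  assert (HA : 0 < A).
  { unfold A. pose proof (pos_INR K). apply Rmult_lt_0_compat; [lra|]. apply pow_lt; lra. }
  exists (eps / (2 * A)). split; [apply Rdiv_lt_0_compat; lra|].
  intros F0 p HF0 HM0 HS0.
  assert (main : forall F, hol F 0 Rad -> (forall z, Cmod z < Rad -> Cmod (F z) <= 1) ->
    (forall z, Cmod z < s -> Cmod (F z) <= eps / (2 * A)) ->
    forall w, Cmod w <= Rad / 4 -> Cmod (F w) <= eps).
  2:{ intros z Hz. replace z with (p + (z - p))%C by ring.
      apply (main (fun z => F0 (p + z))%C); auto using hol_shift.
      - intros y Hy. apply HM0. now rewrite Cplus_sub_cancel.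
      - intros y Hy. apply HS0. now rewrite Cplus_sub_cancel. }
  clear F0 HF0 HM0 HS0 p. intros F HF HM HS w Hw. pose proof (Cmod_ge_0 w).
  assert (Hwr : Cmod w < r) by (unfold r; lra).
  assert (Hd : forall z : C, z <> 0 -> ex_der (fun z => geom_sum (w / z) K) z).
  { intros z Hz. apply ex_der_geom_sum. apply ex_der_div; auto using ex_der_const, ex_der_id. }
  assert (Hnz : forall (z : C) t, Cmod z = t -> 0 < t -> z <> 0).
  { intros z t Ez Ht. apply Cmod_gt_0; lra. }
  apply Rmult_le_reg_l with (2 * PI); [lra|].
  rewrite <- Cmod_2PI at 1. rewrite <- Cmod_mult.
  rewrite <- (cauchy_formula_hol F Rad r w); auto; [|unfold r; lra].
  assert (HrR : r < Rad) by (unfold r; lra).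
  set (P := fun z => (F z * geom_sum (w / z) K)%C).
  set (Q := fun z => (F z * ((w / z) ^ K * (z / (z - w))))%C).
  assert (CP : forall t, 0 < t < Rad -> forall z, Cmod z = t -> cont P z).
  { intros t Ht z Hz. apply cont_mult; [apply hol_circle_cont with Rad t; auto; lra|].
    apply ex_der_cont, Hd, (Hnz z t); lra. }
  assert (CQ : forall z, Cmod z = r -> cont Q z).
  { intros z Hz. apply cont_mult; [apply hol_circle_cont with Rad r; auto; lra|].
    apply cont_mult; [|apply kernel_cont with r; auto].
    apply ex_der_cont, ex_der_pow, ex_der_div; auto using ex_der_const, ex_der_id.
    apply (Hnz z r); lra. }
  rewrite (CI_ext _ (fun z => P z + Q z)%C r); [|lra|].
  2:{ intros z Hz. unfold P, Q. assert (z <> 0) by (apply (Hnz z r); lra).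
      assert (z <> w) by (apply Cmod_neq; lra).
      assert (Z1 : (z - w)%C <> 0) by now apply Csub_neq_0.
      pose proof (geom_sum_spec (w / z) K) as E.
      replace (geom_sum (w / z) K) with ((1 - (w / z) ^ K) * (z / (z - w)))%C.
      - ring.
      - rewrite <- E. field; auto. }
  rewrite CI_plus; try lra; auto.
  2:{ apply CP; unfold r; lra. }
  rewrite <- (CI_annulus P s0 r); try lra.
  2:{ intros z Hz. apply ex_der_mult; [apply HF; rewrite Cmod_sub_0; lra|].
      apply Hd. apply (Hnz z (Cmod z)); lra. }
  eapply Rle_trans; [apply Cmod_triangle|].
  replace (2 * PI * eps) with (2 * PI * (eps / 2) + 2 * PI * (eps / 2)) by field.
  apply Rplus_le_compat; apply CI_bound; try lra; auto.
  - apply CP; lra.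
  - intros z Hz. unfold P. rewrite Cmod_mult.
    assert (z <> 0) by (apply (Hnz z s0); lra).
    replace (eps / 2) with (eps / (2 * A) * A) by (field; lra).
    apply Rmult_le_compat; try apply Cmod_ge_0; [apply HS; lra|].
    apply Rle_trans with (INR K * B ^ K).
    + apply geom_sum_bound; auto. rewrite Cmod_div, Hz by auto.
      apply Rmult_le_compat_r; [left; now apply Rinv_0_lt_compat|lra].
    + apply Rmult_le_compat_r; [apply pow_le; lra|lra].
  - intros z Hz. unfold Q. assert (z <> 0) by (apply (Hnz z r); lra).
    rewrite !Cmod_mult.
    replace (eps / 2) with (1 * ((eps / 4) * 2)) by field.
    apply Rmult_le_compat; try apply Cmod_ge_0.
    + apply Rmult_le_pos; apply Cmod_ge_0.
    + apply HM; lra.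
    + apply Rmult_le_compat; try apply Cmod_ge_0.
      * rewrite Cmod_pow. eapply Rle_trans; [|left; exact HK]. apply pow_incr.
        split; [apply Cmod_ge_0|]. rewrite Cmod_div, Hz by auto.
        apply Rle_div_l; [lra|]. unfold r; lra.
      * eapply Rle_trans; [apply kernel_bound; eauto|]. apply Rle_div_l; unfold r; lra.
Qed.

(** G is the difference quotient of F at 0; it is continuous at 0, where its singularity is
    removable. *)
Lemma divide_zero (F : C -> C) (Rad : R) :
  0 < Rad -> hol F 0 Rad -> F 0 = 0 -> exists G, hol G 0 Rad /\ forall z, F z = (z * G z)%C.
Proof.
  intros HR HF H0. destruct (ex_der_slope F 0) as [l Hl].
  { apply HF. rewrite Cmod_sub_self; auto. }
  assert (HD : forall z, Cmod z < Rad -> z <> 0 -> ex_der (slope F 0 l) z).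
  { intros z Hz N. assert (0 < Cmod z) by now apply Cmod_gt_0.
    apply ex_der_ext_loc with (fun z => (F z - F 0) / (z - 0))%C (Cmod z); auto.
    - intros y Hy. unfold slope. destruct (Ceq_dec y 0) as [->|]; auto.
      rewrite Cmod_sub_sym, Cmod_sub_0 in Hy. lra.
    - apply ex_der_div; [now apply Csub_neq_0| |]; apply ex_der_minus;
        auto using ex_der_const, ex_der_id. apply HF. now rewrite Cmod_sub_0. }
  exists (slope F 0 l); split.
  - intros z Hz. rewrite Cmod_sub_0 in Hz.
    destruct (Ceq_dec z 0) as [->|N]; auto.
    apply removable_singularity_0 with Rad; auto.
    intros z Hz'. destruct (Ceq_dec z 0) as [->|N]; auto using ex_der_cont.
  - intros z. rewrite (slope_spec F 0 l z) at 1. rewrite H0. ring.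
Qed.

(** If division by z never stops, then F = z^k G_k for every k; the maximum principle for G_k on a
    circle of radius r where |F| <= M gives |F w| <= M 2^-k for |w| < r / 2, hence F w = 0. *)
Lemma zero_order_0 (F : C -> C) (Rad : R) :
  0 < Rad -> hol F 0 Rad ->
  (exists d, 0 < d /\ forall z, Cmod z < d -> F z = 0) \/
  (exists k G, hol G 0 Rad /\ G 0 <> 0 /\ forall z, F z = (z ^ k * G z)%C).
Proof.
  intros HR HF. apply NNPP. intros N.
  assert (D : forall k, exists G, hol G 0 Rad /\ forall z, F z = (z ^ k * G z)%C).
  { induction k as [|k [G [HG E]]]; [exists F; split; auto; intros; simpl; ring|].
    destruct (divide_zero G Rad HR HG) as [H [HH E']].
    - apply NNPP; intros G0. apply N. right. now exists k, G.
    - exists H; split; auto. intros z. rewrite E, E'. simpl; ring. }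
  apply N; left.
  destruct (hol_cont F 0 Rad 0 HF) with (eps := 1) as [d [Hd K]];
    [rewrite Cmod_sub_self; auto|lra|].
  set (r := Rmin d Rad / 2).
  assert (0 < r) by (unfold r; pose proof (Rmin_pos d Rad Hd HR); lra).
  assert (r < d) by (unfold r in *; pose proof (Rmin_l d Rad); lra).
  assert (r < Rad) by (unfold r in *; pose proof (Rmin_r d Rad); lra).
  exists (r / 2); split; [lra|]. intros w Hw.
  set (M := Cmod (F 0) + 1). assert (HM : 0 < M) by (unfold M; pose proof (Cmod_ge_0 (F 0)); lra).
  apply Cmod_eq_0, Rle_antisym; [|apply Cmod_ge_0]. apply Rnot_lt_le; intros Hp.
  destruct (half_pow_small (Cmod (F w) / M)) as [k Hk]; [apply Rdiv_lt_0_compat; auto|].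
  destruct (D k) as [G [HG E]].
  assert (HGw : Cmod (G w) <= M / r ^ k).
  { apply (maximum_modulus_0 G Rad r); auto; [|lra]. intros z Hz.
    assert (Fz : Cmod (F z) <= M).
    { specialize (K z). rewrite Cmod_sub_0 in K. specialize (K ltac:(lra)).
      pose proof (Cmod_triangle_inv (F z) (F 0)). unfold M; lra. }
    rewrite E, Cmod_mult, Cmod_pow, Hz in Fz. apply Rle_div_r; [now apply pow_lt|lra]. }
  apply Rlt_div_r in Hk; auto.
  apply (Rlt_irrefl (Cmod (F w))). eapply Rle_lt_trans; [|exact Hk].
  rewrite E, Cmod_mult, Cmod_pow.
  apply Rle_trans with ((r / 2) ^ k * (M / r ^ k)).
  - apply Rmult_le_compat; auto using Cmod_ge_0.
    + apply pow_le, Cmod_ge_0.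
    + apply pow_incr; split; [apply Cmod_ge_0|lra].
  - apply Req_le. unfold Rdiv. rewrite Rpow_mult_distr. field. apply pow_nonzero; lra.
Qed.

Lemma zero_order (F : C -> C) (p : C) (Rad : R) :
  0 < Rad -> hol F p Rad ->
  (exists d, 0 < d /\ forall z, Cmod (z - p) < d -> F z = 0) \/
  (exists k G, hol G p Rad /\ G p <> 0 /\ forall z, F z = ((z - p) ^ k * G z)%C).
Proof.
  intros HR HF. destruct (zero_order_0 _ Rad HR (hol_shift _ _ _ HF)) as [[d [Hd E]]|[k [G [HG [G0 E]]]]].
  - left. exists d; split; auto. intros z Hz. rewrite <- (Cplus_sub p z). now apply E.
  - right. exists k, (fun z => G (z - p))%C. split; [|split].
    + apply hol_unshift. intros z Hz. apply ex_der_ext with G; auto.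
      intros y. now rewrite Cplus_sub_cancel.
    + now rewrite Csub_diag.
    + intros z. rewrite <- E. now rewrite Cplus_sub.
Qed.

Lemma cont_uniform_limit (Fn : nat -> C -> C) (g : C -> C) (z : C) (r : R) :
  0 < r -> (forall n, cont (Fn n) z) ->
  (forall e, 0 < e -> exists N, forall n, (N <= n)%nat -> forall y, Cmod (y - z) < r ->
     Cmod (Fn n y - g y) <= e) -> cont g z.
Proof.
  intros Hr HC HU e He. destruct (HU (e/4)) as [N HN]; [lra|]. specialize (HN N (le_n N)).
  destruct (HC N (e/4)) as [d [Hd K]]; [lra|].
  exists (Rmin d r); split; [now apply Rmin_pos|]. intros y Hy.
  pose proof (Rmin_l d r). pose proof (Rmin_r d r).
  specialize (K y ltac:(lra)). pose proof (HN y ltac:(lra)) as H1.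
  pose proof (HN z ltac:(rewrite Cmod_sub_self; lra)) as H2.
  replace (g y - g z)%C with (- (Fn N y - g y) + (Fn N y - Fn N z) + (Fn N z - g z))%C by ring.
  pose proof (Cmod_triangle (- (Fn N y - g y) + (Fn N y - Fn N z)) (Fn N z - g z)).
  pose proof (Cmod_triangle (- (Fn N y - g y)) (Fn N y - Fn N z)).
  rewrite Cmod_opp in *. lra.
Qed.

(** Cauchy's formula passes to the uniform limit, and Cauchy integrals are differentiable. *)
Lemma weierstrass (Fn : nat -> C -> C) (g : C -> C) (Rad M : R) :
  (forall n, hol (Fn n) 0 Rad) -> (forall z, Cmod z < Rad -> Cmod (g z) <= M) ->
  (forall e, 0 < e -> exists N, forall n, (N <= n)%nat -> forall z, Cmod z < Rad ->
     Cmod (Fn n z - g z) <= e) ->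
  hol g 0 Rad.
Proof.
  intros HF HM HU w0 Hw0. rewrite Cmod_sub_0 in Hw0. pose proof PI_RGT_0. pose proof (Cmod_ge_0 w0).
  assert (HC : forall z, Cmod z < Rad -> cont g z).
  { intros z Hz. apply cont_uniform_limit with Fn (Rad - Cmod z); [lra| |].
    - intros n. apply (hol_cont _ 0 Rad); auto. now rewrite Cmod_sub_0.
    - intros e He. destruct (HU e He) as [N HN]. exists N. intros n Hn y Hy. apply HN; auto.
      pose proof (Cmod_triangle_inv y z). lra. }
  set (r := (Cmod w0 + Rad) / 2).
  assert (Hr : 0 < r < Rad) by (unfold r; lra).
  assert (Cg : forall z, Cmod z = r -> cont g z) by (intros; apply HC; lra).
  apply cauchy_integral_ex_der with g r M (/ RtoC (2 * PI))%C; auto.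
  { unfold r; lra. }
  { intros; apply HM; lra. }
  intros w Hw. pose proof (Cmod_ge_0 w).
  assert (Ck : forall h, (forall z, Cmod z = r -> cont h z) -> forall z, Cmod z = r ->
    cont (fun z => h z * (z / (z - w)))%C z).
  { intros h Hh z Hz. apply cont_mult; auto. apply kernel_cont with r; auto. }
  assert (E : CI (fun z => g z * (z / (z - w)))%C r = (RtoC (2 * PI) * g w)%C).
  2:{ rewrite E. field. apply RtoC_2PI_neq_0. }
  apply Csub_eq_0, Cmod_eq_0.
  set (D := Cmod (CI (fun z => g z * (z / (z - w)))%C r - RtoC (2 * PI) * g w)).
  set (B := r / (r - Cmod w)).
  assert (HB : 0 < B) by (apply Rdiv_lt_0_compat; lra).
  assert (HD : forall e, 0 < e -> D <= 2 * PI * (B + 1) * e).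
  { intros e He. destruct (HU e He) as [N HN]. specialize (HN N (le_n N)).
    assert (CN : forall z, Cmod z = r -> cont (Fn N) z) by (apply hol_circle_cont with Rad; auto; lra).
    unfold D.
    replace (CI (fun z => g z * (z / (z - w)))%C r - RtoC (2 * PI) * g w)%C with
      ((RtoC (2 * PI) * (Fn N w - g w))
       - (RtoC (2 * PI) * Fn N w - CI (fun z => g z * (z / (z - w)))%C r))%C by ring.
    eapply Rle_trans; [apply Cmod_triangle_minus|].
    rewrite Cmod_mult, Cmod_2PI.
    rewrite <- (cauchy_formula_hol (Fn N) Rad r w) by auto.
    rewrite <- CI_minus; auto; try lra.
    assert (Cmod (CI (fun z => Fn N z * (z / (z - w)) - g z * (z / (z - w)))%C r) <= 2 * PI * (e * B)).
    { apply CI_bound; [lra| |].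
      - intros z Hz. apply cont_minus; auto.
      - intros z Hz. replace (Fn N z * (z / (z - w)) - g z * (z / (z - w)))%C with
          ((Fn N z - g z) * (z / (z - w)))%C by ring.
        rewrite Cmod_mult. apply Rmult_le_compat; try apply Cmod_ge_0.
        + apply HN; lra.
        + now apply kernel_bound. }
    specialize (HN w ltac:(lra)).
    assert (2 * PI * Cmod (Fn N w - g w) <= 2 * PI * e) by (apply Rmult_le_compat_l; lra). lra. }
  apply Rle_antisym; [|apply Cmod_ge_0]. fold D. apply Rnot_lt_le; intros Dp.
  assert (W : 0 < 2 * PI * (B + 1)) by (apply Rmult_lt_0_compat; lra).
  specialize (HD (D / 2 / (2 * PI * (B + 1))) ltac:(apply Rdiv_lt_0_compat; lra)).
  replace (2 * PI * (B + 1) * (D / 2 / (2 * PI * (B + 1)))) with (D / 2) in HD by (field; lra). lra.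
Qed.

(** * The Riemann sphere *)

(* Pins the type argument of [Some]: Coquelicot's [C] and [Cplx] are convertible, but [rewrite] tells
   them apart. *)
Notation Fin := (@Some Cplx).

Definition iota (u : sphere) : sphere :=
  match u with
  | None => Fin (RtoC 0)
  | Some w => if Ceq_dec w 0 then None else Fin (/ w)%C
  end.

Lemma iota_Some (w : C) : w <> 0 -> iota (Fin w) = Fin (/ w)%C.
Proof. intros H. unfold iota. now destruct (Ceq_dec w 0). Qed.

Lemma iota_0 : iota (Fin (RtoC 0)) = None.
Proof. unfold iota. destruct (Ceq_dec 0 0) as [_|N]; [reflexivity|now elim N]. Qed.

Lemma Cinv_neq_0 (w : C) : w <> 0 -> (/ w)%C <> 0.
Proof. intros H. apply Cmod_gt_0. rewrite Cmod_inv by auto. now apply Rinv_0_lt_compat, Cmod_gt_0. Qed.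

Lemma Cinv_inv (w : C) : w <> 0 -> (/ / w)%C = w.
Proof. intros H. field. auto. Qed.

Lemma iota_involutive (u : sphere) : iota (iota u) = u.
Proof.
  destruct u as [w|]; [|apply iota_0].
  destruct (Ceq_dec w 0) as [->|N]; [now rewrite iota_0|].
  rewrite !iota_Some, Cinv_inv; auto. now apply Cinv_neq_0.
Qed.

Lemma Req_EM_T_iota (w : C) :
  (if Req_EM_T (fst w) 0 then if Req_EM_T (snd w) 0 then None else Fin (Defs.Cinv w)
   else Fin (Defs.Cinv w)) = iota (Fin w).
Proof.
  unfold iota. destruct (Ceq_dec w 0) as [->|N].
  - simpl. destruct (Req_EM_T 0 0); [reflexivity|lra].
  - destruct (Req_EM_T (fst w) 0) as [E1|]; [|reflexivity].
    destruct (Req_EM_T (snd w) 0) as [E2|]; [|reflexivity].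
    elim N. rewrite (surjective_pairing w), E1, E2. reflexivity.
Qed.

(** Stereographic projection to the unit sphere of R^3. It turns [rhoS] into the chordal distance,
    from which the triangle inequality and the invariance under inversion are read off. *)
Definition stereo (u : sphere) : R * R * R :=
  match u with
  | None => (0, 0, 1)
  | Some z => let m := 1 + fst z ^ 2 + snd z ^ 2 in
              (2 * fst z / m, 2 * snd z / m, (m - 2) / m)
  end.

Definition dist3_sqr (p q : R * R * R) : R :=
  match p, q with (a, b, c), (a', b', c') => (a - a') ^ 2 + (b - b') ^ 2 + (c - c') ^ 2 end.

Lemma dist3_sqr_ge_0 (p q : R * R * R) : 0 <= dist3_sqr p q.
Proof.
  destruct p as [[a b] c], q as [[a' b'] c']. unfold dist3_sqr.
  repeat apply Rplus_le_le_0_compat; apply pow2_ge_0.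
Qed.

Lemma Cmod_sqr (z : C) : Cmod z ^ 2 = fst z ^ 2 + snd z ^ 2.
Proof. apply Cmod2_alt. Qed.

Lemma sqr_sqrt_pow (x : R) : 0 <= x -> sqrt x ^ 2 = x.
Proof. intros H. simpl. rewrite Rmult_1_r. now apply sqrt_sqrt. Qed.

Lemma rhoS_stereo_finite_infinite (z : C) :
  2 / sqrt (1 + Cmod z ^ 2) = sqrt (dist3_sqr (stereo (Fin z)) (stereo None)).
Proof.
  assert (M : 0 < 1 + fst z ^ 2 + snd z ^ 2) by nra.
  symmetry; apply sqrt_lem_1.
  - apply dist3_sqr_ge_0.
  - left; apply Rdiv_lt_0_compat; [lra|]. apply sqrt_lt_R0. rewrite Cmod_sqr; lra.
  - replace (2 / sqrt (1 + Cmod z ^ 2) * (2 / sqrt (1 + Cmod z ^ 2))) with (4 / sqrt (1 + Cmod z ^ 2) ^ 2).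
    2:{ field. apply Rgt_not_eq, sqrt_lt_R0. rewrite Cmod_sqr; lra. }
    rewrite sqr_sqrt_pow, Cmod_sqr by (rewrite Cmod_sqr; lra).
    unfold dist3_sqr, stereo. field. lra.
Qed.

Lemma rhoS_stereo (u v : sphere) : rhoS u v = sqrt (dist3_sqr (stereo u) (stereo v)).
Proof.
  destruct u as [z|], v as [w|]; unfold rhoS; change Cnorm with Cmod.
  - assert (M : 0 < 1 + fst z ^ 2 + snd z ^ 2) by nra.
    assert (M' : 0 < 1 + fst w ^ 2 + snd w ^ 2) by nra.
    assert (P : 0 < (1 + Cmod z ^ 2) * (1 + Cmod w ^ 2)).
    { rewrite !Cmod_sqr. apply Rmult_lt_0_compat; lra. }
    symmetry; apply sqrt_lem_1.
    + apply dist3_sqr_ge_0.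
    + apply Rdiv_le_0_compat; [|now apply sqrt_lt_R0].
      pose proof (Cmod_ge_0 (Defs.Csub z w)). lra.
    + set (S := sqrt ((1 + Cmod z ^ 2) * (1 + Cmod w ^ 2))).
      assert (HS : 0 < S) by now apply sqrt_lt_R0.
      replace (2 * Cmod (Defs.Csub z w) / S * (2 * Cmod (Defs.Csub z w) / S)) with
        (4 * Cmod (Defs.Csub z w) ^ 2 / S ^ 2) by (field; lra).
      unfold S. rewrite sqr_sqrt_pow, !Cmod_sqr by lra.
      unfold dist3_sqr, stereo, Defs.Csub, Defs.Cadd, Defs.Copp; simpl fst; simpl snd. field. lra.
  - apply rhoS_stereo_finite_infinite.
  - rewrite rhoS_stereo_finite_infinite. f_equal. unfold dist3_sqr, stereo. ring.
  - unfold dist3_sqr, stereo. replace ((0 - 0) ^ 2 + (0 - 0) ^ 2 + (1 - 1) ^ 2) with 0 by ring.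
    now rewrite sqrt_0.
Qed.

Lemma dist3_triangle (p q r : R * R * R) :
  sqrt (dist3_sqr p r) <= sqrt (dist3_sqr p q) + sqrt (dist3_sqr q r).
Proof.
  destruct p as [[a b] c], q as [[a' b'] c'], r as [[a'' b''] c'']. unfold dist3_sqr.
  set (x := a - a'). set (y := b - b'). set (z := c - c').
  set (x' := a' - a''). set (y' := b' - b''). set (z' := c' - c'').
  replace (a - a'') with (x + x') by (unfold x, x'; ring).
  replace (b - b'') with (y + y') by (unfold y, y'; ring).
  replace (c - c'') with (z + z') by (unfold z, z'; ring).
  clearbody x y z x' y' z'.
  set (P := x ^ 2 + y ^ 2 + z ^ 2). set (Q := x' ^ 2 + y' ^ 2 + z' ^ 2).
  assert (HP : 0 <= P) by (unfold P; nra). assert (HQ : 0 <= Q) by (unfold Q; nra).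
  pose proof (sqrt_pos P). pose proof (sqrt_pos Q).
  assert (CS : x * x' + y * y' + z * z' <= sqrt P * sqrt Q).
  { rewrite <- sqrt_mult by auto. apply Rle_trans with (Rabs (x * x' + y * y' + z * z')); [apply Rle_abs|].
    rewrite <- sqrt_Rsqr_abs. apply sqrt_le_1_alt. unfold Rsqr, P, Q.
    (* By Lagrange's identity these three squares add up to the defect in the Cauchy-Schwarz
       inequality. *)
    pose proof (pow2_ge_0 (x * y' - y * x')). pose proof (pow2_ge_0 (x * z' - z * x')).
    pose proof (pow2_ge_0 (y * z' - z * y')). nra. }
  apply Rsqr_incr_0_var; [|lra]. unfold Rsqr.
  rewrite sqrt_sqrt by (repeat apply Rplus_le_le_0_compat; apply pow2_ge_0).
  pose proof (sqrt_sqrt P HP). pose proof (sqrt_sqrt Q HQ). unfold P, Q in *. nra.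
Qed.

Lemma rhoS_triangle (u v w : sphere) : rhoS u w <= rhoS u v + rhoS v w.
Proof. rewrite !rhoS_stereo. apply dist3_triangle. Qed.

Lemma rhoS_sym (u v : sphere) : rhoS u v = rhoS v u.
Proof.
  rewrite !rhoS_stereo. f_equal. destruct (stereo u) as [[? ?] ?], (stereo v) as [[? ?] ?].
  unfold dist3_sqr. ring.
Qed.

Lemma rhoS_ge_0 (u v : sphere) : 0 <= rhoS u v.
Proof. rewrite rhoS_stereo. apply sqrt_pos. Qed.

Lemma rhoS_refl (u : sphere) : rhoS u u = 0.
Proof.
  rewrite rhoS_stereo. destruct (stereo u) as [[a b] c]. unfold dist3_sqr.
  replace ((a - a) ^ 2 + (b - b) ^ 2 + (c - c) ^ 2) with 0 by ring. apply sqrt_0.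
Qed.

Lemma Cinv_fst (z : C) : fst (/ z)%C = fst z / (fst z ^ 2 + snd z ^ 2).
Proof. reflexivity. Qed.
Lemma Cinv_snd (z : C) : snd (/ z)%C = - snd z / (fst z ^ 2 + snd z ^ 2).
Proof. reflexivity. Qed.

(** On the sphere, inversion is the rotation by pi about the first axis, hence an isometry. *)
Lemma stereo_iota (u : sphere) :
  stereo (iota u) = match stereo u with (a, b, c) => (a, - b, - c) end.
Proof.
  destruct u as [z|].
  - destruct (Ceq_dec z 0) as [->|N].
    + rewrite iota_0. unfold stereo; simpl. f_equal; [f_equal|]; field.
    + rewrite iota_Some by auto. unfold stereo. rewrite Cinv_fst, Cinv_snd.
      assert (0 < fst z ^ 2 + snd z ^ 2).
      { rewrite <- Cmod_sqr. apply pow_lt. now apply Cmod_gt_0. }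
      f_equal; [f_equal|]; field; nra.
  - unfold stereo; simpl. f_equal; [f_equal|]; field.
Qed.

Lemma rhoS_iota (u v : sphere) : rhoS (iota u) (iota v) = rhoS u v.
Proof.
  rewrite !rhoS_stereo, !stereo_iota. f_equal.
  destruct (stereo u) as [[? ?] ?], (stereo v) as [[? ?] ?]. unfold dist3_sqr. ring.
Qed.

Lemma rhoS_Some_le (z w : C) : rhoS (Fin z) (Fin w) <= 2 * Cmod (z - w).
Proof.
  unfold rhoS. change Cnorm with Cmod. change (Defs.Csub z w) with (z - w)%C.
  assert (1 <= sqrt ((1 + Cmod z ^ 2) * (1 + Cmod w ^ 2))).
  { rewrite <- sqrt_1 at 1. apply sqrt_le_1_alt.
    pose proof (pow2_ge_0 (Cmod z)). pose proof (pow2_ge_0 (Cmod w)). nra. }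
  pose proof (Cmod_ge_0 (z - w)). apply Rle_div_l; [lra|]. nra.
Qed.

Lemma Cmod_le_rhoS (z w : C) (M : R) :
  Cmod z <= M -> Cmod w <= M -> Cmod (z - w) <= (1 + M ^ 2) / 2 * rhoS (Fin z) (Fin w).
Proof.
  intros Hz Hw. unfold rhoS. change Cnorm with Cmod. change (Defs.Csub z w) with (z - w)%C.
  pose proof (Cmod_ge_0 z). pose proof (Cmod_ge_0 w).
  set (S := sqrt ((1 + Cmod z ^ 2) * (1 + Cmod w ^ 2))).
  assert (S1 : 0 < S).
  { apply sqrt_lt_R0. apply Rmult_lt_0_compat; [pose proof (pow2_ge_0 (Cmod z))|pose proof (pow2_ge_0 (Cmod w))]; lra. }
  assert (S2 : S <= 1 + M ^ 2).
  { assert (0 <= 1 + M ^ 2) by (pose proof (pow2_ge_0 M); lra).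
    rewrite <- (sqrt_square (1 + M ^ 2)) by auto. apply sqrt_le_1_alt.
    assert (Cmod z ^ 2 <= M ^ 2) by (apply pow_incr; lra).
    assert (Cmod w ^ 2 <= M ^ 2) by (apply pow_incr; lra).
    pose proof (pow2_ge_0 (Cmod z)). pose proof (pow2_ge_0 (Cmod w)).
    apply Rmult_le_compat; lra. }
  replace ((1 + M ^ 2) / 2 * (2 * Cmod (z - w) / S)) with ((1 + M ^ 2) * Cmod (z - w) / S) by (field; lra).
  apply Rle_div_r; auto. pose proof (Cmod_ge_0 (z - w)). nra.
Qed.

(** It includes finiteness of u; with a large e the same predicate expresses boundedness. *)
Definition small (e : R) (u : sphere) : Prop := exists w : C, u = Fin w /\ Cmod w <= e.

Lemma small_le (e e' : R) (u : sphere) : e <= e' -> small e u -> small e' u.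
Proof. intros H [w [E Hw]]. exists w; split; auto; lra. Qed.

Lemma small_rhoS (e : R) (u : sphere) : small e u -> rhoS u (Fin (RtoC 0)) <= 2 * e.
Proof.
  intros [w [-> Hw]]. eapply Rle_trans; [apply rhoS_Some_le|]. rewrite Cmod_sub_0. lra.
Qed.

Lemma rhoS_0_oo : rhoS (Fin (RtoC 0)) None = 2.
Proof.
  unfold rhoS. change Cnorm with Cmod. rewrite Cmod_0. replace (1 + 0 ^ 2) with 1 by ring.
  rewrite sqrt_1. field.
Qed.

(** Infinity is excluded, being at distance 2 from 0. For x = |u| the hypothesis reads 4 x^2 <= e^2
    (1 + x^2), and e <= 1 turns this into 3 x^2 <= e^2. *)
Lemma rhoS_small (e : R) (u : sphere) : e <= 1 -> rhoS u (Fin (RtoC 0)) <= e -> small e u.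
Proof.
  intros He H. destruct u as [w|].
  2:{ rewrite rhoS_sym, rhoS_0_oo in H. lra. }
  exists w; split; auto. pose proof (rhoS_ge_0 (Fin w) (Fin (RtoC 0))) as P.
  unfold rhoS in H, P. change Cnorm with Cmod in *.
  change (Defs.Csub w (RtoC 0)) with (w - 0)%C in *. rewrite Cmod_sub_0, Cmod_0 in *.
  pose proof (Cmod_ge_0 w). set (x := Cmod w) in *.
  replace ((1 + x ^ 2) * (1 + 0 ^ 2)) with (1 + x ^ 2) in * by ring.
  assert (S1 : 0 < 1 + x ^ 2) by nra.
  assert (S2 : 0 < sqrt (1 + x ^ 2)) by now apply sqrt_lt_R0.
  pose proof (sqrt_sqrt (1 + x ^ 2) ltac:(lra)) as S3.
  assert (Hx : 2 * x <= e * sqrt (1 + x ^ 2)) by (apply Rle_div_l; auto).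
  set (S := sqrt (1 + x ^ 2)) in *.
  assert (0 <= e) by lra.
  assert (H4 : (2 * x) * (2 * x) <= (e * S) * (e * S)) by (apply Rmult_le_compat; lra).
  assert (H5 : 4 * (x * x) <= e * e * (1 + x ^ 2)) by (rewrite <- S3; lra).
  assert (e * e <= 1) by nra.
  assert (e * e * x ^ 2 <= x ^ 2) by nra.
  apply Rsqr_incr_0_var; auto. unfold Rsqr. nra.
Qed.

(** The value 0 at infinity is a mere default: [val] is evaluated where finiteness is known. *)
Definition val (u : sphere) : C := match u with Some w => w | None => RtoC 0 end.

Lemma small_val (e : R) (u : sphere) : small e u -> u = Fin (val u) /\ Cmod (val u) <= e.
Proof. intros [w [-> H]]. now split. Qed.

Lemma not_None_val (u : sphere) : u <> None -> u = Fin (val u).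
Proof. destruct u; [reflexivity|congruence]. Qed.


(** * Zeros and poles of meromorphic functions *)

Lemma Fin_eq (z w : C) : z = w -> Fin z = Fin w.
Proof. now intros ->. Qed.

(** The local half of [meromorphic]. The other half, that f is somewhere finite, is lost by [flip]
    when f is identically 0; this half is not. *)
Definition locmero (f : Cplx -> sphere) : Prop :=
  forall z0 : C, exists r, 0 < r /\ exists g : C -> C, hol g z0 r /\
    ((forall z : C, Cmod (z - z0) < r -> f z = Fin (g z)) \/
     (forall z : C, Cmod (z - z0) < r -> f z = iota (Fin (g z)))).

Definition flip (f : Cplx -> sphere) : Cplx -> sphere := fun z => iota (f z).

Lemma holo_on_disc_iff (g : C -> C) (z0 : C) (r : R) : holo_on_disc g z0 r <-> hol g z0 r.
Proof.
  split; intros H z Hz; [apply C_differentiable_iff|apply (proj2 (C_differentiable_iff g z))]; apply H, Hz.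
Qed.

Lemma meromorphic_locmero (f : Cplx -> sphere) : meromorphic f -> locmero f.
Proof.
  intros [H _] z0. destruct (H z0) as [r [Hr [g [Hg D]]]]. exists r; split; auto.
  exists g; split; [now apply holo_on_disc_iff|]. destruct D as [D|D]; [left; exact D|right].
  intros z Hz. rewrite <- Req_EM_T_iota. apply (D z Hz).
Qed.

Lemma flip_flip (f : Cplx -> sphere) : flip (flip f) = f.
Proof. apply functional_extensionality. intros z. apply iota_involutive. Qed.

Lemma locmero_flip (f : Cplx -> sphere) : locmero f -> locmero (flip f).
Proof.
  intros H z0. destruct (H z0) as [r [Hr [g [Hg D]]]]. exists r; split; auto. exists g; split; auto.
  destruct D as [D|D]; [right|left]; intros z Hz; unfold flip; rewrite D by auto; auto.
  apply iota_involutive.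
Qed.

Lemma locmero_hol_val (f : Cplx -> sphere) (p : C) (r : R) :
  locmero f -> (forall z : C, Cmod (z - p) < r -> f z <> None) -> hol (fun z => val (f z)) p r.
Proof.
  intros Hf HN z Hz. destruct (Hf z) as [s [Hs [g [Hg D]]]].
  assert (Hgz : ex_der g z) by (apply Hg; rewrite Cmod_sub_self; auto).
  assert (Hm : 0 < Rmin s (r - Cmod (z - p))) by (apply Rmin_pos; lra).
  destruct D as [D|D].
  - apply ex_der_ext_loc with g s; auto. intros y Hy. now rewrite D.
  - assert (N0 : forall y : C, Cmod (y - z) < Rmin s (r - Cmod (z - p)) -> g y <> 0).
    { intros y Hy E. pose proof (Rmin_l s (r - Cmod (z - p))). pose proof (Rmin_r s (r - Cmod (z - p))).
      apply (HN y); [pose proof (Cmod_sub_triangle y z p); lra|].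
      rewrite D by lra. now rewrite E, iota_0. }
    apply ex_der_ext_loc with (fun y => / g y)%C (Rmin s (r - Cmod (z - p))); auto.
    + intros y Hy. pose proof (Rmin_l s (r - Cmod (z - p))). rewrite D by lra.
      now rewrite iota_Some by auto.
    + apply ex_der_inv; auto. apply N0. now rewrite Cmod_sub_self.
Qed.

Lemma locmero_cont (f : Cplx -> sphere) (z0 : C) (e : R) :
  locmero f -> 0 < e -> exists d, 0 < d /\ forall z : C, Cmod (z - z0) < d -> rhoS (f z) (f z0) < e.
Proof.
  intros Hf He. destruct (Hf z0) as [r [Hr [g [Hg D]]]].
  destruct (hol_cont g z0 r z0 Hg) with (eps := e / 2) as [d [Hd K]];
    [rewrite Cmod_sub_self; auto|lra|].
  exists (Rmin d r). split; [now apply Rmin_pos|]. intros z Hz.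
  pose proof (Rmin_l d r). pose proof (Rmin_r d r).
  assert (Cmod (z0 - z0) < r) by (rewrite Cmod_sub_self; auto).
  specialize (K z ltac:(lra)).
  destruct D as [D|D]; rewrite !D by lra; rewrite ?rhoS_iota; pose proof (rhoS_Some_le (g z) (g z0)); lra.
Qed.

(** Connectedness of the plane: along the segment from z to w the indicator of P has derivative 0,
    so it is constant. *)
Lemma locally_constant_prop (P : C -> Prop) :
  (forall z, exists d, 0 < d /\ forall y, Cmod (y - z) < d -> (P y <-> P z)) ->
  forall z w, P z -> P w.
Proof.
  intros H z w Hz. apply NNPP; intros Hw.
  set (g := fun t : R => (z + RtoC t * (w - z))%C).
  set (phi := fun t : R => if excluded_middle_informative (P (g t)) then 1 else 0).
  assert (E : phi 0 = phi 1).
  { apply (eq_is_derive (V:=R_NormedModule) phi 0 1); [|lra]. intros t _.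
    destruct (H (g t)) as [d [Hd K]].
    assert (W : 0 < Cmod (w - z) + 1) by (pose proof (Cmod_ge_0 (w - z)); lra).
    apply is_derive_ext_loc with (fun _ => phi t); [|apply (is_derive_const (V:=R_NormedModule))].
    assert (Hq : 0 < d / (Cmod (w - z) + 1)) by now apply Rdiv_lt_0_compat.
    exists (mkposreal _ Hq). intros s Hs. change (Rabs (s - t) < d / (Cmod (w - z) + 1)) in Hs.
    apply Rlt_div_r in Hs; auto.
    assert (Ks : P (g s) <-> P (g t)).
    { apply K. unfold g.
      replace (z + RtoC s * (w - z) - (z + RtoC t * (w - z)))%C with (RtoC (s - t) * (w - z))%C
        by (rewrite RtoC_minus; ring).
      rewrite Cmod_mult, Cmod_R. pose proof (Rabs_pos (s - t)). pose proof (Cmod_ge_0 (w - z)). nra. }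
    unfold phi. destruct (excluded_middle_informative (P (g s))),
      (excluded_middle_informative (P (g t))); tauto. }
  unfold phi in E.
  replace (g 0) with z in E by (unfold g; ring). replace (g 1) with w in E by (unfold g; ring).
  destruct (excluded_middle_informative (P z)), (excluded_middle_informative (P w)); try tauto; lra.
Qed.

Definition nowhere (f : Cplx -> sphere) (c : sphere) : Prop :=
  forall z0 : C, ~ exists d, 0 < d /\ forall z : C, Cmod (z - z0) < d -> f z = c.

(** An identity theorem. Being infinite near a point is a locally constant property: where f = 1/g,
    the zeros of g either fill a disc or are isolated. *)
Lemma nowhere_None (f : Cplx -> sphere) :
  locmero f -> (exists z, f z <> None) -> nowhere f None.
Proof.
  intros Hf [z1 Hz1] z0 H0.
  set (P := fun z0 : C => exists d, 0 < d /\ forall z : C, Cmod (z - z0) < d -> f z = None).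
  assert (H1 : P z1).
  { apply (locally_constant_prop P) with z0; auto. intros z.
    destruct (classic (P z)) as [HP|HP].
    - pose proof HP as [d [Hd K]]. exists d; split; auto. intros y Hy; split; auto. intros _.
      exists (d - Cmod (y - z)); split; [lra|]. intros x Hx. apply K.
      pose proof (Cmod_sub_triangle x y z). lra.
    - assert (Q : exists d, 0 < d /\ forall y : C, Cmod (y - z) < d -> y <> z -> f y <> None).
      { destruct (Hf z) as [r [Hr [g [Hg D]]]]. destruct D as [D|D].
        - exists r; split; auto. intros y Hy _. rewrite D by auto. discriminate.
        - destruct (zero_order g z r Hr Hg) as [[d [Hd E]]|[k [G [HG [G0 E]]]]].
          + exfalso; apply HP. exists (Rmin d r); split; [now apply Rmin_pos|]. intros y Hy.
            pose proof (Rmin_l d r). pose proof (Rmin_r d r).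
            rewrite D, E by lra. apply iota_0.
          + destruct (cont_neq_0 G z G0) as [s [Hs K]].
            { apply (hol_cont G z r); auto. rewrite Cmod_sub_self; auto. }
            exists (Rmin r s); split; [now apply Rmin_pos|]. intros y Hy N.
            pose proof (Rmin_l r s). pose proof (Rmin_r r s).
            rewrite D, E by lra. rewrite iota_Some; [discriminate|].
            apply Cmult_neq_0; [apply Cpow_nz, Csub_neq_0, N|apply K; lra]. }
      destruct Q as [d [Hd K]]. exists d; split; auto. intros y Hy. split; [|tauto]. intros Py.
      destruct (Ceq_dec y z) as [->|N]; auto. exfalso.
      destruct Py as [d' [Hd' K']]. apply (K y Hy N), K'. now rewrite Cmod_sub_self. }
  destruct H1 as [d [Hd K]]. apply Hz1. apply (K z1). now rewrite Cmod_sub_self.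
Qed.

Lemma is_zero_of_order_iff (f : Cplx -> sphere) (a : C) (k : nat) :
  is_zero_of_order f a k <-> (1 <= k)%nat /\ exists r, 0 < r /\ exists g : C -> C,
    hol g a r /\ g a <> RtoC 0 /\
    forall z : C, Cmod (z - a) < r -> f z = Fin ((z - a) ^ k * g z)%C.
Proof.
  split; intros [Hk [r [Hr [g [Hg [G0 E]]]]]]; (split; [exact Hk|]); exists r; (split; [exact Hr|]);
    exists g; (split; [now apply holo_on_disc_iff|]); (split; [exact G0|exact E]).
Qed.

Lemma is_pole_of_order_iff (f : Cplx -> sphere) (a : C) (k : nat) :
  is_pole_of_order f a k <-> (1 <= k)%nat /\ f a = None /\ exists r, 0 < r /\ exists g : C -> C,
    hol g a r /\ g a <> RtoC 0 /\
    forall z : C, Cmod (z - a) < r -> z <> a -> f z = Fin (g z / (z - a) ^ k)%C.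
Proof.
  split; intros [Hk [Ha [r [Hr [g [Hg [G0 E]]]]]]]; (split; [exact Hk|]); (split; [exact Ha|]);
    exists r; (split; [exact Hr|]);
    exists g; (split; [now apply holo_on_disc_iff|]); (split; [exact G0|exact E]).
Qed.

Lemma is_zero_value (f : Cplx -> sphere) (a : C) : is_zero f a -> f a = Fin (RtoC 0).
Proof.
  intros [k [Hk [r [Hr [g [Hg [G0 E]]]]]]]. rewrite E.
  - f_equal. change (((a - a) ^ k * g a)%C = 0). rewrite Csub_diag. destruct k; [lia|]. simpl. ring.
  - change (Cmod (a - a) < r). now rewrite Cmod_sub_self.
Qed.

Lemma is_pole_value (f : Cplx -> sphere) (b : C) : is_pole f b -> f b = None.
Proof. now intros [k [_ [H _]]]. Qed.

(** The hypothesis [nowhere] rules out a zero of infinite order. *)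
Lemma value_is_zero (f : Cplx -> sphere) (a : C) :
  locmero f -> nowhere f (Fin (RtoC 0)) -> f a = Fin (RtoC 0) -> is_zero f a.
Proof.
  intros Hf HN Ha. destruct (Hf a) as [r [Hr [g [Hg D]]]].
  assert (Haa : Cmod (a - a) < r) by now rewrite Cmod_sub_self.
  destruct D as [D|D].
  2:{ exfalso. rewrite D in Ha by auto. destruct (Ceq_dec (g a) 0) as [E|E].
      - rewrite E, iota_0 in Ha. discriminate.
      - rewrite iota_Some in Ha by auto. apply (Cinv_neq_0 (g a) E).
        exact (f_equal val Ha). }
  assert (ga : g a = 0) by (rewrite D in Ha by auto; exact (f_equal val Ha)).
  destruct (zero_order g a r Hr Hg) as [[d [Hd E]]|[k [G [HG [G0 E]]]]].
  - exfalso. apply (HN a). exists (Rmin d r). split; [now apply Rmin_pos|]. intros z Hz.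
    pose proof (Rmin_l d r). pose proof (Rmin_r d r). rewrite D, E by lra. reflexivity.
  - exists k. split.
    + destruct k; [|lia]. exfalso. apply G0. rewrite E in ga. simpl in ga.
      now rewrite Cmult_1_l in ga.
    + exists r; split; auto. exists G. split; [now apply holo_on_disc_iff|]. split; auto.
      intros z Hz. rewrite D by exact Hz. f_equal. apply E.
Qed.

Lemma zero_of_flip (f : Cplx -> sphere) (a : C) (k : nat) :
  is_zero_of_order (flip f) a k -> is_pole_of_order f a k.
Proof.
  intros H. assert (Ha : flip f a = Fin (RtoC 0)) by (apply is_zero_value; now exists k).
  apply is_zero_of_order_iff in H. destruct H as [Hk [r [Hr [g [Hg [G0 E]]]]]].
  apply is_pole_of_order_iff. split; auto. split.
  { rewrite <- (iota_involutive (f a)). fold (flip f a). rewrite Ha. apply iota_0. }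
  destruct (cont_neq_0 g a G0) as [s [Hs K]].
  { apply (hol_cont g a r); auto. rewrite Cmod_sub_self; auto. }
  exists (Rmin r s); split; [now apply Rmin_pos|].
  pose proof (Rmin_l r s). pose proof (Rmin_r r s).
  exists (fun z => / g z)%C. split; [|split].
  - intros z Hz. apply ex_der_inv; [apply K|apply Hg]; lra.
  - now apply Cinv_neq_0.
  - intros z Hz N.
    rewrite <- (iota_involutive (f z)). fold (flip f z). rewrite E by lra.
    assert (g z <> 0) by (apply K; lra).
    assert (((z - a) ^ k)%C <> 0) by (apply Cpow_nz, Csub_neq_0, N).
    rewrite iota_Some by now apply Cmult_neq_0. apply Fin_eq. field. auto.
Qed.

Lemma pole_to_flip (f : Cplx -> sphere) (b : C) (k : nat) :
  is_pole_of_order f b k -> is_zero_of_order (flip f) b k.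
Proof.
  intros H. apply is_pole_of_order_iff in H. destruct H as [Hk [Hb [r [Hr [g [Hg [G0 E]]]]]]].
  apply is_zero_of_order_iff. split; auto.
  destruct (cont_neq_0 g b G0) as [s [Hs K]].
  { apply (hol_cont g b r); auto. rewrite Cmod_sub_self; auto. }
  exists (Rmin r s); split; [now apply Rmin_pos|].
  pose proof (Rmin_l r s). pose proof (Rmin_r r s).
  exists (fun z => / g z)%C. split; [|split].
  - intros z Hz. apply ex_der_inv; [apply K|apply Hg]; lra.
  - now apply Cinv_neq_0.
  - intros z Hz. unfold flip.
    destruct (Ceq_dec z b) as [->|N].
    + rewrite Hb. apply Fin_eq. rewrite Csub_diag. destruct k; [lia|]. simpl. ring.
    + rewrite E by (auto; lra).
      assert (g z <> 0) by (apply K; lra).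
      assert (((z - b) ^ k)%C <> 0) by (apply Cpow_nz, Csub_neq_0, N).
      rewrite iota_Some.
      * apply Fin_eq. field. auto.
      * apply Cmult_neq_0; auto. now apply Cinv_neq_0.
Qed.

Lemma is_zero_flip (f : Cplx -> sphere) (a : C) : is_zero (flip f) a <-> is_pole f a.
Proof.
  split; intros [k H]; exists k; [now apply zero_of_flip|now apply pole_to_flip].
Qed.

Lemma is_pole_flip (f : Cplx -> sphere) (a : C) : is_pole (flip f) a <-> is_zero f a.
Proof. rewrite <- is_zero_flip, flip_flip. reflexivity. Qed.

Lemma inA_flip (f : Cplx -> sphere) (d : R) (z : C) : inA (flip f) d z <-> inA f d z.
Proof.
  unfold inA. split; intros [c [H K]]; exists c; split; auto.
  - rewrite is_zero_flip, is_pole_flip in H. tauto.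
  - rewrite is_zero_flip, is_pole_flip. tauto.
Qed.

(** * Uniform continuity implies normality *)

Definition unif_cont (f : Cplx -> sphere) : Prop :=
  forall e, 0 < e -> exists d, 0 < d /\ forall z w : C, Cmod (z - w) < d -> rhoS (f z) (f w) < e.

(** Subsequences are handled as infinite sets of indices until the diagonal argument turns them into
    a function. *)
Definition infinitely_many (S : nat -> Prop) : Prop := forall n, exists m, (n <= m)%nat /\ S m.

Lemma pigeonhole_nat (K : nat) : forall (c : nat -> nat) (S : nat -> Prop),
  infinitely_many S -> (forall n, S n -> (c n <= K)%nat) ->
  exists v, infinitely_many (fun n => S n /\ c n = v).
Proof.
  induction K as [|K IH]; intros c S HS Hc.
  - exists 0%nat. intros n. destruct (HS n) as [m [Hm Sm]]. exists m. specialize (Hc m Sm).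
    repeat split; auto; lia.
  - destruct (classic (infinitely_many (fun n => S n /\ c n = Datatypes.S K))) as [Y|N]; [now exists (Datatypes.S K)|].
    apply not_all_ex_not in N. destruct N as [n0 N].
    destruct (IH c (fun n => S n /\ (n0 <= n)%nat)) as [v Hv].
    + intros n. destruct (HS (max n n0)) as [m [Hm Sm]]. exists m. repeat split; auto; lia.
    + intros n [Sn Hn]. specialize (Hc n Sn).
      destruct (Nat.eq_dec (c n) (Datatypes.S K)) as [E|]; [|lia]. elim N. now exists n.
    + exists v. intros n. destruct (Hv n) as [m [Hm [[Sm _] Em]]]. now exists m.
Qed.

Lemma pigeonhole_real (x : nat -> R) (e : R) (S : nat -> Prop) :
  0 < e -> infinitely_many S -> (forall n, -1 <= x n <= 1) ->
  exists S' : nat -> Prop, infinitely_many S' /\ (forall n, S' n -> S n) /\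
    forall n m, S' n -> S' m -> Rabs (x n - x m) < e.
Proof.
  intros He HS Hx.
  assert (Hq : forall n, 0 <= (x n + 1) / e).
  { intros n. specialize (Hx n). apply Rdiv_le_0_compat; lra. }
  set (c := fun n => proj1_sig (nfloor_ex ((x n + 1) / e) (Hq n))).
  assert (Hc : forall n, INR (c n) <= (x n + 1) / e < INR (c n) + 1).
  { intros n. unfold c. now destruct (nfloor_ex ((x n + 1) / e) (Hq n)). }
  destruct (INR_unbounded (2 / e)) as [K HK].
  destruct (pigeonhole_nat K c S HS) as [v Hv].
  { intros n _. apply INR_le. specialize (Hc n). specialize (Hx n).
    assert ((x n + 1) / e <= 2 / e).
    { apply Rmult_le_compat_r; [left; now apply Rinv_0_lt_compat|lra]. } lra. }
  exists (fun n => S n /\ c n = v); split; [exact Hv|]. split; [tauto|].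
  intros n m [_ En] [_ Em]. pose proof (Hc n) as Cn. pose proof (Hc m) as Cm.
  rewrite En in Cn. rewrite Em in Cm.
  assert (D : Rabs ((x n - x m) / e) < 1).
  { replace ((x n - x m) / e) with ((x n + 1) / e - (x m + 1) / e) by (field; lra).
    apply Rabs_def1; lra. }
  unfold Rdiv in D. rewrite Rabs_mult, Rabs_inv, (Rabs_pos_eq e) in D by lra.
  apply (Rlt_div_l (Rabs (x n - x m))) in D; lra.
Qed.

Lemma pigeonhole_list (xs : list (nat -> R)) (e : R) : forall S : nat -> Prop,
  0 < e -> infinitely_many S -> (forall x, In x xs -> forall n, -1 <= x n <= 1) ->
  exists S' : nat -> Prop, infinitely_many S' /\ (forall n, S' n -> S n) /\
    forall x, In x xs -> forall n m, S' n -> S' m -> Rabs (x n - x m) < e.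
Proof.
  induction xs as [|x xs IH]; intros S He HS Hx.
  - exists S; repeat split; auto. intros x [].
  - destruct (pigeonhole_real x e S He HS) as [S1 [H1 [H2 H3]]]; [apply Hx; now left|].
    destruct (IH S1 He H1) as [S2 [K1 [K2 K3]]]; [intros y Hy; apply Hx; now right|].
    exists S2; repeat split; auto. intros y [<-|Hy]; auto.
Qed.

(** The infinite sets T k decrease and q k holds for all pairs from T k; phi picks an element of T n
    at stage n, so phi n lies in T k whenever n >= k. *)
Lemma diagonal_subsequence (q : nat -> nat -> nat -> Prop) :
  (forall k S, infinitely_many S -> exists S' : nat -> Prop, infinitely_many S' /\
     (forall n, S' n -> S n) /\ forall n m, S' n -> S' m -> q k n m) ->
  exists phi, strictly_increasing phi /\
    forall k n m, (k <= n)%nat -> (k <= m)%nat -> q k (phi n) (phi m).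
Proof.
  intros H.
  destruct (choice (fun (p : nat * (nat -> Prop)) (S' : nat -> Prop) => infinitely_many (snd p) ->
    infinitely_many S' /\ (forall n, S' n -> snd p n) /\ forall n m, S' n -> S' m -> q (fst p) n m))
    as [nx Hnx].
  { intros [k S]. destruct (classic (infinitely_many S)) as [Y|N].
    - destruct (H k S Y) as [S' HS']. exists S'. intros _. exact HS'.
    - exists S. intros Y. contradiction. }
  set (T := fix T (k : nat) : nat -> Prop :=
    match k with O => nx (0%nat, fun _ => True) | Datatypes.S j => nx (Datatypes.S j, T j) end).
  assert (HT : forall k, infinitely_many (T k) /\ (forall n m, T k n -> T k m -> q k n m)).
  { induction k as [|k [IH _]].
    - destruct (Hnx (0%nat, fun _ => True)) as [A [_ B]]; [|split; auto].
      intros n; exists n; simpl; auto.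
    - destruct (Hnx (Datatypes.S k, T k)) as [A [_ B]]; [exact IH|split; auto]. }
  assert (HTS : forall k n, T (Datatypes.S k) n -> T k n).
  { intros k. destruct (Hnx (Datatypes.S k, T k)) as [_ [A _]]; [apply HT|]. exact A. }
  assert (HTle : forall k n x, (k <= n)%nat -> T n x -> T k x).
  { intros k n x L. induction L; auto. }
  destruct (choice (fun (p : nat * nat) m => (Datatypes.S (snd p) <= m)%nat /\ T (fst p) m)) as [pk Hpk].
  { intros [k n]. apply (proj1 (HT k)). }
  set (phi := fix phi (n : nat) : nat :=
    match n with O => pk (0%nat, 0%nat) | Datatypes.S j => pk (Datatypes.S j, phi j) end).
  assert (Hphi : forall n, T n (phi n)) by (intros [|n]; [apply (Hpk (0%nat, 0%nat))|apply (Hpk (Datatypes.S n, phi n))]).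
  exists phi; split.
  - intros n m L. induction L as [|m L IH]; simpl; [apply (Hpk (Datatypes.S n, phi n))|].
    apply Nat.lt_trans with (phi m); auto. apply (Hpk (Datatypes.S m, phi m)).
  - intros k n m Hn Hm. apply (proj2 (HT k)); [apply HTle with n|apply HTle with m]; auto.
Qed.

Lemma finite_net_R (A d : R) : 0 < d -> exists L : list R, forall x, Rabs x <= A ->
  exists y, In y L /\ Rabs (x - y) < d.
Proof.
  intros Hd. destruct (INR_unbounded (2 * A / (d / 2))) as [K HK].
  exists (map (fun i => - A + INR i * (d / 2)) (seq 0 (S K))). intros x Hx.
  apply Rabs_le_between in Hx.
  assert (H0 : 0 <= (x + A) / (d / 2)) by (apply Rdiv_le_0_compat; lra).
  destruct (nfloor_ex _ H0) as [i Hi].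
  assert (Hi' : INR i * (d / 2) <= x + A < (INR i + 1) * (d / 2)).
  { split; [apply Rle_div_r; lra|apply Rlt_div_l; lra]. }
  exists (- A + INR i * (d / 2)). split.
  - apply in_map_iff. exists i; split; auto. apply in_seq. split; [lia|].
    assert (L : INR i < INR K).
    { apply Rle_lt_trans with (2 * A / (d / 2)); auto. apply Rle_trans with ((x + A) / (d / 2)); [lra|].
      apply Rmult_le_compat_r; [left; apply Rinv_0_lt_compat; lra|lra]. }
    apply INR_lt in L. lia.
  - apply Rabs_def1; lra.
Qed.

Lemma finite_net (A d : R) : 0 < d -> exists L : list C, forall z : C, Cmod z <= A ->
  exists y, In y L /\ Cmod (z - y) < d.
Proof.
  intros Hd. destruct (finite_net_R A (d / 2)) as [L HL]; [lra|].
  exists (list_prod L L). intros z Hz.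
  destruct (HL (fst z)) as [x [Hx Dx]]; [pose proof (Rabs_fst_le z); lra|].
  destruct (HL (snd z)) as [y [Hy Dy]]; [pose proof (Rabs_snd_le z); lra|].
  exists (x, y); split; [now apply in_prod|].
  eapply Rle_lt_trans; [apply Cmod_le_sum|]. simpl. unfold Rminus in *. lra.
Qed.

Lemma stereo_bounds (u : sphere) :
  (-1 <= fst (fst (stereo u)) <= 1) /\ (-1 <= snd (fst (stereo u)) <= 1) /\ (-1 <= snd (stereo u) <= 1).
Proof.
  destruct u as [z|]; simpl; [|lra].
  set (x := fst z). set (y := snd z).
  assert (M : 0 < 1 + x * (x * 1) + y * (y * 1)) by nra.
  set (m := 1 + x * (x * 1) + y * (y * 1)) in *.
  assert (B : forall t, - m <= t <= m -> -1 <= t / m <= 1).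
  { intros t Ht. split; [apply (Rle_div_r (-1) t m)|apply (Rle_div_l t 1 m)]; lra. }
  pose proof (pow2_ge_0 (x + 1)). pose proof (pow2_ge_0 (x - 1)).
  pose proof (pow2_ge_0 (y + 1)). pose proof (pow2_ge_0 (y - 1)).
  pose proof (pow2_ge_0 x). pose proof (pow2_ge_0 y).
  split; [|split]; apply B; unfold m in *; lra.
Qed.

(** The factor 2 stands for the square root of 3. *)
Lemma rhoS_le_coordinates (u v : sphere) (e : R) :
  Rabs (fst (fst (stereo u)) - fst (fst (stereo v))) < e ->
  Rabs (snd (fst (stereo u)) - snd (fst (stereo v))) < e ->
  Rabs (snd (stereo u) - snd (stereo v)) < e -> rhoS u v <= 2 * e.
Proof.
  rewrite rhoS_stereo. destruct (stereo u) as [[a b] c], (stereo v) as [[a' b'] c']. simpl fst; simpl snd.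
  intros H1 H2 H3. assert (He : 0 < e) by (pose proof (Rabs_pos (a - a')); lra).
  rewrite <- (sqrt_pow2 (2 * e)) by lra. apply sqrt_le_1_alt. unfold dist3_sqr.
  assert (Q : forall t, Rabs t < e -> t ^ 2 <= e ^ 2).
  { intros t Ht. rewrite <- (pow2_abs t). apply pow_incr. split; [apply Rabs_pos|lra]. }
  pose proof (Q _ H1). pose proof (Q _ H2). pose proof (Q _ H3). pose proof (pow2_ge_0 e). nra.
Qed.

(** Arzela-Ascoli: on a finite net of |z| <= k the pigeonhole principle, applied to the three
    coordinates on the sphere, brings the translates close together; uniform continuity extends this
    to the whole disc. *)
Theorem unif_cont_normal (f : Cplx -> sphere) : unif_cont f -> normal f.
Proof.
  intros Hf h.
  (* The 4 is made of 2 from the coordinates at a net point and 1 for each of the two moves between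
     z and that point. *)
  destruct (diagonal_subsequence (fun k n m => forall z : C, Cmod z <= INR k ->
    rhoS (f (z + h n)%C) (f (z + h m)%C) <= 4 * / (INR k + 1))) as [phi [H1 H2]].
  - intros k S HS. pose proof (pos_INR k) as Hk.
    assert (He : 0 < / (INR k + 1)) by (apply Rinv_0_lt_compat; lra).
    destruct (Hf _ He) as [d [Hd K]].
    destruct (finite_net (INR k) d Hd) as [L HL].
    set (co := fun (g : C) => (fun n : nat => fst (fst (stereo (f (g + h n)%C)))) ::
      (fun n => snd (fst (stereo (f (g + h n)%C)))) :: (fun n => snd (stereo (f (g + h n)%C))) :: nil).
    destruct (pigeonhole_list (flat_map co L) _ S He HS) as [S' [A1 [A2 A3]]].
    { intros x Hx n. apply in_flat_map in Hx. destruct Hx as [g [_ Hx]].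
      destruct (stereo_bounds (f (g + h n)%C)) as [B1 [B2 B3]].
      destruct Hx as [<-|[<-|[<-|[]]]]; auto. }
    exists S'; repeat split; auto. intros n m Sn Sm z Hz.
    destruct (HL z Hz) as [g [Hg Dg]].
    assert (Hc : forall x, In x (co g) -> Rabs (x n - x m) < / (INR k + 1)).
    { intros x Hx. apply A3; auto. apply in_flat_map. now exists g. }
    pose proof (Hc _ (or_introl eq_refl)) as C1.
    pose proof (Hc _ (or_intror (or_introl eq_refl))) as C2.
    pose proof (Hc _ (or_intror (or_intror (or_introl eq_refl)))) as C3.
    pose proof (rhoS_le_coordinates _ _ _ C1 C2 C3) as R0. clear C1 C2 C3 Hc.
    assert (Dn : forall n, Cmod (z + h n - (g + h n)) < d).
    { intros i. replace (z + h i - (g + h i))%C with (z - g)%C by ring. exact Dg. }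
    pose proof (K _ _ (Dn n)) as R1. pose proof (K _ _ (Dn m)) as R2.
    pose proof (rhoS_triangle (f (z + h n)%C) (f (g + h n)%C) (f (z + h m)%C)).
    pose proof (rhoS_triangle (f (g + h n)%C) (f (g + h m)%C) (f (z + h m)%C)).
    rewrite (rhoS_sym (f (z + h m)%C)) in R2. lra.
  - exists phi; split; auto. intros Rad eps He.
    destruct (INR_unbounded (Rmax Rad (4 / eps))) as [N HN].
    pose proof (Rmax_l Rad (4 / eps)). pose proof (Rmax_r Rad (4 / eps)).
    exists N. intros n m Hn Hm z Hz. change (Cmod z <= Rad) in Hz.
    eapply Rle_lt_trans; [apply (H2 N n m Hn Hm z); lra|].
    apply (Rlt_div_l 4); [pose proof (pos_INR N); lra|].
    assert (4 / eps < INR N) as Q by lra. apply Rlt_div_l in Q; lra.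
Qed.

(** * From the divisor conditions to N_1 *)

Lemma Csub_add (z h : C) : (z - h + h)%C = z.
Proof. ring. Qed.

Lemma nowhere_flip (f : Cplx -> sphere) (c : sphere) : nowhere f c -> nowhere (flip f) (iota c).
Proof.
  intros H z0 [d [Hd K]]. apply (H z0). exists d; split; auto. intros z Hz.
  rewrite <- (iota_involutive (f z)), <- (iota_involutive c). f_equal. now apply K.
Qed.

Lemma value_is_pole (f : Cplx -> sphere) (b : C) :
  locmero f -> nowhere f None -> f b = None -> is_pole f b.
Proof.
  intros Hf HN Hb. apply is_zero_flip, value_is_zero.
  - now apply locmero_flip.
  - exact (nowhere_flip f None HN).
  - unfold flip. now rewrite Hb.
Qed.

Lemma nowhere_0 (f : Cplx -> sphere) :
  locmero f -> (exists z, f z <> Fin (RtoC 0)) -> nowhere f (Fin (RtoC 0)).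
Proof.
  intros Hf [z Hz]. rewrite <- (flip_flip f). apply (nowhere_flip (flip f) None).
  apply nowhere_None; [now apply locmero_flip|]. exists z. intros E. apply Hz.
  rewrite <- (iota_involutive (f z)). unfold flip in E. now rewrite E.
Qed.

(** Distinct points are counted here; [list_with_orders] derives this from the count with
    multiplicities, as every order is at least 1. *)
Definition finitely_many_near (f : Cplx -> sphere) (C0 : R) : Prop :=
  forall (c : C) (ps : list C), NoDup ps ->
    Forall (fun p => Cmod (p - c) <= 1 /\ (is_zero f p \/ is_pole f p)) ps -> INR (length ps) < C0.

(* Pigeonhole among n concentric circles 3 delta apart: each circle met by A(delta) owns a point of the
   divisor that meets no other circle. *)
Lemma circle_off_divisor (f : Cplx -> sphere) (C0 rho : R) :
  0 < rho <= 1 / 2 -> finitely_many_near f C0 ->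
  exists delta, 0 < delta /\ forall z0 : C, exists t, rho / 2 <= t < rho /\
    forall z : C, Cmod (z - z0) = t -> ~ inA f delta z.
Proof.
  intros Hrho HC. destruct (INR_unbounded C0) as [n Hn].
  (* The n radii, starting at rho / 2 in steps of 3 delta, all stay below rho. *)
  set (delta := rho / (6 * (INR n + 1))). pose proof (pos_INR n) as Pn.
  assert (Hd : 0 < delta) by (apply Rdiv_lt_0_compat; lra).
  assert (En : 6 * (INR n + 1) * delta = rho) by (unfold delta; field; lra).
  exists delta; split; auto. intros z0. apply NNPP; intros N.
  set (t := fun i : nat => rho / 2 + 3 * delta * INR i).
  assert (Hc : forall i, exists c : C, (i < n)%nat -> (is_zero f c \/ is_pole f c) /\ Rabs (Cmod (c - z0) - t i) < delta).
  { intros i. destruct (Nat.le_gt_cases n i) as [L|L]; [exists z0; intros; lia|].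
    apply NNPP; intros N'. apply N. exists (t i).
    apply lt_INR in L. pose proof (pos_INR i). unfold t. split; [nra|].
    intros z Hz [c [Hc Dc]]. change (Cmod (z - c) < delta) in Dc. apply N'. exists c. intros _. split; auto.
    rewrite Cmod_sub_sym in Dc. fold (t i) in Hz. rewrite <- Hz.
    apply Rabs_def1.
    - pose proof (Cmod_sub_triangle c z z0). lra.
    - pose proof (Cmod_sub_triangle z c z0). rewrite Cmod_sub_sym in Dc. lra. }
  destruct (choice _ Hc) as [s Hs].
  assert (L : INR (length (map s (seq 0 n))) < C0).
  { apply (HC z0).
    - assert (Inj : forall i j, (i < j < n)%nat -> s i <> s j).
      { intros i j [Hij Hj] E. destruct (Hs i) as [_ Di]; [lia|]. destruct (Hs j Hj) as [_ Dj].
        rewrite E in Di. apply le_INR in Hij. rewrite S_INR in Hij.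
        apply Rabs_def2 in Di. apply Rabs_def2 in Dj. unfold t in *.
        assert (delta * (INR i + 1) <= delta * INR j) by (apply Rmult_le_compat_l; lra). lra. }
      apply NoDup_map_NoDup_ForallPairs; [|apply seq_NoDup].
      intros i j Hi Hj E. apply in_seq in Hi. apply in_seq in Hj.
      destruct (Nat.lt_trichotomy i j) as [L|[L|L]]; auto; exfalso; [apply (Inj i j)|apply (Inj j i)]; auto; lia.
    - apply Forall_forall. intros p Hp. apply in_map_iff in Hp. destruct Hp as [i [<- Hi]].
      apply in_seq in Hi. destruct (Hs i) as [A B]; [lia|]. split; auto.
      apply Rabs_def2 in B. assert (Hi' : (i < n)%nat) by lia. apply lt_INR in Hi'. unfold t in B.
      assert (delta * INR i <= delta * INR n) by (apply Rmult_le_compat_l; lra). lra. }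
  rewrite length_map, length_seq in L. lra.
Qed.

(** One M serves all z0 because [circle_off_divisor] provides one delta for all centres. The circle
    has radius at least rho / 2, so it encloses the disc of the conclusion. *)
Lemma bounded_off_poles (f : Cplx -> sphere) (C0 rho : R) :
  locmero f -> nowhere f None -> finitely_many_near f C0 ->
  (forall delta, 0 < delta -> exists M, forall z, ~ inA f delta z -> small M (f z)) ->
  0 < rho <= 1 / 2 ->
  exists M, forall z0 : C, (forall z : C, Cmod (z - z0) < rho -> ~ is_pole f z) ->
    forall z : C, Cmod (z - z0) < rho / 2 -> small M (f z).
Proof.
  intros Hf HN HC HA Hrho. destruct (circle_off_divisor f C0 rho Hrho HC) as [delta [Hd Hcirc]].
  destruct (HA delta Hd) as [M HM]. exists M. intros z0 Hz0 z Hz.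
  destruct (Hcirc z0) as [t [Ht Hct]].
  assert (NN : forall z : C, Cmod (z - z0) < rho -> f z <> None).
  { intros y Hy E. apply (Hz0 y Hy). now apply value_is_pole. }
  pose proof (locmero_hol_val f z0 rho Hf NN) as Hh.
  exists (val (f z)). split; [apply not_None_val, NN; lra|].
  apply (maximum_modulus (fun z => val (f z)) z0 rho t); auto; try lra.
  intros y Hy. apply (small_val M (f y)), HM, Hct, Hy.
Qed.

Lemma equicont_off_poles (f : Cplx -> sphere) (C0 rho e : R) :
  locmero f -> nowhere f None -> finitely_many_near f C0 ->
  (forall delta, 0 < delta -> exists M, forall z, ~ inA f delta z -> small M (f z)) ->
  0 < rho <= 1 / 2 -> 0 < e ->
  exists d, 0 < d /\ forall z0 : C, (forall z : C, Cmod (z - z0) < rho -> ~ is_pole f z) ->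
    forall z : C, Cmod (z - z0) < d -> rhoS (f z) (f z0) < e.
Proof.
  intros Hf HN HC HA Hrho He.
  destruct (bounded_off_poles f C0 rho Hf HN HC HA Hrho) as [M0 HM0].
  set (M := Rmax M0 1). assert (HM1 : 1 <= M) by apply Rmax_r.
  assert (HM : forall z0 : C, (forall z : C, Cmod (z - z0) < rho -> ~ is_pole f z) ->
    forall z : C, Cmod (z - z0) < rho / 2 -> small M (f z)).
  { intros z0 Hz0 z Hz. apply small_le with M0; [apply Rmax_l|eauto]. }
  (* rho / 8 is the quarter of the radius rho / 2 that the Lipschitz bound allows; the other entry
     makes 16 M |z - z0| / rho, twice that bound, less than e. *)
  exists (Rmin (rho / 8) (e * rho / (16 * M))). split.
  { apply Rmin_pos; [lra|]. apply Rdiv_lt_0_compat; [apply Rmult_lt_0_compat|]; lra. }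
  intros z0 Hz0 z Hz.
  pose proof (Rmin_l (rho / 8) (e * rho / (16 * M))). pose proof (Rmin_r (rho / 8) (e * rho / (16 * M))).
  assert (Hh : hol (fun z => val (f z)) z0 (rho / 2)).
  { apply locmero_hol_val; auto. intros y Hy. destruct (HM z0 Hz0 y Hy) as [w [-> _]]. discriminate. }
  assert (HL : Cmod (val (f z) - val (f z0)) <= 4 * M / (rho / 2) * Cmod (z - z0)).
  { apply (cauchy_lipschitz (fun z => val (f z)) z0 (rho / 2) M); auto; try lra.
    intros y Hy. apply (small_val M (f y)); eauto. }
  destruct (small_val M (f z)) as [-> _]; [apply HM with z0; auto; lra|].
  destruct (small_val M (f z0)) as [-> _]; [apply HM with z0; auto; rewrite Cmod_sub_self; lra|].
  simpl val. eapply Rle_lt_trans; [apply rhoS_Some_le|].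
  apply Rle_lt_trans with (2 * (4 * M / (rho / 2) * Cmod (z - z0))); [lra|].
  replace (2 * (4 * M / (rho / 2) * Cmod (z - z0))) with (Cmod (z - z0) * (16 * M) / rho) by (field; lra).
  apply Rlt_div_l; [lra|]. apply Rlt_div_r; lra.
Qed.

Lemma conditions_unif_cont (f : Cplx -> sphere) (C0 eta : R) :
  locmero f -> nowhere f None -> nowhere f (Fin (RtoC 0)) -> finitely_many_near f C0 -> 0 < eta ->
  (forall a b : C, is_zero f a -> is_pole f b -> eta <= Cmod (a - b)) ->
  (forall delta, 0 < delta -> exists M, forall z, ~ inA f delta z -> small M (f z)) ->
  (forall delta, 0 < delta -> exists M, forall z, ~ inA f delta z -> small M (iota (f z))) ->
  unif_cont f.
Proof.
  intros Hf HN H0 HC Heta Hab HA HA' e He.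
  (* Since 2 rho <= eta, a disc of radius rho that contains a pole contains no zero, so f or 1/f has
     no pole in it. *)
  set (rho := Rmin (1 / 2) (eta / 2)).
  assert (Hrho : 0 < rho <= 1 / 2) by (split; [apply Rmin_pos; lra|apply Rmin_l]).
  assert (Hrho' : rho <= eta / 2) by apply Rmin_r.
  destruct (equicont_off_poles f C0 rho e) as [d1 [Hd1 K1]]; auto.
  destruct (equicont_off_poles (flip f) C0 rho e) as [d2 [Hd2 K2]]; auto.
  - now apply locmero_flip.
  - rewrite <- iota_0. now apply nowhere_flip.
  - intros c ps Hps HF. apply (HC c ps Hps). eapply Forall_impl; [|exact HF]. intros p [Hp D].
    split; auto. rewrite is_zero_flip, is_pole_flip in D. tauto.
  - intros delta Hd. destruct (HA' delta Hd) as [M HM]. exists M. intros z Hz. apply HM.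
    now rewrite <- inA_flip.
  - exists (Rmin d1 d2); split; [now apply Rmin_pos|]. intros z w Hzw.
    pose proof (Rmin_l d1 d2). pose proof (Rmin_r d1 d2).
    destruct (classic (exists b, is_pole f b /\ Cmod (b - w) < rho)) as [[b [Pb Db]]|N].
    + rewrite <- rhoS_iota. apply (K2 w); [|lra]. intros a Da Pa. apply is_pole_flip in Pa.
      specialize (Hab a b Pa Pb). pose proof (Cmod_sub_triangle a w b).
      rewrite (Cmod_sub_sym w b) in *. lra.
    + apply (K1 w); [|lra]. intros b Db Pb. apply N. now exists b.
Qed.

Lemma list_with_orders (f : Cplx -> sphere) (c : C) (ps : list C) :
  Forall (fun p => Cmod (p - c) <= 1 /\ (is_zero f p \/ is_pole f p)) ps ->
  exists l : list (Cplx * nat), map fst l = ps /\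
    Forall (fun p => Cnorm (Csub (fst p) c) <= 1 /\
                  (is_zero_of_order f (fst p) (snd p) \/ is_pole_of_order f (fst p) (snd p))) l /\
    (length ps <= total_mult l)%nat.
Proof.
  induction 1 as [|p ps [Hp D] _ [l [E [HF HL]]]]; [exists nil; repeat split; auto|].
  assert (X : exists k, (1 <= k)%nat /\ (is_zero_of_order f p k \/ is_pole_of_order f p k)).
  { destruct D as [[k K]|[k K]]; exists k; (split; [apply K|auto]). }
  destruct X as [k [Hk K]]. exists ((p, k) :: l). split; [|split].
  - simpl. now rewrite E.
  - constructor; auto.
  - simpl in *. lia.
Qed.

Theorem conditions_in_N1 (f : Cplx -> sphere) (Hf : meromorphic f) :
  (forall delta, delta > 0 -> exists Cd, forall z, ~ inA f delta z ->
     exists w, f z = Some w /\ / Cd <= Cnorm w /\ Cnorm w <= Cd) ->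
  (exists eta, eta > 0 /\ forall a b, is_zero f a -> is_pole f b -> eta <= Cnorm (Csub a b)) ->
  (exists C0 : R, forall (c : Cplx) (l : list (Cplx * nat)), NoDup (map fst l) ->
     Forall (fun p => Cnorm (Csub (fst p) c) <= 1 /\
       (is_zero_of_order f (fst p) (snd p) \/ is_pole_of_order f (fst p) (snd p))) l ->
     INR (total_mult l) < C0) ->
  (exists R0, forall w : Cplx, (exists a, is_zero f a /\ Cnorm (Csub a w) < R0) /\
     (exists b, is_pole f b /\ Cnorm (Csub b w) < R0)) ->
  in_N1 f.
Proof.
  intros HA [eta [Heta Hab]] [C0 HC0] [R0 HR0].
  pose proof (meromorphic_locmero f Hf) as Lf.
  assert (HN : nowhere f None) by (apply nowhere_None; auto; apply Hf).
  assert (H0 : nowhere f (Fin (RtoC 0))).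
  { apply nowhere_0; auto. destruct (HR0 Czero) as [_ [b [Hb _]]]. exists b.
    rewrite (is_pole_value f b Hb). discriminate. }
  assert (HC : finitely_many_near f C0).
  { intros c ps Hps HF. destruct (list_with_orders f c ps HF) as [l [E [Hl HL]]].
    rewrite <- E in Hps. specialize (HC0 c l Hps Hl). apply le_INR in HL. lra. }
  split.
  - apply unif_cont_normal. apply conditions_unif_cont with C0 eta; auto.
    + intros delta Hd. destruct (HA delta Hd) as [M HM]. exists M. intros z Hz.
      destruct (HM z Hz) as [w [E [_ B]]]. now exists w.
    + intros delta Hd. destruct (HA delta Hd) as [M HM]. exists M. intros z Hz.
      destruct (HM z Hz) as [w [E [B1 B2]]].
      (* As / 0 = 0, the two bounds alone would allow w = 0 when M = 0; but then z would be a zero,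
         inside A(delta). *)
      assert (Hw : w <> RtoC 0).
      { intros ->. apply Hz. exists z. split; [left; now apply value_is_zero|].
        change (Cmod (z - z) < delta). now rewrite Cmod_sub_self. }
      change (Cnorm w) with (Cmod w) in *. assert (0 < Cmod w) by now apply Cmod_gt_0.
      rewrite E, iota_Some by auto. exists (/ w)%C. split; auto. rewrite Cmod_inv by auto.
      rewrite <- (Rinv_inv M). apply Rinv_le_contravar; auto. apply Rinv_0_lt_compat. lra.
  (* A constant limit would be within 1 of the values 0 and infinity, which the translates take on
     |z| < R0 and whose distance is 2. *)
  - intros h g Hg [c Hc]. destruct (Hg R0 1 ltac:(lra)) as [N HN1]. specialize (HN1 N (le_n N)).
    destruct (HR0 (h N)) as [[a [Ha Da]] [b [Hb Db]]].
    assert (V : forall p : C, Cmod (p - h N) < R0 -> rhoS (f p) c < 1).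
    { intros p Hp. specialize (HN1 (p - h N)%C). rewrite (Hc (p - h N)%C) in HN1.
      unfold translate in HN1. assert (E : Cadd (p - h N)%C (h N) = p) by apply Csub_add.
      rewrite E in HN1. apply HN1.
      change (Cmod (p - h N) <= R0). lra. }
    pose proof (V a Da) as Va. pose proof (V b Db) as Vb.
    rewrite (is_zero_value f a Ha) in Va. rewrite (is_pole_value f b Hb) in Vb.
    pose proof (rhoS_triangle (Fin (RtoC 0)) c None). rewrite rhoS_0_oo, (rhoS_sym c None) in *. lra.
Qed.

(** * From N_1 to the divisor conditions *)

Lemma strictly_increasing_ge (phi : nat -> nat) (n : nat) :
  strictly_increasing phi -> (n <= phi n)%nat.
Proof. intros H. induction n as [|n IH]; [lia|]. specialize (H n (S n)). lia. Qed.

Lemma inv_nat_small (e : R) : 0 < e -> exists N : nat, forall n, (N <= n)%nat -> / (INR n + 1) < e.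
Proof.
  intros He. destruct (INR_unbounded (/ e)) as [N HN]. exists N. intros n Hn.
  apply le_INR in Hn. rewrite <- (Rinv_inv e). pose proof (Rinv_0_lt_compat e He).
  apply Rinv_lt_contravar; [|lra]. apply Rmult_lt_0_compat; lra.
Qed.

Lemma inv_nat_pos (n : nat) : 0 < / (INR n + 1).
Proof. apply Rinv_0_lt_compat. pose proof (pos_INR n). lra. Qed.

Lemma C_complete (x : nat -> C) :
  (forall e, 0 < e -> exists N, forall n m, (N <= n)%nat -> (N <= m)%nat -> Cmod (x n - x m) < e) ->
  exists l : C, forall e, 0 < e -> exists N, forall n, (N <= n)%nat -> Cmod (x n - l) < e.
Proof.
  intros H.
  destruct (R_complete (fun n => fst (x n))) as [l1 H1].
  { intros e He. destruct (H e He) as [N HN]. exists N. intros n m Hn Hm.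
    eapply Rle_lt_trans; [apply (Rabs_fst_le (x n - x m))|]. now apply HN. }
  destruct (R_complete (fun n => snd (x n))) as [l2 H2].
  { intros e He. destruct (H e He) as [N HN]. exists N. intros n m Hn Hm.
    eapply Rle_lt_trans; [apply (Rabs_snd_le (x n - x m))|]. now apply HN. }
  exists (l1, l2). intros e He.
  destruct (H1 (e/2)) as [N1 K1]; [lra|]. destruct (H2 (e/2)) as [N2 K2]; [lra|].
  exists (max N1 N2). intros n Hn. eapply Rle_lt_trans; [apply Cmod_le_sum|].
  specialize (K1 n ltac:(lia)). specialize (K2 n ltac:(lia)).
  change (Rabs (fst (x n) - l1) < e / 2) in K1. change (Rabs (snd (x n) - l2) < e / 2) in K2.
  simpl. unfold Rminus in *. lra.
Qed.

(** Suppose z_n and w_n approach each other while their images stay e apart. Along a subsequence the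
    translates by z_n are close on |v| <= 1 to one fixed translate, by q, and continuity of f at the
    single point q gives a contradiction. *)
Lemma normal_unif_cont (f : Cplx -> sphere) : locmero f -> normal f -> unif_cont f.
Proof.
  intros Lf Nf e He. apply NNPP; intros N.
  assert (X : forall n : nat, exists p : C * C,
    Cmod (fst p - snd p) < / (INR n + 1) /\ e <= rhoS (f (fst p)) (f (snd p))).
  { intros n. apply NNPP; intros N'. apply N. exists (/ (INR n + 1)). split; [apply inv_nat_pos|].
    intros z w Hzw. apply Rnot_le_lt. intros L. apply N'. now exists (z, w). }
  destruct (choice _ X) as [p Hp].
  destruct (Nf (fun n => fst (p n))) as [phi [Hphi Hc]].
  destruct (Hc 1 (e/3)) as [N0 HN0]; [lra|].
  destruct (locmero_cont f (fst (p (phi N0))) (e/3) Lf) as [d [Hd K]]; [lra|].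
  destruct (inv_nat_small (Rmin 1 d)) as [N1 HN1]; [apply Rmin_pos; lra|].
  set (n := max N0 N1). specialize (HN1 (phi n)).
  pose proof (strictly_increasing_ge phi n Hphi).
  specialize (HN1 ltac:(lia)). pose proof (Rmin_l 1 d). pose proof (Rmin_r 1 d).
  destruct (Hp (phi n)) as [D E]. set (z := fst (p (phi n))) in *. set (w := snd (p (phi n))) in *.
  set (q := fst (p (phi N0))) in *.
  assert (A : forall v : C, Cmod v <= 1 -> rhoS (f (v + z)%C) (f (v + q)%C) < e / 3).
  { intros v Hv. apply (HN0 n N0); [lia|lia|exact Hv]. }
  assert (D' : Cmod (w - z) < Rmin 1 d) by (rewrite Cmod_sub_sym; lra).
  pose proof (A 0 ltac:(rewrite Cmod_0; lra)) as A0. rewrite !Cplus_0_l in A0.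
  pose proof (A (w - z)%C ltac:(lra)) as A1. rewrite Csub_add in A1.
  specialize (K (w - z + q)%C). replace (w - z + q - q)%C with (w - z)%C in K by ring.
  specialize (K ltac:(lra)).
  pose proof (rhoS_triangle (f z) (f q) (f w)).
  pose proof (rhoS_triangle (f q) (f (w - z + q)%C) (f w)).
  pose proof (rhoS_sym (f q) (f (w - z + q)%C)).
  pose proof (rhoS_sym (f (w - z + q)%C) (f w)). lra.
Qed.

Lemma in_N1_flip (f : Cplx -> sphere) : in_N1 f -> in_N1 (flip f).
Proof.
  intros [Nf Hf]. split.
  - intros h. destruct (Nf h) as [phi [H1 H2]]. exists phi; split; auto.
    intros Rad eps He. destruct (H2 Rad eps He) as [N HN]. exists N. intros n m Hn Hm z Hz.
    unfold translate, flip. rewrite rhoS_iota. now apply HN.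
  - intros h g Hg [c Hc]. apply (Hf h (fun z => iota (g z))); [|exists (iota c); intros; now rewrite Hc].
    intros Rad eps He. destruct (Hg Rad eps He) as [N HN]. exists N. intros n Hn z Hz.
    rewrite <- rhoS_iota, iota_involutive. now apply HN.
Qed.

Definition bounded_near_small (f : Cplx -> sphere) (r0 : R) : Prop :=
  forall p z : C, small (1 / 4) (f p) -> Cmod (z - p) < r0 -> small 1 (f z).

(** A value of modulus at most 1/4 lies within 1/2 of 0 in [rhoS]; a further 1/2 from uniform
    continuity keeps the distance below 1, the range of [rhoS_small]. *)
Lemma unif_cont_bounded_near_small (f : Cplx -> sphere) :
  unif_cont f -> exists r0, 0 < r0 /\ bounded_near_small f r0.
Proof.
  intros Hf. destruct (Hf (1/2)) as [d [Hd K]]; [lra|]. exists d; split; auto.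
  intros p z Hp Hz. apply rhoS_small; [lra|]. apply small_rhoS in Hp. specialize (K z p Hz).
  pose proof (rhoS_triangle (f z) (f p) (Fin (RtoC 0))). lra.
Qed.

Lemma hol_near_small (f : Cplx -> sphere) (r0 : R) (p : C) :
  locmero f -> bounded_near_small f r0 -> small (1 / 4) (f p) -> hol (fun z => val (f z)) p r0.
Proof.
  intros Lf Hr Hp. apply locmero_hol_val; auto. intros z Hz.
  destruct (Hr p z Hp Hz) as [w [-> _]]. discriminate.
Qed.

Lemma propagation_step (f : Cplx -> sphere) (r0 s eps : R) :
  locmero f -> 0 < r0 -> bounded_near_small f r0 -> 0 < s -> 0 < eps ->
  exists eps', 0 < eps' /\ forall p : C, (forall z : C, Cmod (z - p) < s -> small eps' (f z)) ->
    forall z : C, Cmod (z - p) <= r0 / 4 -> small eps (f z).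
Proof.
  intros Lf H0 Hr Hs He. destruct (small_spread r0 s eps H0 Hs He) as [e1 [He1 K]].
  (* The cap 1/4 makes [bounded_near_small] applicable at the centre p. *)
  exists (Rmin e1 (1 / 4)). split; [apply Rmin_pos; lra|]. intros p Hp z Hz.
  pose proof (Rmin_l e1 (1 / 4)). pose proof (Rmin_r e1 (1 / 4)).
  assert (Sp : small (1 / 4) (f p)).
  { apply small_le with (Rmin e1 (1 / 4)); auto. apply Hp. now rewrite Cmod_sub_self. }
  exists (val (f z)). split.
  - apply (small_val 1 (f z)). apply (Hr p); auto. lra.
  - apply (K (fun z => val (f z)) p); auto.
    + now apply hol_near_small.
    + intros y Hy. apply (small_val 1 (f y)). now apply (Hr p).
    + intros y Hy. apply Rle_trans with (Rmin e1 (1 / 4)); auto. apply (small_val _ (f y)). now apply Hp.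
Qed.

(** Smallness on the disc of radius r0 / 8 about p spreads to radius r0 / 4, which covers the disc
    of radius r0 / 8 about any p' with |p' - p| <= r0 / 8. Each step thus moves the centre by r0 / 8
    towards z. *)
Lemma propagation (f : Cplx -> sphere) (r0 : R) (k : nat) :
  locmero f -> 0 < r0 -> bounded_near_small f r0 -> forall eps, 0 < eps ->
  exists eps', 0 < eps' /\ forall p : C, (forall z : C, Cmod (z - p) < r0 / 8 -> small eps' (f z)) ->
    forall z : C, Cmod (z - p) <= r0 / 4 + INR k * (r0 / 8) -> small eps (f z).
Proof.
  intros Lf H0 Hr. induction k as [|k IH]; intros eps He.
  - destruct (propagation_step f r0 (r0 / 8) eps) as [e [He' K]]; auto; [lra|].
    exists e; split; auto. intros p Hp z Hz. simpl in Hz. apply (K p); auto. lra.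
  - destruct (IH eps He) as [e1 [He1 K1]].
    destruct (propagation_step f r0 (r0 / 8) e1) as [e2 [He2 K2]]; auto; [lra|].
    exists e2; split; auto. intros p Hp z Hz. rewrite S_INR in Hz. pose proof (pos_INR k) as Pk.
    assert (X : exists p' : C, Cmod (p' - p) <= r0 / 8 /\ Cmod (z - p') <= r0 / 4 + INR k * (r0 / 8)).
    { destruct (Rle_lt_dec (Cmod (z - p)) (r0 / 8)) as [L|L].
      - exists p. rewrite Cmod_sub_self. split; [lra|]. assert (0 <= INR k * (r0 / 8)) by nra. lra.
      - set (t := r0 / 8 / Cmod (z - p)).
        assert (Et : t * Cmod (z - p) = r0 / 8) by (unfold t; field; lra).
        assert (Ht : 0 <= t <= 1).
        { split; [apply Rdiv_le_0_compat; lra|]. apply Rle_div_l; lra. }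
        exists (p + RtoC t * (z - p))%C. split.
        + replace (p + RtoC t * (z - p) - p)%C with (RtoC t * (z - p))%C by ring.
          rewrite Cmod_mult, Cmod_R, Rabs_pos_eq by lra. lra.
        + replace (z - (p + RtoC t * (z - p)))%C with (RtoC (1 - t) * (z - p))%C
            by (rewrite RtoC_minus; ring).
          rewrite Cmod_mult, Cmod_R, Rabs_pos_eq by lra. lra. }
    destruct X as [p' [D1 D2]]. apply (K1 p'); auto. intros y Hy. apply (K2 p); auto.
    pose proof (Cmod_sub_triangle y p' p). lra.
Qed.

(* Otherwise the smallness would propagate to all compacta and translates would tend to 0. *)
Lemma not_uniformly_small (f : Cplx -> sphere) (r0 s : R) :
  locmero f -> in_N1 f -> 0 < r0 -> bounded_near_small f r0 -> 0 < s ->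
  exists eps, 0 < eps /\ forall p : C, ~ forall z : C, Cmod (z - p) < s -> small eps (f z).
Proof.
  intros Lf [_ Nf] H0 Hr Hs. apply NNPP; intros N.
  assert (X : forall n : nat, exists p : C, forall z : C, Cmod (z - p) < s -> small (/ (INR n + 1)) (f z)).
  { intros n. apply NNPP; intros N'. apply N. exists (/ (INR n + 1)). split; [apply inv_nat_pos|].
    intros p Hp. apply N'. now exists p. }
  destruct (choice _ X) as [p Hp].
  apply (Nf p (fun _ => Fin (RtoC 0))); [|now exists (Fin (RtoC 0))].
  intros Rad eps He.
  destruct (INR_unbounded (Rad / (r0 / 8))) as [k Hk]. apply Rlt_div_l in Hk; [|lra].
  destruct (propagation f r0 k Lf H0 Hr (eps / 3)) as [e1 [He1 K1]]; [lra|].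
  destruct (propagation_step f r0 s e1 Lf H0 Hr Hs He1) as [e2 [He2 K2]].
  destruct (inv_nat_small e2 He2) as [n0 Hn0]. exists n0. intros n Hn z Hz. specialize (Hn0 n Hn).
  change (Cmod z <= Rad) in Hz. change (rhoS (f (z + p n)%C) (Fin (RtoC 0)) < eps).
  apply Rle_lt_trans with (2 * (eps / 3)); [|lra]. apply small_rhoS.
  apply (K1 (p n)).
  - intros y Hy. apply (K2 (p n)); [|lra]. intros x Hx.
    apply small_le with (/ (INR n + 1)); [lra|]. now apply Hp.
  - rewrite Cplus_comm, Cplus_sub_cancel. lra.
Qed.

(** Otherwise g = z^k G with G 0 nonzero, so |g| >= 2 c on a small circle and |Fn N| >= c there for
    a suitable N. The maximum principle for 1 / Fn N then gives |Fn N 0| >= c, whereas Fn N 0 is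
    within c / 2 of g 0 = 0. *)
Lemma hurwitz_nonvanishing (Fn : nat -> C -> C) (g : C -> C) (r : R) :
  0 < r -> (forall n, hol (Fn n) 0 r) -> (forall n (z : C), Cmod z < r -> Fn n z <> 0) ->
  (forall n (z : C), Cmod z < r -> Cmod (Fn n z) <= 1) ->
  (forall e, 0 < e -> exists N, forall n, (N <= n)%nat -> forall z : C, Cmod z < r ->
     Cmod (Fn n z - g z) <= e) ->
  g 0 = 0 -> exists d, 0 < d /\ forall z : C, Cmod z < d -> g z = 0.
Proof.
  intros Hr HF HZ H1 HU H0.
  assert (Hg : hol g 0 r).
  { apply weierstrass with Fn 2; auto. intros z Hz. destruct (HU 1 Rlt_0_1) as [N HN].
    specialize (HN N (le_n N) z Hz). specialize (H1 N z Hz).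
    replace (g z) with (Fn N z - (Fn N z - g z))%C by ring.
    pose proof (Cmod_triangle_minus (Fn N z) (Fn N z - g z)). lra. }
  destruct (zero_order_0 g r Hr Hg) as [Y|[k [G [HG [G0 E]]]]]; auto. exfalso.
  assert (Ha : 0 < Cmod (G 0)) by now apply Cmod_gt_0.
  destruct (hol_cont G 0 r 0 HG) with (eps := Cmod (G 0) / 2) as [d [Hd K]];
    [rewrite Cmod_sub_self; auto|lra|].
  set (t := Rmin d r / 2). assert (0 < Rmin d r) by now apply Rmin_pos.
  assert (Ht : 0 < t) by (unfold t; lra).
  assert (t < d) by (unfold t; pose proof (Rmin_l d r); lra).
  assert (t < r) by (unfold t; pose proof (Rmin_r d r); lra).
  set (c := t ^ k * (Cmod (G 0) / 2) / 2).
  assert (Hc : 0 < c).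
  { unfold c. assert (0 < t ^ k) by now apply pow_lt.
    assert (0 < t ^ k * (Cmod (G 0) / 2)) by (apply Rmult_lt_0_compat; lra). lra. }
  assert (Gc : forall z : C, Cmod z = t -> 2 * c <= Cmod (g z)).
  { intros z Hz. rewrite E, Cmod_mult, Cmod_pow, Hz.
    specialize (K z). rewrite Cmod_sub_0 in K. specialize (K ltac:(lra)).
    pose proof (Cmod_triangle_inv (G 0) (G z)) as T. rewrite Cmod_sub_sym in T.
    replace (2 * c) with (t ^ k * (Cmod (G 0) / 2)) by (unfold c; field).
    apply Rmult_le_compat_l; [left; now apply pow_lt|lra]. }
  destruct (HU (c / 2)) as [N HN]; [lra|]. specialize (HN N (le_n N)).
  assert (Fc : forall z : C, Cmod z = t -> c <= Cmod (Fn N z)).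
  { intros z Hz. specialize (HN z ltac:(lra)). specialize (Gc z Hz).
    pose proof (Cmod_triangle_inv (g z) (Fn N z)). rewrite Cmod_sub_sym in HN. lra. }
  assert (B : Cmod (/ Fn N 0) <= / c).
  { apply (maximum_modulus_0 (fun z => / Fn N z)%C r t); auto.
    - intros z Hz. apply ex_der_inv; [|now apply HF]. rewrite Cmod_sub_0 in Hz. now apply HZ.
    - intros z Hz. rewrite Cmod_inv by (apply HZ; lra). apply Rinv_le_contravar; auto.
    - now rewrite Cmod_0. }
  assert (N0 : Fn N 0 <> 0) by (apply HZ; now rewrite Cmod_0).
  rewrite Cmod_inv in B by auto.
  apply Rinv_le_contravar in B; [|now apply Rinv_0_lt_compat, Cmod_gt_0]. rewrite !Rinv_inv in B.
  specialize (HN 0 ltac:(rewrite Cmod_0; lra)). rewrite H0, Cmod_sub_0 in HN. lra.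
Qed.

(** Translates by points off A(delta) where f tends to 0 have no zero on a fixed disc, and a
    subsequence converges there to some g with g 0 = 0. By Hurwitz g vanishes near 0, so f becomes
    arbitrarily small on discs of one fixed radius. *)
Lemma bounded_below_off_zeros (f : Cplx -> sphere) (r0 : R) :
  locmero f -> nowhere f (Fin (RtoC 0)) -> in_N1 f -> 0 < r0 -> bounded_near_small f r0 ->
  forall delta, 0 < delta -> exists eps, 0 < eps /\ forall z, ~ inA f delta z -> ~ small eps (f z).
Proof.
  intros Lf H0 Nf Hr0 Hbd delta Hd. apply NNPP; intros N.
  assert (X : forall n : nat, exists z : C, ~ inA f delta z /\ small (/ (INR n + 1)) (f z)).
  { intros n. apply NNPP; intros N'. apply N. exists (/ (INR n + 1)). split; [apply inv_nat_pos|].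
    intros z Hz Sz. apply N'. now exists z. }
  destruct (choice _ X) as [p Hp].
  destruct (proj1 Nf p) as [phi [Hphi Hc]].
  (* The shift by 3 gives 1 / (phi (n + 3) + 1) <= 1/4, so every term, the first included, meets the
     threshold of [bounded_near_small]. *)
  set (q := fun n => p (phi (n + 3)%nat)).
  assert (Sq : forall n, small (/ (INR n + 1)) (f (q n)) /\ small (1 / 4) (f (q n))).
  { intros n. destruct (Hp (phi (n + 3)%nat)) as [_ S].
    pose proof (strictly_increasing_ge phi (n + 3) Hphi) as L. apply le_INR in L.
    rewrite plus_INR in L. simpl in L. pose proof (pos_INR n).
    split; eapply small_le; try exact S.
    - apply Rinv_le_contravar; lra.
    - replace (1 / 4) with (/ 4) by field. apply Rinv_le_contravar; lra. }
  set (r := Rmin r0 delta). assert (Hr : 0 < r) by now apply Rmin_pos.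
  assert (r <= r0) by apply Rmin_l. assert (r <= delta) by apply Rmin_r.
  set (Fn := fun n (z : C) => val (f (q n + z)%C)).
  assert (S1 : forall n (z : C), Cmod z < r -> small 1 (f (q n + z)%C)).
  { intros n z Hz. apply (Hbd (q n)); [apply Sq|]. rewrite Cplus_sub_cancel. lra. }
  assert (F1 : forall n (z : C), Cmod z < r -> Cmod (Fn n z) <= 1) by (intros; now apply small_val, S1).
  assert (Hcau : forall e, 0 < e -> exists M, forall n m, (M <= n)%nat -> (M <= m)%nat ->
    forall z : C, Cmod z < r -> Cmod (Fn n z - Fn m z) < e).
  { intros e He. destruct (Hc r e He) as [M HM]. exists M. intros n m Hn Hm z Hz.
    assert (B : rhoS (f (q n + z)%C) (f (q m + z)%C) < e).
    { rewrite !(Cplus_comm _ z). apply (HM (n + 3)%nat (m + 3)%nat); [lia|lia|].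
      change (Cmod z <= r). lra. }
    destruct (small_val 1 _ (S1 n z Hz)) as [E1 _]. destruct (small_val 1 _ (S1 m z Hz)) as [E2 _].
    rewrite E1, E2 in B. eapply Rle_lt_trans; [|exact B].
    eapply Rle_trans; [apply (Cmod_le_rhoS _ _ 1); now apply F1|]. unfold Fn. lra. }
  destruct (choice (fun (z l : C) => Cmod z < r -> forall e, 0 < e -> exists M, forall n, (M <= n)%nat ->
     Cmod (Fn n z - l) < e)) as [g Hg].
  { intros z. destruct (Rlt_dec (Cmod z) r) as [L|L]; [|exists z; tauto].
    destruct (C_complete (fun n => Fn n z)) as [l Hl].
    - intros e He. destruct (Hcau e He) as [M HM]. exists M. intros. now apply HM.
    - now exists l. }
  assert (HU : forall e, 0 < e -> exists M, forall n, (M <= n)%nat -> forall z : C, Cmod z < r ->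
     Cmod (Fn n z - g z) <= e).
  { intros e He. destruct (Hcau (e/2)) as [M HM]; [lra|]. exists M. intros n Hn z Hz.
    destruct (Hg z Hz (e/2)) as [M' HM']; [lra|].
    specialize (HM' (max M M') ltac:(lia)). specialize (HM n (max M M') Hn ltac:(lia) z Hz).
    pose proof (Cmod_sub_triangle (Fn n z) (Fn (max M M') z) (g z)). lra. }
  assert (g0 : g 0 = 0).
  { apply Cmod_eq_0, Rle_antisym; [|apply Cmod_ge_0]. apply Rnot_lt_le; intros Pg.
    destruct (HU (Cmod (g 0) / 4)) as [M HM]; [lra|].
    destruct (inv_nat_small (Cmod (g 0) / 4)) as [M' HM']; [lra|].
    specialize (HM (max M M') ltac:(lia) 0 ltac:(rewrite Cmod_0; lra)).
    specialize (HM' (max M M') ltac:(lia)).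
    destruct (Sq (max M M')) as [Sm _]. apply small_val in Sm. destruct Sm as [_ Sm].
    unfold Fn in HM. rewrite Cplus_0_r in HM. rewrite Cmod_sub_sym in HM.
    pose proof (Cmod_triangle_inv (g 0) (val (f (q (max M M'))))). lra. }
  destruct (hurwitz_nonvanishing Fn g r) as [d [Hd' Z]]; auto.
  - intros n. apply (hol_shift (fun z => val (f z)) (q n) r).
    apply (hol_sub _ (q n) (q n) r0 r); [rewrite Cmod_sub_self; lra|].
    apply hol_near_small; auto. apply Sq.
  - intros n z Hz E. apply (proj1 (Hp (phi (n + 3)%nat))). exists (q n + z)%C. split.
    + left. apply value_is_zero; auto. destruct (small_val 1 _ (S1 n z Hz)) as [E1 _].
      rewrite E1. now apply Fin_eq.
    + change (Cmod (q n - (q n + z)) < delta). rewrite Cmod_sub_sym, Cplus_sub_cancel. lra.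
  - destruct (not_uniformly_small f r0 (Rmin d r) Lf Nf Hr0 Hbd) as [eps [He K]]; [now apply Rmin_pos|].
    destruct (HU eps He) as [M HM]. specialize (HM M (le_n M)). apply (K (q M)). intros z Hz.
    pose proof (Rmin_l d r). pose proof (Rmin_r d r).
    assert (Hz' : Cmod (z - q M) < r) by lra.
    specialize (HM _ Hz'). rewrite Z, Cmod_sub_0 in HM by lra. unfold Fn in HM.
    pose proof (small_val 1 _ (S1 M _ Hz')) as [E _]. rewrite Cplus_sub in *.
    exists (val (f z)). now split.
Qed.

Lemma not_small_iota (e : R) (u : sphere) : 0 < e -> ~ small e u -> small (/ e) (iota u).
Proof.
  intros He H. destruct u as [w|].
  - assert (Hw : e < Cmod w) by (apply Rnot_le_lt; intros L; apply H; now exists w).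
    assert (w <> RtoC 0) by (apply Cmod_gt_0; lra).
    rewrite iota_Some by auto. exists (/ w)%C; split; auto. rewrite Cmod_inv by auto.
    apply Rinv_le_contravar; lra.
  - exists (RtoC 0). split; auto. rewrite Cmod_0. left. now apply Rinv_0_lt_compat.
Qed.

Fixpoint divisor_poly (l : list (Cplx * nat)) (z : C) : C :=
  match l with
  | nil => 1%C
  | (a, k) :: l' => ((z - a) ^ k * divisor_poly l' z)%C
  end.

Lemma divisor_poly_ge (l : list (Cplx * nat)) (z : C) (A : R) :
  0 <= A -> Forall (fun q => A <= Cmod (z - fst q)) l -> A ^ total_mult l <= Cmod (divisor_poly l z).
Proof.
  intros HA. induction 1 as [|[a k] l Ha _ IH]; simpl; [rewrite Cmod_1; lra|].
  rewrite Cmod_mult, Cmod_pow, pow_add. simpl in Ha.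
  apply Rmult_le_compat; auto using pow_le. now apply pow_incr.
Qed.

Lemma divisor_poly_le (l : list (Cplx * nat)) (z : C) (B : R) :
  Forall (fun q => Cmod (z - fst q) <= B) l -> Cmod (divisor_poly l z) <= B ^ total_mult l.
Proof.
  induction 1 as [|[a k] l Ha _ IH]; simpl; [rewrite Cmod_1; lra|].
  rewrite Cmod_mult, Cmod_pow, pow_add. simpl in Ha.
  apply Rmult_le_compat; auto using Cmod_ge_0, pow_le. apply pow_incr; split; auto using Cmod_ge_0.
Qed.

(** Only a lower bound for the order of vanishing: g may be 0 at the point. *)
Definition local_factor (F : C -> C) (q : Cplx * nat) : Prop :=
  exists r, 0 < r /\ exists g : C -> C, hol g (fst q) r /\
    forall z : C, Cmod (z - fst q) < r -> F z = ((z - fst q) ^ snd q * g z)%C.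

(** One point a is divided out at a time; near every other point b of the list the factor (z - a)^-k
    is holomorphic and is absorbed into the cofactor at b. *)
Lemma divide_divisor (p : C) (Rad : R) (l : list (Cplx * nat)) : forall F : C -> C,
  hol F p Rad -> NoDup (map fst l) -> Forall (local_factor F) l ->
  exists G, hol G p Rad /\ forall z, F z = (divisor_poly l z * G z)%C.
Proof.
  induction l as [|[a k] l IH]; intros F HF Hl HL.
  { exists F; split; auto. intros z; simpl; ring. }
  inversion_clear Hl as [|? ? Na Nl]. inversion_clear HL as [|? ? Fa Fl].
  destruct Fa as [r [Hr [g [Hg E]]]]. simpl fst in *; simpl snd in *.
  set (G := fun z => if Ceq_dec z a then g a else (F z / (z - a) ^ k)%C).
  assert (Gne : forall z : C, z <> a -> G z = (F z / (z - a) ^ k)%C).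
  { intros z N. unfold G. now destruct (Ceq_dec z a). }
  assert (Ga : forall z : C, Cmod (z - a) < r -> G z = g z).
  { intros z Hz. unfold G. destruct (Ceq_dec z a) as [->|N]; auto. rewrite E by auto.
    field. now apply Cpow_nz, Csub_neq_0. }
  assert (HFG : forall z, F z = ((z - a) ^ k * G z)%C).
  { intros z. destruct (Ceq_dec z a) as [->|N].
    - rewrite E, Ga; auto; rewrite Cmod_sub_self; auto.
    - rewrite Gne by auto. field. now apply Cpow_nz, Csub_neq_0. }
  assert (Dden : forall z : C, z <> a -> ex_der (fun z => / (z - a) ^ k)%C z).
  { intros z N. apply ex_der_inv; [now apply Cpow_nz, Csub_neq_0|].
    apply (ex_der_pow (fun z => z - a)%C). apply ex_der_minus; auto using ex_der_id, ex_der_const. }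
  assert (Near : forall z : C, z <> a -> 0 < Cmod (z - a) /\
     forall y : C, Cmod (y - z) < Cmod (z - a) -> y <> a).
  { intros z N. split; [now apply Cmod_gt_0, Csub_neq_0|]. intros y Hy ->.
    rewrite Cmod_sub_sym in Hy. lra. }
  destruct (IH G) as [H [HH EH]]; auto.
  - intros z Hz. destruct (Ceq_dec z a) as [->|N].
    + apply ex_der_ext_loc with g r; auto.
      * intros y Hy. symmetry. now apply Ga.
      * apply Hg. now rewrite Cmod_sub_self.
    + destruct (Near z N) as [Hn Hn'].
      apply ex_der_ext_loc with (fun z => F z * / (z - a) ^ k)%C (Cmod (z - a)); auto.
      * intros y Hy. symmetry. now apply Gne, Hn'.
      * apply ex_der_mult; auto.
  - apply Forall_forall. intros [b m] Hb. rewrite Forall_forall in Fl.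
    destruct (Fl _ Hb) as [s [Hs [h [Hh Eh]]]]. simpl fst in *; simpl snd in *.
    assert (Nb : b <> a) by (intros ->; apply Na; now apply (in_map fst) in Hb).
    destruct (Near b Nb) as [Hn Hn'].
    exists (Rmin s (Cmod (b - a))). split; [now apply Rmin_pos|].
    pose proof (Rmin_l s (Cmod (b - a))). pose proof (Rmin_r s (Cmod (b - a))).
    exists (fun z => h z * / (z - a) ^ k)%C. simpl fst; simpl snd. split.
    + intros z Hz. apply ex_der_mult; [apply Hh; lra|]. apply Dden, Hn'. lra.
    + intros z Hz. rewrite Gne by (apply Hn'; lra). rewrite Eh by lra. unfold Cdiv. ring.
  - exists H; split; auto. intros z. rewrite HFG, EH. simpl. ring.
Qed.

Lemma zeros_cluster_bound (f : Cplx -> sphere) (r0 : R) :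
  locmero f -> in_N1 f -> 0 < r0 -> bounded_near_small f r0 ->
  exists s N0, 0 < s /\ forall (p : C) (l : list (Cplx * nat)), NoDup (map fst l) ->
    Forall (fun q => Cmod (fst q - p) < s /\ is_zero_of_order f (fst q) (snd q)) l ->
    (total_mult l <= N0)%nat.
Proof.
  (* With 8 s = r0, a zero within s of p makes |f| <= 1 on the disc of radius 6 s about p. On the
     circle of radius 5 s each linear factor is at least 4 s, on the disc of radius s at most 2 s:
     every zero gains a factor 1/2. *)
  intros Lf Nf Hr0 Hbd. set (s := r0 / 8). assert (Hs : 0 < s) by (unfold s; lra).
  destruct (not_uniformly_small f r0 s Lf Nf Hr0 Hbd Hs) as [eps [He K]].
  destruct (half_pow_small eps He) as [N0 HN0].
  exists s, N0. split; auto. intros p l Hl HL. apply Nat.nlt_ge; intros LN.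
  destruct l as [|[a k] l0] eqn:El; [simpl in LN; lia|]. rewrite <- El in *.
  assert (Ha : Cmod (a - p) < s /\ is_zero_of_order f a k).
  { rewrite Forall_forall in HL. apply (HL (a, k)). rewrite El. now left. }
  destruct Ha as [Da Za]. set (N := total_mult l) in *.
  assert (Sa : small (1 / 4) (f a)).
  { exists (RtoC 0). rewrite Cmod_0. split; [|lra]. apply is_zero_value. now exists k. }
  assert (S1 : forall z : C, Cmod (z - p) < 6 * s -> small 1 (f z)).
  { intros z Hz. apply (Hbd a); auto. pose proof (Cmod_sub_triangle z p a).
    rewrite (Cmod_sub_sym p a) in *. unfold s in *. lra. }
  assert (HF : hol (fun z => val (f z)) p (6 * s)).
  { apply locmero_hol_val; auto. intros z Hz. destruct (S1 z Hz) as [w [-> _]]. discriminate. }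
  rewrite Forall_forall in HL.
  destruct (divide_divisor p (6 * s) l (fun z => val (f z)) HF Hl) as [G [HG EG]].
  { apply Forall_forall. intros q Hq. destruct (HL q Hq) as [_ Zq].
    apply is_zero_of_order_iff in Zq. destruct Zq as [_ [r [Hr [g [Hg [_ E]]]]]].
    exists r; split; auto. exists g; split; auto. intros z Hz. now rewrite E. }
  apply (K p). intros z Hz. exists (val (f z)). split; [apply (small_val 1), S1; lra|].
  assert (P4 : 0 < (4 * s) ^ N) by (apply pow_lt; lra).
  assert (BG : Cmod (G z) <= / (4 * s) ^ N).
  { apply (maximum_modulus G p (6 * s) (5 * s)); auto; try lra. intros y Hy.
    assert (By : Cmod (val (f y)) <= 1) by (apply (small_val 1), S1; lra).
    rewrite EG, Cmod_mult in By.
    assert (Py : (4 * s) ^ N <= Cmod (divisor_poly l y)).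
    { apply divisor_poly_ge; [lra|]. apply Forall_forall. intros q Hq. destruct (HL q Hq) as [Dq _].
      pose proof (Cmod_sub_triangle y (fst q) p). lra. }
    apply Rmult_le_reg_l with ((4 * s) ^ N); auto. rewrite Rinv_r by lra.
    eapply Rle_trans; [|exact By]. apply Rmult_le_compat_r; auto using Cmod_ge_0. }
  assert (BQ : Cmod (divisor_poly l z) <= (2 * s) ^ N).
  { apply divisor_poly_le. apply Forall_forall. intros q Hq. destruct (HL q Hq) as [Dq _].
    pose proof (Cmod_sub_triangle z p (fst q)). rewrite (Cmod_sub_sym p (fst q)) in *. lra. }
  rewrite EG, Cmod_mult. apply Rle_trans with ((2 * s) ^ N * / (4 * s) ^ N).
  - apply Rmult_le_compat; auto using Cmod_ge_0.
  - rewrite <- pow_inv, <- Rpow_mult_distr. replace (2 * s * / (4 * s)) with (/ 2) by (field; lra).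
    left. apply Rle_lt_trans with ((/ 2) ^ N0); auto.
    replace N with (N0 + (N - N0))%nat by lia. rewrite pow_add.
    assert (0 < (/ 2) ^ N0) by (apply pow_lt; lra).
    assert ((/ 2) ^ (N - N0) <= 1) by (rewrite <- (pow1 (N - N0)); apply pow_incr; lra). nra.
Qed.

Lemma total_mult_filter (b : Cplx * nat -> bool) (l : list (Cplx * nat)) :
  total_mult l = (total_mult (filter b l) + total_mult (filter (fun q => negb (b q)) l))%nat.
Proof. induction l as [|q l IH]; simpl; auto. destruct (b q); simpl; lia. Qed.

Lemma NoDup_map_filter (b : Cplx * nat -> bool) (l : list (Cplx * nat)) :
  NoDup (map fst l) -> NoDup (map fst (filter b l)).
Proof.
  induction l as [|q l IH]; simpl; auto. intros H. inversion_clear H as [|? ? Nq Nl].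
  destruct (b q); auto. simpl. constructor; auto. intros Hq. apply Nq.
  apply in_map_iff in Hq. destruct Hq as [x [E Hx]]. apply filter_In in Hx.
  rewrite <- E. now apply in_map.
Qed.

(** Passes from small discs to the unit disc that they cover: entries in the first disc are split
    off before the induction, so overlaps do no harm. *)
Lemma total_mult_cover (Ps : list (Cplx * nat -> Prop)) (N0 : nat) : forall l : list (Cplx * nat),
  NoDup (map fst l) ->
  (forall P, In P Ps -> forall l', NoDup (map fst l') -> Forall P l' -> (total_mult l' <= N0)%nat) ->
  Forall (fun q => exists P, In P Ps /\ P q) l -> (total_mult l <= length Ps * N0)%nat.
Proof.
  induction Ps as [|P Ps IH]; intros l Hl HB HC.
  - destruct HC as [|q l [P [[] _]]]. simpl; lia.
  - set (b := fun q => if excluded_middle_informative (P q) then true else false).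
    rewrite (total_mult_filter b l). simpl.
    rewrite Forall_forall in HC. apply Nat.add_le_mono.
    + apply (HB P); [now left|now apply NoDup_map_filter|]. apply Forall_forall. intros q Hq.
      apply filter_In in Hq. destruct Hq as [_ Hq]. unfold b in Hq.
      now destruct (excluded_middle_informative (P q)).
    + apply IH; [now apply NoDup_map_filter| |].
      * intros Q HQ. apply HB. now right.
      * apply Forall_forall. intros q Hq. apply filter_In in Hq. destruct Hq as [Hq Bq]. unfold b in Bq.
        destruct (HC q Hq) as [Q [[<-|HQ] Qq]]; [|now exists Q].
        now destruct (excluded_middle_informative (P q)).
Qed.

Lemma zeros_relatively_dense (f : Cplx -> sphere) (r0 : R) :
  locmero f -> nowhere f None -> nowhere f (Fin (RtoC 0)) -> in_N1 f ->
  0 < r0 -> bounded_near_small f r0 -> unif_cont f ->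
  exists R0, forall w : C, exists a, is_zero f a /\ Cmod (a - w) < R0.
Proof.
  intros Lf HN H0 Nf Hr0 Hbd Uf. apply NNPP; intros N.
  (* Estimates are wanted on the disc of radius n + 1; the margin 1 absorbs delta <= 1. *)
  assert (X : forall n : nat, exists w : C, forall a, is_zero f a -> INR n + 2 <= Cmod (a - w)).
  { intros n. apply NNPP; intros N'. apply N. exists (INR n + 2). intros w. apply NNPP; intros N2.
    apply N'. exists w. intros a Ha. apply Rnot_lt_le. intros L. apply N2. now exists a. }
  destruct (choice _ X) as [w Hw].
  destruct (Uf 1 Rlt_0_1) as [d [Hd K]].
  set (delta := Rmin 1 d). assert (Hdel : 0 < delta) by (apply Rmin_pos; lra).
  assert (delta <= 1) by apply Rmin_l. assert (delta <= d) by apply Rmin_r.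
  destruct (bounded_below_off_zeros f r0 Lf H0 Nf Hr0 Hbd delta Hdel) as [e1 [He1 K1]].
  set (e := Rmin e1 (1 / 4)). assert (He : 0 < e) by (apply Rmin_pos; lra).
  assert (e <= e1) by apply Rmin_l. assert (e <= 1 / 4) by apply Rmin_r.
  (* If |f z| <= e, then z is not near a zero, as there is none around, nor near a pole, since its
     image would be within 1/2 of 0 and within 1 of infinity; off A(delta) the lower bound e1
     applies. *)
  assert (Hns : forall n (z : C), Cmod (z - w n) < INR n + 1 -> small (/ e) (flip f z)).
  { intros n z Hz. apply not_small_iota; auto. intros S.
    destruct (classic (inA f delta z)) as [[c [[Zc|Pc] Dc]]|NA]; try change (Cmod (z - c) < delta) in Dc.
    - specialize (Hw n c Zc). pose proof (Cmod_sub_triangle c z (w n)).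
      rewrite (Cmod_sub_sym c z) in *. lra.
    - specialize (K z c ltac:(lra)). rewrite (is_pole_value f c Pc) in K.
      apply small_rhoS in S. pose proof (rhoS_triangle (Fin (RtoC 0)) (f z) None).
      rewrite rhoS_0_oo, (rhoS_sym (Fin (RtoC 0)) (f z)) in *. lra.
    - apply (K1 z NA). now apply small_le with e. }
  set (u := fun z : C => val (flip f z)). set (M := / e).
  assert (HM : 0 < M) by now apply Rinv_0_lt_compat.
  assert (HL : forall n (z : C), Cmod (z - w n) <= (INR n + 1) / 4 ->
     Cmod (u z - u (w n)) <= 4 * M / (INR n + 1) * Cmod (z - w n)).
  { intros n z Hz. pose proof (pos_INR n).
    apply cauchy_lipschitz; auto; [lra| |].
    - apply locmero_hol_val; [now apply locmero_flip|]. intros y Hy.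
      destruct (Hns n y Hy) as [v [-> _]]. discriminate.
    - intros y Hy. apply (small_val M (flip f y)), (Hns n), Hy. }
  destruct (in_N1_flip f Nf) as [NF1 NF2].
  destruct (NF1 w) as [phi [Hphi Hc]].
  assert (Ew : forall n, small M (flip f (w n))).
  { intros n. apply (Hns n). rewrite Cmod_sub_self. pose proof (pos_INR n). lra. }
  destruct (C_complete (fun n => u (w (phi n)))) as [l Hl].
  { intros eps Heps. pose proof (pow2_ge_0 M).
    (* Only the values at the centres need a limit, so the disc of radius 0 is enough; the factor
       converts [rhoS] to the euclidean distance on |u| <= M. *)
    destruct (Hc 0 (2 * eps / (1 + M ^ 2))) as [N1 HN1]; [apply Rdiv_lt_0_compat; lra|].
    exists N1. intros n m Hn Hm. specialize (HN1 n m Hn Hm (RtoC 0)).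
    change (Cmod 0 <= 0 -> rhoS (flip f (0 + w (phi n))%C) (flip f (0 + w (phi m))%C) < 2 * eps / (1 + M ^ 2)) in HN1.
    rewrite Cmod_0, !Cplus_0_l in HN1. specialize (HN1 (Rle_refl 0)).
    destruct (small_val M _ (Ew (phi n))) as [E1 B1]. destruct (small_val M _ (Ew (phi m))) as [E2 B2].
    rewrite E1, E2 in HN1. eapply Rle_lt_trans; [apply (Cmod_le_rhoS _ _ M); auto|].
    unfold u. apply (Rlt_div_r _ (2 * eps)) in HN1; lra. }
  apply (NF2 (fun n => w (phi n)) (fun _ => Fin l)); [|now exists (Fin l)].
  intros Rad eps Heps. set (Q := Rmax Rad 1). assert (HQ1 : 1 <= Q) by apply Rmax_r.
  assert (HQ : Rad <= Q) by apply Rmax_l.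
  destruct (Hl (eps / 8)) as [N1 HN1]; [lra|].
  (* N2 brings the disc of radius Q into the range of the Lipschitz bound, N3 makes that bound at
     most eps / 8; with eps / 8 from the centres and the factor 2 of [rhoS_Some_le] the total stays
     below eps / 2. *)
  destruct (INR_unbounded (4 * Q)) as [N2 HN2].
  destruct (INR_unbounded (32 * M * Q / eps)) as [N3 HN3]. apply Rlt_div_l in HN3; auto.
  exists (max N1 (max N2 N3)). intros n Hn z Hz. change (Cmod z <= Rad) in Hz.
  change (rhoS (flip f (z + w (phi n))%C) (Fin l) < eps).
  pose proof (strictly_increasing_ge phi n Hphi) as Ln.
  assert (L2 : INR N2 <= INR (phi n)) by (apply le_INR; lia).
  assert (L3 : INR N3 <= INR (phi n)) by (apply le_INR; lia).
  specialize (HN1 n ltac:(lia)).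
  set (z' := (z + w (phi n))%C).
  assert (Dz : Cmod (z' - w (phi n)) <= Q).
  { unfold z'. rewrite Cplus_comm, Cplus_sub_cancel. lra. }
  specialize (HL (phi n) z' ltac:(lra)).
  assert (B : 4 * M / (INR (phi n) + 1) * Cmod (z' - w (phi n)) <= eps / 8).
  { apply Rle_trans with (4 * M / (INR (phi n) + 1) * Q).
    - apply Rmult_le_compat_l; auto. apply Rdiv_le_0_compat; lra.
    - replace (4 * M / (INR (phi n) + 1) * Q) with (4 * M * Q / (INR (phi n) + 1)) by (field; lra).
      apply Rle_div_l; [lra|]. nra. }
  destruct (small_val M (flip f z')) as [E _]; [apply (Hns (phi n)); lra|].
  rewrite E. eapply Rle_lt_trans; [apply rhoS_Some_le|].
  pose proof (Cmod_sub_triangle (u z') (u (w (phi n))) l). unfold u in *. lra.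
Qed.

(** 0 and infinity are at spherical distance 2, so uniform continuity with tolerance 1 keeps their
    preimages apart. *)
Lemma zeros_poles_separated (f : Cplx -> sphere) : unif_cont f ->
  exists eta, eta > 0 /\ forall a b, is_zero f a -> is_pole f b -> eta <= Cnorm (Csub a b).
Proof.
  intros Uf. destruct (Uf 1 Rlt_0_1) as [d [Hd K]]. exists d; split; auto.
  intros a b Ha Hb. apply Rnot_lt_le. intros L. specialize (K a b L).
  rewrite (is_zero_value f a Ha), (is_pole_value f b Hb), rhoS_0_oo in K. lra.
Qed.

Theorem in_N1_conditions (f : Cplx -> sphere) (Hf : meromorphic f) :
  in_N1 f ->
  (forall delta, delta > 0 -> exists Cd, forall z, ~ inA f delta z ->
     exists w, f z = Some w /\ / Cd <= Cnorm w /\ Cnorm w <= Cd) /\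
  (exists eta, eta > 0 /\ forall a b, is_zero f a -> is_pole f b -> eta <= Cnorm (Csub a b)) /\
  (exists C0 : R, forall (c : Cplx) (l : list (Cplx * nat)), NoDup (map fst l) ->
     Forall (fun p => Cnorm (Csub (fst p) c) <= 1 /\
       (is_zero_of_order f (fst p) (snd p) \/ is_pole_of_order f (fst p) (snd p))) l ->
     INR (total_mult l) < C0) /\
  (exists R0, forall w : Cplx, (exists a, is_zero f a /\ Cnorm (Csub a w) < R0) /\
     (exists b, is_pole f b /\ Cnorm (Csub b w) < R0)).
Proof.
  intros Nf. pose proof (meromorphic_locmero f Hf) as Lf. pose proof (locmero_flip f Lf) as Lf'.
  pose proof (in_N1_flip f Nf) as Nf'.
  assert (HN : nowhere f None) by (apply nowhere_None; auto; apply Hf).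
  assert (H0 : nowhere f (Fin (RtoC 0))).
  { apply nowhere_0; auto. apply NNPP; intros N.
    assert (E : forall z, f z = Fin (RtoC 0)) by (intros z; apply NNPP; intros E; apply N; now exists z).
    (* The translates by 0 converge to f, so f itself must not be constant. *)
    apply (proj2 Nf (fun _ => Czero) f); [|now exists (Fin (RtoC 0))].
    intros Rad eps He. exists 0%nat. intros n _ z _. unfold translate. rewrite !E, rhoS_refl. exact He. }
  assert (HN' : nowhere (flip f) None) by (rewrite <- iota_0; now apply nowhere_flip).
  assert (H0' : nowhere (flip f) (Fin (RtoC 0))) by exact (nowhere_flip f None HN).
  pose proof (normal_unif_cont f Lf (proj1 Nf)) as Uf.
  pose proof (normal_unif_cont _ Lf' (proj1 Nf')) as Uf'.
  destruct (unif_cont_bounded_near_small f Uf) as [r1 [Hr1 B1]].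
  destruct (unif_cont_bounded_near_small _ Uf') as [r2 [Hr2 B2]].
  split; [|split; [|split]].
  - intros delta Hd.
    destruct (bounded_below_off_zeros f r1 Lf H0 Nf Hr1 B1 delta Hd) as [e1 [He1 K1]].
    destruct (bounded_below_off_zeros _ r2 Lf' H0' Nf' Hr2 B2 delta Hd) as [e2 [He2 K2]].
    exists (Rmax (/ e1) (/ e2)). intros z Hz.
    pose proof (Rinv_0_lt_compat _ He1). pose proof (Rmax_l (/ e1) (/ e2)).
    assert (S2 : small (/ e2) (f z)).
    { rewrite <- (iota_involutive (f z)). apply not_small_iota; auto. apply K2. now rewrite inA_flip. }
    destruct S2 as [w [E Bw]]. exists w. split; auto. split.
    + apply Rle_trans with e1.
      * rewrite <- (Rinv_inv e1) at 2. apply Rinv_le_contravar; auto.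
      * left. apply Rnot_le_lt. intros L. apply (K1 z Hz). now exists w.
    + eapply Rle_trans; [exact Bw|apply Rmax_r].
  - now apply zeros_poles_separated.
  - destruct (zeros_cluster_bound f r1 Lf Nf Hr1 B1) as [s1 [N1 [Hs1 K1]]].
    destruct (zeros_cluster_bound _ r2 Lf' Nf' Hr2 B2) as [s2 [N2 [Hs2 K2]]].
    (* Fixed nets of the closed unit disc, translated by c, cover every unit disc by clusters whose
       number does not depend on c; L1 serves the zeros and L2 the poles. *)
    destruct (finite_net 1 s1 Hs1) as [L1 HL1]. destruct (finite_net 1 s2 Hs2) as [L2 HL2].
    set (N0 := max N1 N2). exists (INR ((length L1 + length L2) * N0) + 1). intros c l Hl HF.
    set (P1 := fun (y : C) (q : Cplx * nat) => Cmod (fst q - (c + y)) < s1 /\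
       is_zero_of_order f (fst q) (snd q)).
    set (P2 := fun (y : C) (q : Cplx * nat) => Cmod (fst q - (c + y)) < s2 /\
       is_zero_of_order (flip f) (fst q) (snd q)).
    assert (B : (total_mult l <= length (map P1 L1 ++ map P2 L2) * N0)%nat).
    { apply total_mult_cover; auto.
      - intros P HP l' Hl' HF'. apply in_app_or in HP.
        destruct HP as [HP|HP]; apply in_map_iff in HP; destruct HP as [y [<- _]].
        + apply Nat.le_trans with N1; [|unfold N0; lia]. now apply (K1 (c + y)%C).
        + apply Nat.le_trans with N2; [|unfold N0; lia]. now apply (K2 (c + y)%C).
      - eapply Forall_impl; [|exact HF]. intros q [Dq Zq].
        change (Cmod (fst q - c) <= 1) in Dq.
        assert (T : forall y : C, (fst q - (c + y))%C = (fst q - c - y)%C) by (intros; ring).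
        destruct Zq as [Zq|Zq].
        + destruct (HL1 _ Dq) as [y [Hy Dy]]. exists (P1 y). split.
          * apply in_or_app; left. now apply in_map.
          * unfold P1. now rewrite T.
        + destruct (HL2 _ Dq) as [y [Hy Dy]]. exists (P2 y). split.
          * apply in_or_app; right. now apply in_map.
          * unfold P2. rewrite T. split; auto. now apply pole_to_flip. }
    rewrite length_app, !length_map in B. apply le_INR in B. lra.
  - destruct (zeros_relatively_dense f r1) as [R1 K1]; auto.
    destruct (zeros_relatively_dense (flip f) r2) as [R2 K2]; auto.
    exists (Rmax R1 R2). pose proof (Rmax_l R1 R2). pose proof (Rmax_r R1 R2). intros w. split.
    + destruct (K1 w) as [a [Ha Da]]. exists a; split; auto. change (Cmod (a - w) < Rmax R1 R2). lra.
    + destruct (K2 w) as [b [Hb Db]]. exists b; split; [now apply is_zero_flip|].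
      change (Cmod (b - w) < Rmax R1 R2). lra.
Qed.

Theorem mainTheorem11 (f : Cplx -> sphere) (Hf : meromorphic f) :
  in_N1 f <->
  ( (* (a) *)
    (forall delta, delta > 0 -> exists Cd, forall z, ~ inA f delta z ->
        exists w, f z = Some w /\ / Cd <= Cnorm w /\ Cnorm w <= Cd)
  /\ (* (b1) inf |a_n - b_k| > 0 *)
    (exists eta, eta > 0 /\ forall a b, is_zero f a -> is_pole f b ->
        eta <= Cnorm (Csub a b))
  /\ (* (b2) zeros plus poles counted with multiplicity in closed unit discs *)
    (exists C0 : R, forall (c : Cplx) (l : list (Cplx * nat)),
        NoDup (map fst l) ->
        Forall (fun p => Cnorm (Csub (fst p) c) <= 1 /\
                  (is_zero_of_order f (fst p) (snd p) \/
                   is_pole_of_order f (fst p) (snd p))) l ->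
        INR (total_mult l) < C0)
  /\ (* (b3) relative density of zeros and of poles *)
    (exists R0, forall w : Cplx,
        (exists a, is_zero f a /\ Cnorm (Csub a w) < R0) /\
        (exists b, is_pole f b /\ Cnorm (Csub b w) < R0)) ).
Proof.
  split; [now apply in_N1_conditions|].
  intros [Ha [Hb1 [Hb2 Hb3]]]. now apply conditions_in_N1.
Qed.
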